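(* Let $(\lambda,u,\sigma)$ be the solution of the mixed Laplace eigenvalue problem (M), let $(\lambda_h,u_h,\sigma_h)$ be the corresponding discrete solution of (M$_h$), let $u_h^*\in U_h^*$ be the post-processed eigenfunction, and let $\sigma_h^*\in\Sigma_h^*$ be the post-processed flux (all defined in the context). Then $$-\operatorname{div}\sigma_h^*=\lambda_h u_h^* .$$ Moreover, if $s>1/2$ and the solution has the regularity $\sigma\in H(\operatorname{div},\Omega)\cap H^s(\Omega,\mathbb{R}^d)$, then, with $r=\min\{s,k+1\}$ and $r'=\min\{s,k+2\}$, there holds the a priori error estimate $$\|\sigma-\sigma_h^*\|_0\lesssim h^{r'}\,\big(|u|_{r+1}+|u|_{r'+1}\big).$$
   Context: Setting. $\Omega\subset\mathbb{R}^d$ is a polygon ($d=2$) or polyhedron ($d=3$). $(\cdot,\cdot)$ and $\|\cdot\|_0$ are the $L^2(\Omega)$ inner product and norm, $(\cdot,\cdot)_K$ is the $L^2(K)$ inner product, $|\cdot|_t$ is the $H^t(\Omega)$-seminorm. Problem (M): find $\lambda\in\mathbb{R}$, $u\in L^2(\Omega)$, $\sigma\in H(\operatorname{div},\Omega)$ with $-(\sigma,\tau)-(\operatorname{div}\tau,u)=0$ for all $\tau\in H(\operatorname{div},\Omega)$ and $-(\operatorname{div}\sigma,v)=\lambda(u,v)$ for all $v\in L^2(\Omega)$. (Thus $\sigma=\nabla u$, $u\in H^1_0(\Omega)$.) Let $\mathcal{C}_h$ range over a family of regular (conforming, shape-regular) simplicial triangulations of $\Omega$ with mesh size $h\to0$,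 with set of facets $\mathcal{F}_h$. Let $k\ge1$ be a fixed integer; $\mathbb{P}^l(K)$ are the polynomials of order $l$ on $K$ and $\mathbb{P}^l(K,\mathbb{R}^d)$ the vector-valued version. Set $U_h=\{v_h\in L^2(\Omega): v_h|_K\in\mathbb{P}^k(K)\ \forall K\in\mathcal{C}_h\}$, $\Sigma_h=\{\tau_h\in H(\operatorname{div},\Omega):\tau_h|_K\in\mathbb{P}^{k+1}(K,\mathbb{R}^d)\ \forall K\in\mathcal{C}_h\}$. Problem (M$_h$): find $\lambda_h\in\mathbb{R}$, $u_h\in U_h$, $\sigma_h\in\Sigma_h$ with $-(\sigma_h,\tau_h)-(\operatorname{div}\tau_h,u_h)=0$ for all $\tau_h\in\Sigma_h$ and $-(\operatorname{div}\sigma_h,v_h)=\lambda_h(u_h,v_h)$ for all $v_h\in U_h$. Standing assumptions. $\lambda$ is a simple eigenvalue, $\|u\|_0=\|u_h\|_0=1$ and $(u,u_h)>0$. The discrete solution $(\lambda_h,u_h,\sigma_h)$ is the one approximating $(\lambda,u,\sigma)$: for $u\in H^{1+s}(\Omega)$, $\sigma\in H(\operatorname{div},\Omega)\cap H^s(\Omega,\mathbb{R}^d)$, $s>1/2$, $r=\min\{s,k+1\}$, $r'=\min\{s,k+2\}$ it satisfies $\|u-u_h\|_0\lesssim h^r|u|_{r+1}$, $\|\sigma-\sigma_h\|_0\lesssim h^{r'}|u|_{r'+1}$, $\|\operatorname{div}(\sigma-\sigma_h)\|_0\lesssim h^r(|u|_{r+1}+|u|_{r'+1})$ and $|\lambda-\lambda_h|\lesssim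 h^{2r}(|u|_{r+1}+|u|_{r'+1})$. Here $a\lesssim b$ means $a\le Cb$ with $C$ independent of $h$ (it may depend on $\Omega$, $k$, $s$, the shape regularity and the eigenpair $(\lambda,u)$), for all sufficiently small $h$. Post-processed eigenfunction. $\Pi^l$ is the $L^2$-projection onto element-wise polynomials of order $l$. $U_h^*=\{v_h\in L^2(\Omega):v_h|_K\in\mathbb{P}^{k+2}(K)\ \forall K\in\mathcal{C}_h\}$. $u_h^*\in U_h^*$ is defined by $(\nabla u_h^*,\nabla v_h^* )_K=(\sigma_h,\nabla v_h^* )_K$ for all $v_h^*\in(\mathrm{id}-\Pi^k)|_K\mathbb{P}^{k+2}(K)$ and all $K\in\mathcal{C}_h$, together with $\Pi^ku_h^*=u_h$. Post-processed flux. $\Sigma_h^*=\{\tau_h\in H(\operatorname{div},\Omega):\tau_h|_K\in\mathbb{P}^{k+3}(K,\mathbb{R}^d)\ \forall K\in\mathcal{C}_h,\ \tau_h\cdot n|_F\in\mathbb{P}^{k+1}(F)\ \forall F\in\mathcal{F}_h\}$ and $\mathbb{H}^{k+3}(K)=\{l_h\in\mathbb{P}^{k+3}(K,\mathbb{R}^d):\operatorname{div}l_h=0,\ l_h\cdot n|_{\partial K}=0\}$. $\sigma_h^*\in\Sigma_h^*$ is defined by the (unisolvent) conditions $\int_F(\sigma_h^*-\sigma_h)\cdot n\,r_h\,ds=0$ for all $r_h\in\mathbb{P}^{k+1}(F)$, $F\in\mathcal{F}_h$; $\int_K(\operatorname{div}\sigma_h^*+\lambda_hu_h^* )\,q_h\,dx=0$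 for all $q_h\in\mathbb{P}^{k+2}(K)/\mathbb{P}^0(K)$ (represented by polynomials with zero mean on $K$), $K\in\mathcal{C}_h$; $\int_K(\sigma_h^*-\sigma_h)\cdot l_h\,dx=0$ for all $l_h\in\mathbb{H}^{k+3}(K)$, $K\in\mathcal{C}_h$. *)

(* Defs.v *)
From HB Require Import structures.
From mathcomp Require Import all_boot all_order all_algebra.
From mathcomp Require Import all_classical all_reals all_analysis.
From mathcomp Require mpoly.
Set Implicit Arguments.
Unset Strict Implicit.
Unset Printing Implicit Defensive.
Import Order.TTheory GRing.Theory Num.Theory numFieldNormedType.Exports.
Local Open Scope classical_set_scope.
Local Open Scope ring_scope.

(* The sigma-algebra generated by the coordinates, i.e. the Borel sets. *)
Section rV_measurable.
Context {R : realType} (n : nat).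

Definition rV_coord (i : 'I_n) (x : 'rV[R]_n) : measurableTypeR R := x ord0 i.

Let rV_set0 : g_sigma_preimage rV_coord set0.
Proof. exact: sigma_algebra0. Qed.

Let rV_setC A : g_sigma_preimage rV_coord A -> g_sigma_preimage rV_coord (~` A).
Proof. exact: sigma_algebraC. Qed.

Let rV_bigcup (F : (set 'rV[R]_n)^nat) :
  (forall i, g_sigma_preimage rV_coord (F i)) ->
  g_sigma_preimage rV_coord (\bigcup_i (F i)).
Proof. exact: sigma_algebra_bigcup. Qed.

HB.instance Definition _ := @isMeasurable.Build
  (measure_tuple_display default_measure_display) 'rV[R]_n
  (g_sigma_preimage rV_coord) rV_set0 rV_setC rV_bigcup.

Lemma measurable_rV_coord (i : 'I_n) : measurable_fun setT (rV_coord i).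
Proof.
move=> _ Y mY; rewrite setTI; apply: sub_sigma_algebra => /=.
rewrite -bigcup_seq/=; exists i => /=; first by rewrite mem_index_enum.
by exists Y => //; rewrite setTI.
Qed.

Lemma measurable_fun_rVP d (T : measurableType d) (f : T -> 'rV[R]_n) :
  (forall i, measurable_fun setT (rV_coord i \o f)) -> measurable_fun setT f.
Proof.
move=> mf.
suff sub : g_sigma_preimage rV_coord `<=` image_set_system setT f measurable.
  by move=> _ A mA; exact: sub.
apply: smallest_sub.
  by apply: sigma_algebra_image; exact: sigma_algebra_measurable.
move=> A; rewrite -bigcup_seq/= => -[i _ [B mB <-]].
rewrite /image_set_system/= !setTI -[X in measurable X]setTI.
exact: (mf i).
Qed.

End rV_measurable.

Section lebesgue_rV.
Context {R : realType}.

Definition rV_cons n (z : measurableTypeR R * 'rV[R]_n) : 'rV[R]_n.+1 :=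
  \row_i oapp (fun j => z.2 ord0 j) z.1 (unlift ord0 i).

Definition rV_uncons n (x : 'rV[R]_n.+1) : measurableTypeR R * 'rV[R]_n :=
  (x ord0 ord0, \row_i x ord0 (lift ord0 i)).

Lemma rV_consK n : cancel (@rV_cons n) (@rV_uncons n).
Proof.
move=> [a y]; rewrite /rV_uncons /rV_cons mxE unlift_none /=; congr pair.
by apply/rowP => i; rewrite !mxE liftK.
Qed.

Lemma measurable_rV_cons n : measurable_fun setT (@rV_cons n).
Proof.
apply: measurable_fun_rVP => i; case: (unliftP ord0 i) => [j|] ->.
  rewrite (_ : _ \o _ = rV_coord j \o snd).
    by apply: measurableT_comp => //; exact: measurable_rV_coord.
  by apply/funext => z; rewrite /= /rV_coord mxE liftK.
rewrite (_ : _ \o _ = fst) //.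
by apply/funext => z; rewrite /= /rV_coord mxE unlift_none.
Qed.

Lemma measurable_rV_uncons n : measurable_fun setT (@rV_uncons n).
Proof.
apply/measurable_fun_pairP; split => /=.
  exact: (measurable_rV_coord ord0).
apply: measurable_fun_rVP => i.
rewrite (_ : _ \o _ = rV_coord (lift ord0 i)); first exact: measurable_rV_coord.
by apply/funext => x; rewrite /= /rV_coord mxE.
Qed.

Section step.
Variables (n : nat) (mu : {sigma_finite_measure set 'rV[R]_n -> \bar R}).

Definition lebesgue_rV_step : set 'rV[R]_n.+1 -> \bar R :=
  pushforward (lebesgue_measure \x mu)%E (@rV_cons n).

Let step0 : lebesgue_rV_step set0 = 0%E.
Proof. by rewrite /lebesgue_rV_step /pushforward preimage_set0 measure0. Qed.

Let step_ge0 A : (0 <= lebesgue_rV_step A)%E.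
Proof. exact: (measure_ge0 (lebesgue_measure \x mu)%E). Qed.

Let step_sigma_additive : semi_sigma_additive lebesgue_rV_step.
Proof.
move=> F mF tF mUF; rewrite /lebesgue_rV_step /pushforward preimage_bigcup.
apply: measure_semi_sigma_additive.
- by move=> i; rewrite -[X in measurable X]setTI; exact: measurable_rV_cons.
- apply/trivIsetP => /= i j _ _ ij; rewrite -preimage_setI.
  by move/trivIsetP : tF => /(_ _ _ _ _ ij) ->//; rewrite preimage_set0.
- rewrite -preimage_bigcup -[X in measurable X]setTI.
  exact: measurable_rV_cons.
Qed.

HB.instance Definition _ := isMeasure.Build _ _ _ lebesgue_rV_step
  step0 step_ge0 step_sigma_additive.

Let step_sigma_finite : sigma_finite setT lebesgue_rV_step.
Proof.
have /sigma_finiteP[F [TF ndF Foo]] :=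
  @sigma_finiteT _ _ _ (@lebesgue_measure R).
have /sigma_finiteP[G [TG ndG Goo]] := sigma_finiteT mu.
exists (fun i => @rV_uncons n @^-1` (F i `*` G i)).
  rewrite predeqE => x; split => // _.
  have [i _ Fi] : (\bigcup_i F i) (rV_uncons x).1 by rewrite -TF.
  have [j _ Gj] : (\bigcup_i G i) (rV_uncons x).2 by rewrite -TG.
  exists (maxn i j) => //; split.
    by move: Fi; exact/subsetPset/ndF/leq_maxl.
  by move: Gj; exact/subsetPset/ndG/leq_maxr.
move=> i; have [mFi Fioo] := Foo i; have [mGi Gioo] := Goo i; split.
  rewrite -[X in measurable X]setTI; apply: measurable_rV_uncons => //.
  exact: measurableX.
rewrite /lebesgue_rV_step /pushforward -comp_preimage.
rewrite (_ : _ \o _ = id); last by apply/funext => z; rewrite /= rV_consK.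
rewrite preimage_id product_measure1E//.
by rewrite lte_mul_pinfty// ge0_fin_numE.
Qed.

HB.instance Definition _ := Measure_isSigmaFinite.Build _ _ _ lebesgue_rV_step
  step_sigma_finite.

End step.

(* Iterated product of the Lebesgue measure on R, for the product sigma-algebra;
   dirac 0 is the counting measure on the one-point space 'rV_0. *)
Fixpoint lebesgue_rV (n : nat) :
  {sigma_finite_measure set 'rV[R]_n -> \bar R} :=
  match n with
  | 0 => dirac (0 : 'rV[R]_0)
  | m.+1 => lebesgue_rV_step (lebesgue_rV m)
  end.

End lebesgue_rV.
Arguments lebesgue_rV {R} n%_nat.

Lemma lebesgue_rV_box (R : realType) (n : nat)
    (A : 'I_n -> set (measurableTypeR R)) :
  (forall i, measurable (A i)) ->
  lebesgue_rV n [set x : 'rV[R]_n | forall i, A i (x ord0 i)] = (\prod_(i < n) lebesgue_measure (A i))%E.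
Proof.
elim: n A => [|n ih] A mA.
  by rewrite big_ord0 /= diracE mem_set// => -[].
rewrite big_ord_recl -(ih (fun i => A (lift ord0 i)))// -product_measure1E//.
- congr (product_measure1 _ _ _).
  apply/seteqP; split => [[a y]/= H|[a y]/= [H1 H2] i].
    by split=> [|i] /=; [have := H ord0|have := H (lift ord0 i)];
      rewrite mxE ?unlift_none ?liftK.
  by rewrite mxE; case: (unliftP ord0 i) => [j|] -> /=.
- have -> : [set x : 'rV[R]_n | forall i, A (lift ord0 i) (x ord0 i)] =
      \bigcap_(i in [set: 'I_n]) (rV_coord i @^-1` A (lift ord0 i)).
    by apply/seteqP; split => x /= H i; have := H i; rewrite /rV_coord //; exact.
  apply: fin_bigcap_measurable => // i _.
  by rewrite -[X in measurable X]setTI; exact: measurable_rV_coord.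
Qed.

Section polynomials.
Import -(notations) mpoly.

Definition polyfun {R : realType} {d : nat} (l : nat) : set ('rV[R]_d -> R) :=
  [set f : 'rV[R]_d -> R | exists2 p : mpoly d R, (msize p <= l.+1)%N &
    forall x, f x = meval (fun i => x ord0 i) p].

End polynomials.

(* Elements of L^2(D) are represented by functions on the whole space, only
   whose restriction to D matters. The library norm of row vectors being the
   sup norm, the Euclidean one is [enorm]. *)
Section function_spaces.
Context {R : realType} {d : nat}.
Local Notation pt := 'rV[R]_d.
Local Notation leb := (@lebesgue_rV R d).
Implicit Types (D Omega : set pt) (f g p q u v : pt -> R) (tau sigma : pt -> pt).

Definition dot (x y : pt) : R := \sum_i x ord0 i * y ord0 i.

Definition enorm (x : pt) : R := Num.sqrt (dot x x).

Definition comp tau (i : 'I_d) : pt -> R := fun x => tau x ord0 i.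

Definition ip D f g : R := \int[leb]_(x in D) (f x * g x).

Definition vip D sigma tau : R := \int[leb]_(x in D) dot (sigma x) (tau x).

Definition L2 D : set (pt -> R) := [set f | f \_ D \in Lfun leb 2%:E].

Definition L2v D : set (pt -> pt) := [set tau | forall i, L2 D (comp tau i)].

Definition L2norm D f : \bar R := 'N[leb]_2%:E[EFin \o f \_ D].

Definition L2vnorm D tau : \bar R := L2norm D (enorm \o tau).

Definition is_L2proj D (V : set (pt -> R)) f g :=
  V g /\ forall v, V v -> ip D (f \- g) v = 0.

Definition pderiv (i : 'I_d) f : pt -> R := fun x => 'D_(delta_mx ord0 i) f x.

Definition pderivs (l : seq 'I_d) f : pt -> R := foldr pderiv f l.

Definition grad f : pt -> pt := fun x => \row_i pderiv i f x.

Definition pdiv tau : pt -> R := fun x => \sum_i pderiv i (comp tau i) x.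

Definition smooth f := forall l x, differentiable (pderivs l f) x.

Definition test_function Omega f :=
  smooth f /\ exists K, [/\ compact K, K `<=` Omega & forall x, ~ K x -> f x = 0].

Definition is_wderiv Omega (l : seq 'I_d) f g := forall phi,
  test_function Omega phi ->
  ip Omega f (pderivs l phi) = (-1) ^+ size l * ip Omega g phi.

Definition wderiv Omega (l : seq 'I_d) f : pt -> R :=
  xget (fun=> 0) [set g | L2 Omega g /\ is_wderiv Omega l f g].

Definition sobolev Omega (m : nat) : set (pt -> R) :=
  [set f | L2 Omega f /\ forall l, (size l <= m)%N ->
    exists2 g, L2 Omega g & is_wderiv Omega l f g].

Definition gagliardo Omega (theta : R) g : \bar R :=
  (\int[leb]_(x in Omega) \int[leb]_(y in Omega)
    ((g x - g y) ^+ 2 / enorm (x - y) `^ (d%:R + 2 * theta))%:E)%E.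

(* The Sobolev-Slobodeckij seminorm of order t >= 0; the index l runs over the
   ordered tuples of derivation directions, so that for an integer t this is
   the L^2 norm of the Frobenius norm of the tensor of t-th derivatives. *)
Definition seminorm Omega (t : R) f : \bar R :=
  let m := Num.truncn t in
  let theta := t - m%:R in
  if `[< sobolev Omega m f >] then
    ((\sum_(l : m.-tuple 'I_d)
      (if (theta == 0)%R then L2norm Omega (wderiv Omega l f) ^+ 2
       else gagliardo Omega theta (wderiv Omega l f))) `^ (2^-1)%R)%E
  else +oo%E.

Definition Hs Omega (t : R) : set (pt -> R) :=
  [set f | (seminorm Omega t f < +oo)%E].

Definition Hsv Omega (t : R) : set (pt -> pt) :=
  [set tau | forall i, Hs Omega t (comp tau i)].

Definition is_div Omega tau g := forall phi, test_function Omega phi ->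
  vip Omega tau (grad phi) = - ip Omega g phi.

Definition Hdiv Omega : set (pt -> pt) :=
  [set tau | L2v Omega tau /\ exists2 g, L2 Omega g & is_div Omega tau g].

Definition div Omega tau : pt -> R :=
  xget (fun=> 0) [set g | L2 Omega g /\ is_div Omega tau g].

Definition mixed_eigenpair Omega (V : set (pt -> R)) (W : set (pt -> pt))
    (lam : R) u sigma :=
  [/\ V u, W sigma,
      forall tau, W tau -> - vip Omega sigma tau - ip Omega (div Omega tau) u = 0 &
      forall v, V v -> - ip Omega (div Omega sigma) v = lam * ip Omega u v].

Definition laplace_eigenpair Omega := mixed_eigenpair Omega (L2 Omega) (Hdiv Omega).

(* The problem being self-adjoint, algebraic and geometric multiplicities
   coincide. *)
Definition simple_eigenvalue Omega (lam : R) :=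
  exists u, [/\ exists sigma, laplace_eigenpair Omega lam u sigma,
    ~ {ae leb, forall x, Omega x -> u x = 0} &
    forall v tau, laplace_eigenpair Omega lam v tau ->
      exists c, {ae leb, forall x, Omega x -> v x = c * u x}].

End function_spaces.

(* An m-simplex is given by the matrix whose m.+1 rows are its vertices. *)
Section simplices.
Context {R : realType} {d : nat}.
Local Notation pt := 'rV[R]_d.

Definition hull (V : seq pt) : set pt :=
  [set x | exists t : 'I_(size V) -> R,
    [/\ forall i, 0 <= t i, \sum_i t i = 1 & x = \sum_i t i *: V`_i]].

Definition vertices (m : nat) (S : 'M[R]_(m, d)) : seq pt :=
  [seq row i S | i <- enum 'I_m].

Definition simplex (m : nat) (S : 'M[R]_(m, d)) : set pt := hull (vertices S).

Definition edges (m : nat) (S : 'M[R]_(m.+1, d)) : 'M[R]_(m, d) :=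
  \matrix_j (row (lift ord0 j) S - row ord0 S).

Definition unit_simplex (m : nat) : set 'rV[R]_m :=
  [set y | (forall i, 0 <= y ord0 i) /\ \sum_i y ord0 i <= 1].

(* The integral over an m-simplex for the m-dimensional surface measure:
   change of variables from the unit simplex, with the square root of the Gram
   determinant as Jacobian. *)
Definition simplex_int (m : nat) (S : 'M[R]_(m.+1, d)) (f : pt -> R) : R :=
  Num.sqrt (\det (edges S *m (edges S)^T)) *
  \int[lebesgue_rV m]_(y in @unit_simplex m) f (row ord0 S + y *m edges S).

(* Both orientations are allowed: every condition below that quantifies over
   unit normals is invariant under nu |-> - nu. *)
Definition unit_normal (m : nat) (S : 'M[R]_(m.+1, d)) (nu : pt) :=
  enorm nu = 1 /\ forall j, dot (row j (edges S)) nu = 0.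

Definition nondegenerate (K : 'M[R]_(d.+1, d)) := edges K \in unitmx.

Definition cell_union (T : seq 'M[R]_(d.+1, d)) : set pt :=
  \bigcup_(K in [set` T]) simplex K.

Definition polytope (Omega : set pt) :=
  [/\ Omega !=set0, connected Omega &
    exists2 S : seq 'M[R]_(d.+1, d), {in S, forall K, nondegenerate K} &
      Omega = (cell_union S)°].

(* The last condition says that a simplex is not listed twice under different
   numberings of its vertices. *)
Definition triangulation (Omega : set pt) (T : seq 'M[R]_(d.+1, d)) :=
  [/\ {in T, forall K, nondegenerate K},
      cell_union T = closure Omega,
      {in T &, forall K L, simplex K `&` simplex L =
        hull [seq x <- vertices K | x \in vertices L]} &
      {in T &, forall K L, perm_eq (vertices K) (vertices L) -> K = L}].

Definition diam (D : set pt) : R := sup [set enorm (x - y) | x in D & y in D].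

Definition indiam (D : set pt) : R :=
  sup [set 2 * r | r in [set r | exists c, forall x, enorm (x - c) <= r -> D x]].

Definition mesh_size (T : seq 'M[R]_(d.+1, d)) : R :=
  \big[Num.max/0]_(K <- T) diam (simplex K).

Definition shape_regular (kappa : R) (T : seq 'M[R]_(d.+1, d)) :=
  {in T, forall K, diam (simplex K) <= kappa * indiam (simplex K)}.

Definition poly_on (l : nat) (K : 'M[R]_(d.+1, d)) : set (pt -> R) :=
  [set f | exists2 p, polyfun l p &
    {ae lebesgue_rV d, forall x, simplex K x -> f x = p x}].

(* The polynomial that agrees almost everywhere on K with f, for a piecewise
   polynomial f. It gives a meaning to the gradient of f on K and, facets being
   negligible, to the trace of f from K on the facets of K. *)
Definition restr (K : 'M[R]_(d.+1, d)) (f : pt -> R) : pt -> R :=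
  xget (fun=> 0) [set p | (exists l, polyfun l p) /\
    {ae lebesgue_rV d, forall x, simplex K x -> f x = p x}].

Definition restrv (K : 'M[R]_(d.+1, d)) (tau : pt -> pt) : pt -> pt :=
  fun x => \row_i restr K (comp tau i) x.

End simplices.

Section discretization.
Context {R : realType} {n : nat}.
Local Notation d := n.+1.
Local Notation pt := 'rV[R]_d.
Local Notation cell := 'M[R]_(d.+1, d).
Variables (Omega : set pt) (T : seq cell) (k : nat).
Implicit Types (u uh us : pt -> R) (sigma sigmah sigmas : pt -> pt).

Definition facet (K : cell) (i : 'I_d.+1) : 'M[R]_(n.+1, d) := row' i K.

Definition broken (l : nat) : set (pt -> R) :=
  [set v | L2 Omega v /\ {in T, forall K, poly_on l K v}].

Definition broken_Hdiv (l : nat) : set (pt -> pt) :=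
  [set tau | Hdiv Omega tau /\
    {in T, forall K, forall i, poly_on l K (comp tau i)}].

Definition discrete_eigenpair :=
  mixed_eigenpair Omega (broken k) (broken_Hdiv k.+1).

(* In the second condition w \- q runs over (id - Pi^k) P^{k+2}(K). *)
Definition postprocessed_eigenfunction uh sigmah us :=
  [/\ broken k.+2 us,
      {in T, forall K, forall w q, polyfun k.+2 w ->
        is_L2proj (simplex K) (polyfun k) w q ->
        vip (simplex K) (grad (restr K us)) (grad (w \- q)) =
        vip (simplex K) sigmah (grad (w \- q))} &
      is_L2proj Omega (broken k) us uh].

Definition flux_space : set (pt -> pt) :=
  [set tau | broken_Hdiv k.+3 tau /\
    {in T, forall K, forall i nu, unit_normal (facet K i) nu ->
      exists2 r, polyfun k.+1 r &
        forall x, simplex (facet K i) x -> dot (restrv K tau x) nu = r x}].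

Definition bubble (K : cell) : set (pt -> pt) :=
  [set l | [/\ forall i, polyfun k.+3 (comp l i),
    forall x, simplex K x -> pdiv l x = 0 &
    forall i nu, unit_normal (facet K i) nu ->
      forall x, simplex (facet K i) x -> dot (l x) nu = 0]].

Definition postprocessed_flux (lamh : R) us sigmah sigmas :=
  [/\ flux_space sigmas,
      {in T, forall K, forall i nu r, unit_normal (facet K i) nu ->
        polyfun k.+1 r ->
        simplex_int (facet K i)
          (fun x => dot (restrv K sigmas x - restrv K sigmah x) nu * r x) = 0},
      {in T, forall K, forall q, polyfun k.+2 q ->
        \int[lebesgue_rV d]_(x in simplex K) q x = 0 ->
        ip (simplex K) (fun x => div Omega sigmas x + lamh * us x) q = 0} &
      {in T, forall K, forall l, bubble K l ->
        vip (simplex K) (sigmas \- sigmah) l = 0}].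

End discretization.

(* a i <= C b i with C independent of i, as soon as h i is small enough. *)
Definition lesssim {R : realType} {I : Type} (h : I -> R) (a b : I -> \bar R) :=
  exists C h0 : R, [/\ 0 < C, 0 < h0 &
    forall i, h i < h0 -> (a i <= C%:E * b i)%E].

(* Main.v *)
Require Import Defs.
From HB Require Import structures.
From mathcomp Require Import all_boot all_order all_algebra.
From mathcomp Require Import all_classical all_reals all_analysis.
From mathcomp Require mpoly.
From mathcomp Require Import measurable_realfun ring lra.
Set Implicit Arguments.
Unset Strict Implicit.
Unset Printing Implicit Defensive.
Import Order.TTheory GRing.Theory Num.Theory numFieldNormedType.Exports.
Local Open Scope classical_set_scope.
Local Open Scope ring_scope.
Import Defs.
Arguments lebesgue_rV {R} n%_nat : simpl never.

(** On a cell K all discrete objects are polynomials, and the weak divergence of a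
piecewise polynomial field of H(div) is its classical divergence on each cell
([ae_div_poly], from the fundamental lemma of the calculus of variations).

Equation for the divergence. On K, e = div sigmas + lamh us is a polynomial of
degree k + 2 that is orthogonal to all polynomials of degree k + 2 with mean zero,
hence a constant. Its mean is zero as well. Indeed the facet moments determine the
normal components, so that sigmas - sigmah has no flux through the boundary of K
([noflux_difference]) and div sigmas has the same mean as div sigmah; the discrete
equation gives div sigmah = - lamh uh, and us has the same mean as uh. The
divergence theorem that is used here ([integral_noflux]) follows from the fact that
partial derivatives of continuously differentiable functions with bounded support
have integral zero, by means of cutoff functions; without flux, the field is
bounded by the distance to each facet in the direction normal to it, so that the
contribution of the gradients of the cutoffs tends to zero.

Error estimate. Since sigma - sigmas = (sigma - sigmah) - (sigmas - sigmah), it is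
enough to bound sigmas - sigmah, whose divergence on K is - lamh g, where
g = us - uh has mean zero. With D the diameter of K and norms taken in L^2(K):
- |sigmas - sigmah| <= C D |lamh| |g|, because the interior moments make
  sigmas - sigmah orthogonal to the divergence free fields without flux; it is the
  field of least norm among those without flux that have its divergence
  ([flux_correction_min]), and some such field has this bound
  ([scaled_divergence]);
- |g| <= C D |grad g| by the inequality of Poincare ([scaled_poincare]);
- |grad g| <= |w| with the residual w = sigmah - grad uh, since grad g is a
  projection of w by definition of us ([grad_correction_min]);
- D |w| <= C (D |sigma - sigmah| + |u - uh|), by the technique of bubble functions:
  with b a weight that vanishes to second order on the boundary, |w|^2 is at most a
  multiple of the integral of b^2 w^2 ([scaled_weight]), the field tau = b^2 w,
  extended by zero, is admissible in the continuous problem, which yields the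
  identity (w, tau) = (sigmah - sigma, tau) + (uh - u, div tau)
  ([residual_identity]), and D |div tau| is at most a multiple of |b w|
  ([scaled_inverse], the only place where shape regularity enters).
Together these bound |sigmas - sigmah| by C |lamh| D (D |sigma - sigmah| +
|u - uh|), and the sum over the cells ([flux_estimate]) gives the claim, since the
eigenvalues lamh are bounded and h * h^r <= h^r'.

The inequalities on a cell are transported from the unit simplex, where they
express that for two positive semidefinite quadratic forms on a space of finite
dimension, the first is at most a multiple of the second as soon as its kernel
contains the kernel of the second ([bform_le], [unit_simplex_compare]). *)

(** * Integrals and almost everywhere equality *)

Section integral_ae.
Context d (T : measurableType d) (R : realType) (mu : {measure set T -> \bar R}).
Import HBNNSimple.

(** The functions need not be measurable: the integral of a nonnegative function
is a supremum over the simple functions below it, and a simple function can be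
set to zero on a null set without changing its integral. *)
Lemma ge0_ae_le_integral_nonmeasurable (N : set T) (f g : T -> \bar R) :
  measurable N -> mu N = 0%E ->
  (forall x, (0 <= f x)%E) -> (forall x, (0 <= g x)%E) ->
  (forall x, ~ N x -> (f x <= g x)%E) ->
  (\int[mu]_x f x <= \int[mu]_x g x)%E.
Proof.
move=> mN N0 f0 g0 fg; rewrite !ge0_integralTE//.
apply: ge_ereal_sup => /= _ [h /= hf <-].
have mNC : measurable (~` N) by exact: measurableC.
pose h' := proj_nnsfun h mNC.
have -> : sintegral mu h = sintegral mu h'.
  rewrite -!integralT_nnsfun; apply: ge0_ae_eq_integral => //.
  - exact/measurable_EFinP/measurable_funP.
  - exact/measurable_EFinP/measurable_funP.
  - by move=> x _; rewrite lee_fin fun_ge0.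
  - by move=> x _; rewrite lee_fin fun_ge0.
  - exists N; split => // x /= /not_implyP[_] Hx; apply: contrapT => Nx.
    by apply: Hx; rewrite /h' /= /mindic indicE mem_set//= mulr1.
apply: ereal_sup_ubound; exists h' => // x; rewrite /h'/= /mindic indicE.
have [Nx|Nx] := pselect (N x).
  by rewrite memNset ?mulr0//; apply.
by rewrite mem_set// mulr1 (le_trans (hf x))// fg.
Qed.

Lemma ae_eq_integral_nonmeasurable (D E : set T) (f g : T -> \bar R) :
  {ae mu, forall x, (f \_ D) x = (g \_ E) x} ->
  (\int[mu]_(x in D) f x = \int[mu]_(x in E) g x)%E.
Proof.
move=> [N [mN N0 sub]].
rewrite integral_mkcond [RHS]integral_mkcond integralE [RHS]integralE.
have eqN x : ~ N x -> (f \_ D) x = (g \_ E) x.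
  by move=> Nx; apply: contrapT => H; apply: Nx; exact: sub.
congr (_ - _)%E; apply/eqP; rewrite eq_le; apply/andP; split;
  apply: (ge0_ae_le_integral_nonmeasurable mN N0) => // x /eqN;
  by rewrite ?funeposE ?funenegE => ->.
Qed.

Lemma ae_eq_Rintegral (D E : set T) (f g : T -> R) :
  {ae mu, forall x, (f \_ D) x = (g \_ E) x} ->
  \int[mu]_(x in D) f x = \int[mu]_(x in E) g x.
Proof.
move=> fg; congr fine; apply: ae_eq_integral_nonmeasurable.
move: fg; apply: filterS => x; rewrite !patchE => fg; move: (congr1 EFin fg).
by case: ifP => _; case: ifP.
Qed.

End integral_ae.

Lemma Rintegral_dominated_cvg d (T : measurableType d) (R : realType)
    (mu : {measure set T -> \bar R}) (D : set T) (f_ : nat -> T -> R) (f h : T -> R) :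
  measurable D -> (forall m, measurable_fun D (f_ m)) -> measurable_fun D f ->
  mu.-integrable D (EFin \o h) -> (forall m x, D x -> `|f_ m x| <= h x) ->
  {ae mu, forall x, D x -> f_ ^~ x @ \oo --> f x} ->
  (fun m => \int[mu]_(x in D) f_ m x) @ \oo --> \int[mu]_(x in D) f x.
Proof.
move=> mD mf_ mf ih bf cf.
have mE_ m : measurable_fun D (EFin \o f_ m) by apply/measurable_EFinP.
have mE : measurable_fun D (EFin \o f) by apply/measurable_EFinP.
have cE : {ae mu, forall x, D x -> (fun m => (EFin \o f_ m) x) @ \oo --> (EFin \o f) x}.
  apply: filterS cf => x H Dx; apply/fine_cvgP; split; first exact: nearW.
  exact: H.
have bE : {ae mu, forall x m, D x -> (`|(EFin \o f_ m) x| <= (EFin \o h) x)%E}.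
  by apply: aeW => x m Dx; rewrite lee_fin; exact: bf.
have [fi _ H] := dominated_convergence mD mE_ mE cE ih bE.
apply: fine_cvg; rewrite fineK; first exact: H.
exact: integrable_fin_num.
Qed.

(** * Lebesgue measure on row vectors *)

Definition obox {R : realType} {d : nat} (a b : 'rV[R]_d) : set 'rV[R]_d :=
  [set x | forall i, a ord0 i < x ord0 i < b ord0 i].

Definition cbox {R : realType} {d : nat} (a b : 'rV[R]_d) : set 'rV[R]_d :=
  [set x | forall i, a ord0 i <= x ord0 i <= b ord0 i].

Definition cube {R : realType} {d : nat} (r : R) : set 'rV[R]_d :=
  [set x | forall i, `|x ord0 i| <= r].

Section rV_boxes.
Context {R : realType} {d : nat}.
Local Notation pt := 'rV[R]_d.
Implicit Types (a b : pt).

Lemma measurable_rV_box (A : 'I_d -> set (measurableTypeR R)) :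
  (forall i, measurable (A i)) ->
  measurable [set x : pt | forall i, A i (x ord0 i)].
Proof.
move=> mA.
have -> : [set x : pt | forall i, A i (x ord0 i)] =
    \bigcap_(i in [set: 'I_d]) (rV_coord i @^-1` A i).
  by apply/seteqP; split => x /= H i; have := H i; rewrite /rV_coord //; exact.
apply: fin_bigcap_measurable => // i _.
by rewrite -[X in measurable X]setTI; exact: measurable_rV_coord.
Qed.

Lemma oboxE a b : obox a b =
  [set x : pt | forall i, `]a ord0 i, b ord0 i[%classic (x ord0 i)].
Proof. by apply/seteqP; split => x /= H i; have := H i; rewrite in_itv. Qed.

Lemma cboxE a b : cbox a b =
  [set x : pt | forall i, `[a ord0 i, b ord0 i]%classic (x ord0 i)].
Proof. by apply/seteqP; split => x /= H i; have := H i; rewrite in_itv. Qed.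

Lemma measurable_obox a b : measurable (obox a b).
Proof.
rewrite oboxE; apply: (@measurable_rV_box (fun i => `]a ord0 i, b ord0 i[%classic)) => i.
exact: measurable_itv.
Qed.

Lemma measurable_cbox a b : measurable (cbox a b).
Proof.
rewrite cboxE; apply: (@measurable_rV_box (fun i => `[a ord0 i, b ord0 i]%classic)) => i.
exact: measurable_itv.
Qed.

Lemma lebesgue_cbox_fin a b : (lebesgue_rV d (cbox a b) < +oo)%E.
Proof.
rewrite cboxE (lebesgue_rV_box (A := fun i => `[a ord0 i, b ord0 i]%classic)).
  suff : (0 <= \prod_(i < d) lebesgue_measure `[a ord0 i, b ord0 i]%classic
      < +oo)%E by case/andP.
  elim/big_ind : _ => [|x y /andP[x0 xoo] /andP[y0 yoo]|i _].
  - by rewrite lee01 ltry.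
  - by rewrite mule_ge0//= lte_mul_pinfty// ge0_fin_numE.
  - by rewrite measure_ge0/= lebesgue_measure_itv/=; case: ifP; rewrite ltry.
by move=> i; exact: measurable_itv.
Qed.

Lemma cubeE (r : R) : @cube R d r = cbox (const_mx (- r)) (const_mx r).
Proof. by apply/seteqP; split => x H i; have := H i; rewrite !mxE ler_norml. Qed.

Lemma measurable_cube (r : R) : measurable (@cube R d r).
Proof. by rewrite cubeE; exact: measurable_cbox. Qed.

Lemma lebesgue_cube_fin (r : R) : (lebesgue_rV d (cube r) < +oo)%E.
Proof. by rewrite cubeE; exact: lebesgue_cbox_fin. Qed.

Lemma cube_natP (x : pt) : exists k : nat, cube k%:R x.
Proof.
exists (Num.bound (\sum_i `|x ord0 i|)) => i.
apply: ltW; apply: le_lt_trans (archi_boundP _).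
  by rewrite (bigD1 i)//= lerDl sumr_ge0.
by rewrite sumr_ge0.
Qed.

Lemma measurable_rVE : @measurable _ pt =
  <<s [set B | exists2 A : 'I_d -> set (measurableTypeR R),
        (forall i, measurable (A i)) & B = [set x : pt | forall i, A i (x ord0 i)]] >>.
Proof.
apply/seteqP; split; last first.
  apply: smallest_sub; first exact: sigma_algebra_measurable.
  by move=> _ [A mA ->]; exact: measurable_rV_box.
apply: smallest_sub; first exact: smallest_sigma_algebra.
move=> B; rewrite -bigcup_seq/= => -[i _ [A mA <-]].
apply: sub_sigma_algebra; exists (fun j => if j == i then A else setT).
  by move=> j; case: ifP.
apply/seteqP; split => x /=.
  by move=> [_ Ax] j; case: eqP => // ->.
by move=> /(_ i); rewrite eqxx.
Qed.

(** Boxes generate the sigma-algebra and are stable under intersection. *)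
Lemma measure_rV_unique (m1 m2 : {measure set pt -> \bar R}) :
  (forall r : R, (m1 (cube r) < +oo)%E) ->
  (forall A : 'I_d -> set (measurableTypeR R), (forall i, measurable (A i)) ->
    m1 [set x : pt | forall i, A i (x ord0 i)] =
    m2 [set x : pt | forall i, A i (x ord0 i)]) ->
  forall E, measurable E -> m1 E = m2 E.
Proof.
move=> fin m12 E mE.
apply: (measure_unique _ (fun k : nat => cube k%:R)
  measurable_rVE) => //.
- move=> _ _ [A mA ->] [B mB ->]; exists (fun i => A i `&` B i).
    by move=> i; exact: measurableI.
  apply/seteqP; split => x /=; first by move=> [HA HB] i; split.
  by move=> H; split => i; have [] := H i.
- move=> k; rewrite cubeE cboxE;
  exists (fun i => `[(const_mx (- k%:R) : pt) ord0 i, (const_mx k%:R : pt) ord0 i]%classic) => //.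
- by rewrite predeqE => x; split => // _; have [k xk] := cube_natP x; exists k.
- by move=> _ [A mA ->]; exact: m12.
Qed.

End rV_boxes.

Section translation.
Context {R : realType}.

Lemma lebesgue_measure_shift (a : R) (A : set (measurableTypeR R)) :
  measurable A -> lebesgue_measure ((fun x => x + a) @^-1` A) = lebesgue_measure A.
Proof.
move=> mA; have ms : measurable_fun setT (fun x : measurableTypeR R => x + a).
  by apply: measurable_funD => //; exact: measurable_id.
pose f : measurableTypeR R -> measurableTypeR R := fun x => x + a.
have mf : measurable_fun setT f by [].
pose Hf := isMeasurableFun.Build _ _ _ _ f mf.
pose F : {mfun measurableTypeR R >-> measurableTypeR R} := HB.pack f Hf.
suff /(_ A mA)-> : forall A, measurable A ->
    lebesgue_measure A = pushforward lebesgue_measure F A by [].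
apply: lebesgue_measure_unique => _ [[x y] _ <-]/=.
rewrite /pushforward/= -/f.
rewrite (_ : _ @^-1` _ = `]x - a, y - a]%classic); last first.
  by apply/seteqP; split => z /=; rewrite !in_itv/= lerBrDr ltrBlDr.
rewrite !lebesgue_measure_itv/= !lte_fin ltrD2r; case: ifP => // _.
by rewrite -!EFinD; congr EFin; ring.
Qed.

Context {d : nat}.
Local Notation pt := 'rV[R]_d.

Lemma measurable_rV_affine (m : nat) (B : 'M[R]_(m, d)) (a : pt) :
  measurable_fun setT (fun x : 'rV[R]_m => x *m B + a).
Proof.
apply: measurable_fun_rVP => i.
rewrite (_ : _ \o _ = fun x : 'rV[R]_m => (\sum_j x ord0 j * B j i) + a ord0 i).
  apply: measurable_funD => //; apply: measurable_sum => j.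
  by apply: measurable_funM => //; exact: (measurable_rV_coord j).
by apply/funext => x; rewrite /= /rV_coord !mxE.
Qed.

Lemma measurable_rV_shift (a : pt) : measurable_fun setT (fun x : pt => x + a).
Proof.
have := measurable_rV_affine 1%:M a; congr measurable_fun.
by apply/funext => x; rewrite mulmx1.
Qed.

Lemma lebesgue_rV_shift (a : pt) (E : set pt) : measurable E ->
  lebesgue_rV d ((fun x => x + a) @^-1` E) = lebesgue_rV d E.
Proof.
move=> mE.
pose f : pt -> pt := fun x => x + a.
pose F : {mfun pt >-> pt} := HB.pack f (isMeasurableFun.Build _ _ _ _ f (measurable_rV_shift a)).
suff /(_ E mE)-> : forall E, measurable E ->
    lebesgue_rV d E = pushforward (lebesgue_rV d) F E by [].
apply: (measure_rV_unique (m2 := pushforward (lebesgue_rV d) F)).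
  by move=> k; exact: lebesgue_cube_fin.
move=> A mA; apply: (etrans (lebesgue_rV_box mA)).
have mA' i : measurable ((fun t : measurableTypeR R => t + a ord0 i) @^-1` A i).
  have ms : measurable_fun setT (fun t : measurableTypeR R => t + a ord0 i).
    by apply: measurable_funD.
  by have := ms measurableT _ (mA i); rewrite setTI.
have fAE : f @^-1` [set x : pt | forall i, A i (x ord0 i)] =
    [set x : pt | forall i, ((fun t => t + a ord0 i) @^-1` A i) (x ord0 i)].
  by apply/seteqP; split => x /= H i; have := H i; rewrite mxE.
transitivity (lebesgue_rV d (f @^-1` [set x : pt | forall i, A i (x ord0 i)])) => //.
rewrite fAE; apply: esym; apply: (etrans (lebesgue_rV_box mA')).
by apply: eq_bigr => i _; rewrite lebesgue_measure_shift.
Qed.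

End translation.

Section shift_integral.
Context {R : realType} {d : nat}.
Local Notation pt := 'rV[R]_d.
Local Notation leb := (@lebesgue_rV R d).

Lemma ge0_integral_shift (f : pt -> \bar R) (a : pt) :
  measurable_fun setT f -> (forall x, 0 <= f x)%E ->
  (\int[leb]_x f (x + a)%R = \int[leb]_x f x)%E.
Proof.
move=> mf f0.
pose s : pt -> pt := fun x => x + a.
pose F : {mfun pt >-> pt} :=
  HB.pack s (isMeasurableFun.Build _ _ _ _ s (measurable_rV_shift a)).
rewrite -[LHS](@ge0_integral_pushforward _ _ _ _ _ _ (measurable_rV_shift a) leb setT f)//.
apply: (@eq_measure_integral _ _ _ setT leb (pushforward leb F)) => A mA _.
exact: lebesgue_rV_shift.
Qed.

Lemma integral_shift (f : pt -> \bar R) (a : pt) : measurable_fun setT f ->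
  (\int[leb]_x f (x + a)%R = \int[leb]_x f x)%E.
Proof.
move=> mf; rewrite integralE [RHS]integralE.
rewrite -[X in (_ = X - _)%E](@ge0_integral_shift _ a); last 2 first.
- exact: measurable_funepos.
- by move=> x; rewrite funeposE le_max lexx orbT.
rewrite -[X in (_ = _ - X)%E](@ge0_integral_shift _ a); last 2 first.
- exact: measurable_funeneg.
- by move=> x; rewrite funenegE le_max lexx orbT.
by congr (_ - _)%E; apply: eq_integral => x _; rewrite ?funeposE ?funenegE.
Qed.

End shift_integral.

(** * Linear change of variables *)

Section linear_change.
Context {R : realType} {d : nat}.
Local Notation pt := 'rV[R]_d.
Local Notation leb := (@lebesgue_rV R d).
Local Notation Q := (cbox (0 : pt) (const_mx 1)).

Lemma lebesgue_unit_cbox : leb Q = 1%E.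
Proof.
rewrite cboxE; apply: etrans.
  apply: (lebesgue_rV_box (A := fun i => `[(0 : pt) ord0 i, (const_mx 1 : pt) ord0 i]%classic)).
  by move=> i; exact: measurable_itv.
rewrite big1// => i _; rewrite lebesgue_measure_itv/= !mxE lte_fin ltr01.
by rewrite -EFinB subr0.
Qed.

Let measurable_lin (B : 'M[R]_d) : measurable_fun setT (fun x : pt => x *m B).
Proof.
have := measurable_rV_affine B 0; congr measurable_fun.
by apply/funext => x; rewrite addr0.
Qed.

(** Both sides are the integral of the indicator of E against that of the unit
cube Q over the pairs (x, y), read after the translation by x B in the one
variable or by y B^-1 in the other: this is the proof that a translation
invariant measure is unique up to a factor. *)
Let linear_fubini (B : 'M[R]_d) (E : set pt) : B \in unitmx -> measurable E ->
  (leb ((fun x => x *m B) @^-1` E) =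
   leb ((fun x => x *m B) @^-1` Q) * leb ((fun x => (- x)%R) @^-1` E))%E.
Proof.
move=> uB mE.
have mQ : measurable Q by exact: measurable_cbox.
have mlin A : measurable A -> measurable ((fun x : pt => x *m B) @^-1` A).
  by move=> mA; rewrite -[X in measurable X]setTI; exact: measurable_lin.
have mo : measurable_fun setT (fun x : pt => - x).
  have := measurable_rV_affine (- 1%:M : 'M[R]_d) 0; congr measurable_fun.
  by apply/funext => x; rewrite addr0 mulmxN mulmx1.
have mopp A : measurable A -> measurable ((fun x : pt => - x) @^-1` A).
  by move=> mA; rewrite -[X in measurable X]setTI; exact: mo.
pose oE (x : pt) : \bar R := (\1_E x)%:E.
pose oQ (x : pt) : \bar R := (\1_Q x)%:E.
have oE0 x : (0 <= oE x)%E by rewrite lee_fin.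
have oQ0 x : (0 <= oQ x)%E by rewrite lee_fin.
have moE : measurable_fun setT oE by exact/measurable_EFinP/measurable_indic.
have moQ : measurable_fun setT oQ by exact/measurable_EFinP/measurable_indic.
have mcomb (c1 c2 : R) :
    measurable_fun setT (fun z : pt * pt => c1 *: z.2 + c2 *: (z.1 *m B)).
  apply: measurable_fun_rVP => i.
  rewrite (_ : _ \o _ = fun z : pt * pt =>
      c1 * z.2 ord0 i + c2 * (\sum_j z.1 ord0 j * B j i)).
    apply: measurable_funD; apply: measurable_funM => //.
      exact: (measurableT_comp (measurable_rV_coord i) measurable_snd).
    apply: measurable_sum => j; apply: measurable_funM => //.
    exact: (measurableT_comp (measurable_rV_coord j) measurable_fst).
  by apply/funext => z; rewrite /= /rV_coord !mxE.
have moEs z : measurable_fun setT (fun y : pt => oE (z - y)).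
  have := measurableT_comp moE (measurableT_comp (measurable_rV_shift z) mo).
  by congr measurable_fun; apply/funext => y; rewrite /= addrC.
pose F (z : pt * pt) : \bar R := (oE (z.1 *m B) * oQ (z.2 + z.1 *m B)%R)%E.
pose G (z : pt * pt) : \bar R := (oQ (z.1 *m B) * oE (z.1 *m B - z.2)%R)%E.
have mF : measurable_fun setT F.
  apply: emeasurable_funM.
    apply: (measurableT_comp moE); have := mcomb 0 1; congr measurable_fun.
    by apply/funext => z; rewrite scale0r add0r scale1r.
  apply: (measurableT_comp moQ); have := mcomb 1 1; congr measurable_fun.
  by apply/funext => z; rewrite !scale1r.
have mG : measurable_fun setT G.
  apply: emeasurable_funM.
    apply: (measurableT_comp moQ); have := mcomb 0 1; congr measurable_fun.
    by apply/funext => z; rewrite scale0r add0r scale1r.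
  apply: (measurableT_comp moE); have := mcomb (-1) 1; congr measurable_fun.
  by apply/funext => z; rewrite scaleN1r scale1r addrC.
have F0 z : (0 <= F z)%E by rewrite mule_ge0.
have G0 z : (0 <= G z)%E by rewrite mule_ge0.
have indE A : measurable A -> leb A = (\int[leb]_x (\1_A x)%:E)%E.
  by move=> mA; rewrite integral_indic// setIT.
have moElin : measurable_fun setT (fun x => oE (x *m B)).
  exact: (measurableT_comp moE).
have moQlin : measurable_fun setT (fun x => oQ (x *m B)).
  exact: (measurableT_comp moQ).
transitivity (\int[leb]_x \int[leb]_y F (x, y))%E.
  rewrite indE; last exact: mlin.
  apply: eq_integral => x _; rewrite /F /=.
  rewrite ge0_integralZl//; last first.
    exact: (measurableT_comp moQ (measurable_rV_shift _)).
  rewrite (@ge0_integral_shift _ _ oQ)// -indE// lebesgue_unit_cbox mule1.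
  by rewrite /oE !indicE.
rewrite fubini_tonelli//.
transitivity (\int[leb]_y \int[leb]_x G (x, y))%E.
  apply: eq_integral => y _.
  rewrite -(@ge0_integral_shift _ _ (fun x => F (x, y)) (- (y *m invmx B))).
  - apply: eq_integral => x _; rewrite /F /G /=.
    by rewrite mulmxDl mulNmx mulmxKV// muleC addrCA subrr addr0.
  - exact: (measurableT_comp mF).
  - by move=> x.
rewrite -fubini_tonelli//.
transitivity (\int[leb]_x (oQ (x *m B) * leb ((fun x => (- x)%R) @^-1` E)))%E.
  apply: eq_integral => x _; rewrite /G /=.
  rewrite ge0_integralZl//.
  congr (_ * _)%E.
  rewrite -(@ge0_integral_shift _ _ (fun y => oE (x *m B - y)) (x *m B)).
  - rewrite indE; last exact: mopp.
    apply: eq_integral => y _.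
    by rewrite opprD addrCA subrr addr0 /oE !indicE.
  - exact: moEs.
  - by move=> y.
rewrite ge0_integralZr//; congr (_ * _)%E.
rewrite [RHS]indE; last exact: mlin.
by apply: eq_integral => x _; rewrite /oQ !indicE.
Qed.

(** The case B = 1 of the identity above is the invariance under reflection; the
factor is then the measure of the preimage of the unit cube. *)
Lemma lebesgue_linear (B : 'M[R]_d) : B \in unitmx ->
  exists2 c : R, 0 < c & forall E, measurable E ->
    (leb ((fun x => x *m B) @^-1` E) = c%:E * leb E)%E.
Proof.
move=> uB.
have opp (E : set pt) : measurable E -> leb ((fun x => - x) @^-1` E) = leb E.
  move=> mE; have := linear_fubini (unitmx1 _ _) mE.
  have id1 (A : set pt) : (fun x : pt => x *m 1%:M) @^-1` A = A.
    by rewrite (_ : (fun x => _) = id)//; apply/funext => x; rewrite mulmx1.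
  by rewrite !id1 lebesgue_unit_cbox mul1e.
set I := leb ((fun x => x *m B) @^-1` Q).
have key (E : set pt) : measurable E -> (leb ((fun x => x *m B) @^-1` E) = I * leb E)%E.
  by move=> mE; rewrite linear_fubini// opp.
have mlin A : measurable A -> measurable ((fun x : pt => x *m B) @^-1` A).
  by move=> mA; rewrite -[X in measurable X]setTI; exact: measurable_lin.
have Ioo : (I < +oo)%E.
  apply: le_lt_trans (lebesgue_cube_fin (\sum_i \sum_j `|invmx B j i|)).
  apply: le_measure; rewrite ?inE.
  - by apply: mlin; exact: measurable_cbox.
  - exact: measurable_cube.
  - move=> x /= Hx i; rewrite -[x](mulmxK uB) mxE.
    apply: (le_trans (ler_norm_sum _ _ _)).
    rewrite [leRHS](bigD1 i)//=; apply: ler_wpDr.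
      by apply: sumr_ge0 => k _; apply: sumr_ge0.
    apply: ler_sum => j _; rewrite normrM ler_piMl//.
    by have := Hx j; rewrite !mxE => /andP[h0 h1]; rewrite ger0_norm.
have I0 : (0 < I)%E.
  rewrite lt_neqAle measure_ge0 andbT eq_sym; apply/eqP => I00.
  have := key setT measurableT; rewrite I00 mul0e preimage_setT => T0.
  have : (leb Q <= leb setT)%E by apply: le_measure; rewrite ?inE//; exact: measurable_cbox.
  by rewrite T0 lebesgue_unit_cbox lee_fin ler10.
have If : I \is a fin_num by rewrite ge0_fin_numE ?measure_ge0.
exists (fine I); first by rewrite fine_gt0// I0.
by move=> E mE; rewrite fineK// key.
Qed.

Lemma ge0_integral_linear (B : 'M[R]_d) : B \in unitmx ->
  exists2 c : R, 0 < c & forall (a : pt) (f : pt -> \bar R),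
    measurable_fun setT f -> (forall x, 0 <= f x)%E ->
    (\int[leb]_x f x = c%:E * \int[leb]_y f (a + y *m B)%R)%E.
Proof.
move=> uB; have [c c0 Hc] := lebesgue_linear uB.
exists c^-1; first by rewrite invr_gt0.
move=> a f mf f0.
have cN0 : (0 <= c^-1) by rewrite invr_ge0 ltW.
pose F : {mfun pt >-> pt} :=
  HB.pack (mulmxr B : pt -> pt) (isMeasurableFun.Build _ _ _ _ (mulmxr B : pt -> pt) (measurable_lin B)).
have -> : (\int[leb]_y f (a + y *m B)%R = \int[pushforward leb F]_y f (a + y)%R)%E.
  rewrite (@ge0_integral_pushforward _ _ _ _ _ _ (measurable_lin B) leb setT (fun y => f (a + y)))//.
  by have := measurableT_comp mf (measurable_rV_shift a); congr measurable_fun;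
    apply/funext => x; rewrite /= addrC.
have -> : (\int[pushforward leb F]_y f (a + y)%R =
   \int[mscale (NngNum (ltW c0)) leb]_y f (a + y)%R)%E.
  apply: (@eq_measure_integral _ _ _ setT (mscale (NngNum (ltW c0)) leb) (pushforward leb F)) => A mA _.
  by rewrite -[LHS]/(leb ((fun x => x *m B) @^-1` A)) Hc.
have mfa : measurable_fun setT (fun y => f (a + y)).
  by have := measurableT_comp mf (measurable_rV_shift a); congr measurable_fun;
    apply/funext => x; rewrite /= addrC.
rewrite ge0_integral_mscale// muleA -EFinM mulVf ?gt_eqF// mul1e.
by rewrite -(@ge0_integral_shift _ _ f a)//; apply: eq_integral => x _; rewrite addrC.
Qed.

End linear_change.

(** * Hyperplanes and open sets *)

Section hyperplane.
Context {R : realType}.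

Lemma measurable_rV_dot d (g : 'rV[R]_d) : measurable_fun setT (fun x : 'rV[R]_d => dot x g).
Proof.
apply: measurable_sum => j.
by apply: measurable_funM => //; exact: (measurable_rV_coord j).
Qed.

(** By induction on the dimension: unless the normal is parallel to the first axis,
each section at a fixed first coordinate is a hyperplane. *)
Lemma lebesgue_hyperplane d (al : R) (g : 'rV[R]_d) : g != 0 ->
  lebesgue_rV d [set x | al + dot x g = 0] = 0%E.
Proof.
have meas k (be : R) (h : 'rV[R]_k) : measurable [set x : 'rV[R]_k | be + dot x h = 0].
  rewrite (_ : [set x | _] = (fun x => dot x h) @^-1` [set - be]).
    rewrite -[X in measurable X]setTI.
    have ms : measurable ([set - be] : set (measurableTypeR R)).
      exact: measurable_set1.
    exact: (measurable_rV_dot h measurableT ms).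
  apply/seteqP; split => x /=; last by move=> ->; rewrite subrr.
  by move=> /eqP; rewrite addrC addr_eq0 => /eqP.
elim: d al g => [|d ih] al g g0.
  by case/eqP: g0; apply/rowP => -[].
pose g' : 'rV[R]_d := \row_i g ord0 (lift ord0 i).
have dotE (x : 'rV[R]_d.+1) : dot x g = x ord0 ord0 * g ord0 ord0 +
    dot (\row_i x ord0 (lift ord0 i)) g'.
  by rewrite /dot big_ord_recl; congr (_ + _); apply: eq_bigr => i _; rewrite !mxE.
have [g'0|g'0] := eqVneq g' 0; last first.
  rewrite /= /lebesgue_rV_step /pushforward /product_measure1.
  apply: integral0_eq => t _ /=.
  rewrite (_ : xsection _ _ = [set y | (al + t * g ord0 ord0) + dot y g' = 0]).
    exact: ih.
  apply/seteqP; split => y; rewrite /xsection /= inE /= dotE !mxE unlift_none /=.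
    rewrite addrA (_ : (\row_i _) = y)//.
    by apply/rowP => i; rewrite !mxE liftK.
  rewrite addrA (_ : (\row_i _) = y)//.
  by apply/rowP => i; rewrite !mxE liftK.
have g00 : g ord0 ord0 != 0.
  apply: contra g0 => /eqP g00; apply/eqP/rowP => i; rewrite mxE.
  case: (unliftP ord0 i) => [j ->|->//].
  by have := congr1 (fun v : 'rV[R]_d => v ord0 j) g'0; rewrite !mxE.
pose A (i : 'I_d.+1) : set (measurableTypeR R) :=
  if i == ord0 then [set - al / g ord0 ord0] else setT.
rewrite (_ : [set x : 'rV[R]_d.+1 | al + dot x g = 0] =
  [set x : 'rV[R]_d.+1 | forall i, A i (x ord0 i)]).
  apply: etrans (lebesgue_rV_box _) _.
    by move=> i; rewrite /A; case: ifP => _; [exact: measurable_set1|].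
  by rewrite big_ord_recl /A eqxx lebesgue_measure_set1 mul0e.
have dot0 x : dot x g = x ord0 ord0 * g ord0 ord0.
  by rewrite dotE g'0 /dot [X in _ + X]big1 ?addr0// => i _; rewrite !mxE mulr0.
apply/seteqP; split => x /=.
  move=> /eqP; rewrite dot0 addrC addr_eq0 => /eqP H i; rewrite /A; case: eqP => // ->.
  by rewrite /= -H mulfK.
by move=> /(_ ord0); rewrite /A eqxx /= dot0 => ->; rewrite mulfVK// subrr.
Qed.

End hyperplane.

Section open_sets.
Context {R : realType} {n : nat}.
Local Notation pt := 'rV[R]_n.+1.

(** For s = -1 and s = 1, the two corners of the box of radius 1 / (p.2 + 1)
around the rational point p.1. *)
Let ratbox (p : 'rV[rat]_n.+1 * nat) (s : R) : pt :=
  \row_i (ratr (p.1 ord0 i) + s * p.2.+1%:R^-1).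

(** The countably many rational boxes inside U; the others are replaced with the
empty box from 1 to 0. *)
Lemma open_bigcup_box (U : set pt) : open U ->
  exists a b : nat -> pt, U = \bigcup_k obox (a k) (b k) /\
    forall k, cbox (a k) (b k) `<=` U.
Proof.
move=> oU.
pose ok p := `[< cbox (ratbox p (-1)) (ratbox p 1) `<=` U >].
pose ab k : pt * pt := if unpickle k is Some p then
    (if ok p then (ratbox p (-1), ratbox p 1) else (const_mx 1, 0))
  else (const_mx 1, 0).
have empty : cbox (const_mx 1 : pt) 0 `<=` U.
  move=> x /(_ ord0); rewrite !mxE => /andP[x1 x0].
  by have := le_trans x1 x0; rewrite ler10.
have sub k : cbox (ab k).1 (ab k).2 `<=` U.
  by rewrite /ab; case: unpickle => [p|//]; case: ifP => [/asboolP|_].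
exists (fun k => (ab k).1), (fun k => (ab k).2); split => //.
apply/seteqP; split => [x Ux|x [k _ xk]]; last first.
  by apply: (sub k) => i; have /andP[/ltW -> /ltW ->] := xk i.
have : nbhs x U by exact: open_nbhs_nbhs.
move=> /nbhs_ballP[e /= e0 xeU].
have [m me] : exists m : nat, m.+1%:R^-1 < e / 2 :> R.
  have e20 : 0 < e / 2 by lra.
  exists (Num.bound (e / 2)^-1); rewrite -[ltRHS]invrK ltf_pV2 ?posrE ?invr_gt0//.
  apply: lt_le_trans (archi_boundP _) _; first by rewrite invr_ge0 ltW.
  by rewrite ler_nat.
set r := m.+1%:R^-1 in me; have r0 : 0 < r by rewrite invr_gt0.
have qP i : exists q : rat, x ord0 i - r < ratr q < x ord0 i + r.
  have [|q] := @rat_in_itvoo R (x ord0 i - r) (x ord0 i + r); first by lra.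
  by rewrite in_itv/=; exists q.
have /choice[q Hq] := qP.
pose p : 'rV[rat]_n.+1 * nat := (\row_i q i, m).
have pok : ok p.
  apply/asboolP => y Hy; apply: xeU; split=> // i j; rewrite (ord1 i).
  have := Hy j; have := Hq j; rewrite !mxE /= -/r => /andP[h1 h2] /andP[h3 h4].
  by rewrite /ball/= ltr_norml; apply/andP; split; lra.
exists (pickle p) => // i; rewrite /ab pickleK pok !mxE /= -/r.
by have := Hq i => /andP[h1 h2]; apply/andP; split; lra.
Qed.

Lemma open_rV_measurable (U : set pt) : open U -> measurable U.
Proof.
move=> /open_bigcup_box[a [b [-> _]]].
by apply: bigcupT_measurable => k; exact: measurable_obox.
Qed.

Lemma continuous_rV_measurable (f : pt -> R) : continuous f ->
  measurable_fun setT f.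
Proof.
move=> cf; apply: (measurability _ (RGenOpens.measurableE R)).
move=> _ [_ [a [b ->]] <-]; rewrite setTI.
apply: open_rV_measurable; move/continuousP: cf; apply.
exact: interval_open.
Qed.

End open_sets.

(** * Polynomial functions *)

Section polyfun_algebra.
Import -(notations) mpoly.
Context {R : realType} {d : nat}.
Local Notation pt := 'rV[R]_d.
Implicit Types (f g : pt -> R) (l : nat).

Lemma polyfun_cst l (c : R) : polyfun l (fun=> c : R) (d := d).
Proof.
exists (mpolyC d c); last by move=> x; rewrite mevalC.
by rewrite msizeC; case: (c != 0).
Qed.

Lemma polyfun_leq l l' f : (l <= l')%N -> polyfun l f -> polyfun l' f.
Proof. by move=> ll' [p pl fp]; exists p => //; exact: leq_trans pl _. Qed.

Lemma polyfunD l f g : polyfun l f -> polyfun l g ->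
  polyfun l (fun x => f x + g x).
Proof.
move=> [p pl fp] [q ql gq]; exists (p + q); last by move=> x; rewrite mevalD fp gq.
by apply: leq_trans (msizeD_le _ _) _; rewrite geq_max pl ql.
Qed.

Lemma polyfunZ l c f : polyfun l f -> polyfun l (fun x => c * f x).
Proof.
move=> [p pl fp]; exists (c *: p); last by move=> x; rewrite mevalZ fp.
exact: leq_trans (msizeZ_le _ _) _.
Qed.

Lemma polyfunM l l' f g : polyfun l f -> polyfun l' g ->
  polyfun (l + l') (fun x => f x * g x).
Proof.
move=> [p pl fp] [q ql gq]; exists (p * q); last by move=> x; rewrite mevalM fp gq.
have [->|p0] := eqVneq p 0; first by rewrite mul0r msize0.
have [->|q0] := eqVneq q 0; first by rewrite mulr0 msize0.
rewrite msizeM//; have := leq_add pl ql; rewrite addSn addnS.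
by case: (msize p + msize q)%N.
Qed.

Lemma polyfun_coord l i : polyfun l.+1 (fun x : pt => x ord0 i).
Proof.
exists (mpolyX R (mnm1 i)); first by rewrite msizeX mdeg1.
by move=> x; rewrite mevalXU.
Qed.

Lemma polyfun_sum l (I : Type) (r : seq I) (P : pred I) (F : I -> pt -> R) :
  (forall i, P i -> polyfun l (F i)) -> polyfun l (fun x => \sum_(i <- r | P i) F i x).
Proof.
move=> HF; elim: r => [|i r ih].
  by rewrite (_ : (fun=> _) = fun=> 0); [exact: polyfun_cst|apply/funext => x; rewrite big_nil].
rewrite (_ : (fun=> _) = fun x => (if P i then F i else fun=> 0) x + \sum_(i <- r | P i) F i x).
  apply: polyfunD; last exact: ih.
  by case: ifP => Pi; [exact: HF|exact: polyfun_cst].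
by apply/funext => x; rewrite big_cons; case: ifP; rewrite ?add0r.
Qed.

Lemma polyfunN l f : polyfun l f -> polyfun l (fun x => - f x).
Proof. by move=> /(polyfunZ (-1)); under eq_fun do rewrite mulN1r. Qed.

Lemma polyfunB l f g : polyfun l f -> polyfun l g -> polyfun l (fun x => f x - g x).
Proof. by move=> pf pg; apply: polyfunD => //; exact: polyfunN. Qed.

(** Polynomials are built from constants by sums and by products with one
coordinate, which raise the degree by one. *)
Lemma polyfun_ind (P : nat -> (pt -> R) -> Prop) :
  (forall l c, P l (fun=> c)) ->
  (forall l f g, P l f -> P l g -> P l (fun x => f x + g x)) ->
  (forall l i f, polyfun l f -> P l f -> P l.+1 (fun x => x ord0 i * f x)) ->
  forall l f, polyfun l f -> P l f.
Proof.
move=> Pc PD PX l f [p pl fp].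
have mono (m : multinom d) (c : R) : (mdeg m <= l)%N ->
    P l (fun x => c * \prod_(i < d) x ord0 i ^+ m i).
  elim: l {pl} m => [|l ih] m ml.
    have -> : (fun x : pt => c * \prod_(i < d) x ord0 i ^+ m i) = fun=> c.
      apply/funext => x; rewrite big1 ?mulr1// => i _.
      move: ml; rewrite leqn0 mdegE sum_nat_eq0 => /forallP/(_ i)/eqP ->.
      by rewrite expr0.
    exact: Pc.
  have [/eqP m0|[i mi]] : mdeg m == 0%N \/ exists i, (0 < m i)%N.
    have [/eqP m0|] := eqVneq (mdeg m) 0%N; first by left.
    rewrite mdegE sum_nat_eq0 negb_forall => /existsP[i]; rewrite -lt0n => mi.
    by right; exists i.
  - have -> : (fun x : pt => c * \prod_(i < d) x ord0 i ^+ m i) = fun=> c.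
      apply/funext => x; rewrite big1 ?mulr1// => i _.
      move/eqP: m0; rewrite mdegE sum_nat_eq0 => /forallP/(_ i)/eqP ->.
      by rewrite expr0.
    exact: Pc.
  pose m' := mnm_sub m (mnm1 i).
  have mE j : m j = ((i == j) + m' j)%N.
    by rewrite mnmBE mnm1E; case: eqP => [<-|_]; rewrite ?subn0//= subnKC.
  have -> : (fun x : pt => c * \prod_(i < d) x ord0 i ^+ m i) =
      fun x => x ord0 i * (c * \prod_(i < d) x ord0 i ^+ m' i).
    apply/funext => x; rewrite mulrCA; congr (_ * _).
    rewrite (bigD1 i)//= [in RHS](bigD1 i)//= mulrA; congr (_ * _).
      by rewrite mE eqxx exprD expr1.
    by apply: eq_bigr => j ji; rewrite mE eq_sym (negbTE ji).
  have m'l : (mdeg m' <= l)%N.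
    rewrite -ltnS; apply: leq_trans ml; rewrite !mdegE.
    rewrite [ltnRHS](bigD1 i)//= [X in (X < _)%N](bigD1 i)//= mE eqxx add1n addSn ltnS.
    by rewrite leq_add2l; apply: leq_sum => j ji; rewrite mE eq_sym (negbTE ji).
  apply: PX; last exact: ih.
  exists (c *: mpolyX R m'); last by move=> x; rewrite mevalZ mevalX.
  by apply: leq_trans (msizeZ_le _ _) _; rewrite msizeX.
have -> : f = fun x => \sum_(m <- msupp p) mcoeff m p * \prod_(i < d) x ord0 i ^+ m i.
  by apply/funext => x; rewrite fp mevalE.
have : forall m, m \in msupp p -> (mdeg m <= l)%N.
  by move=> m /msize_mdeg_lt /leq_trans /(_ pl).
elim: (msupp p : seq _) => [_|m s ih ms].
  by rewrite (_ : (fun=> _) = fun=> 0); [exact: Pc|apply/funext => x; rewrite big_nil].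
rewrite (_ : (fun=> _) = fun x : pt => mcoeff m p * \prod_(i < d) x ord0 i ^+ m i +
   \sum_(m <- s) mcoeff m p * \prod_(i < d) x ord0 i ^+ m i).
  apply: PD; first by apply: mono; apply: ms; rewrite mem_head.
  by apply: ih => m' m's; apply: ms; rewrite inE m's orbT.
by apply/funext => x; rewrite big_cons.
Qed.

(** The monomials: inequalities between norms of polynomials of a given degree
become inequalities between quadratic forms in finitely many coefficients. *)
Lemma polyfun_basis l : exists N (e : 'I_N -> pt -> R),
  (forall j, polyfun l (e j)) /\
  forall f, polyfun l f -> exists c : 'rV[R]_N, forall x, f x = \sum_j c ord0 j * e j x.
Proof.
pose J : finType := bmultinom d l.+1.
pose e (j : 'I_#|J|) (x : pt) := \prod_(i < d) x ord0 i ^+ (enum_val j : J) i.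
exists #|J|, e; split.
  move=> j; exists (mpolyX R (enum_val j : J)); last by move=> x; rewrite mevalX.
  by rewrite msizeX; exact: bmdeg.
move=> f [p pl fp].
exists (\row_j mcoeff (enum_val j : J) p) => x.
rewrite fp {1}(mpolywE pl) raddf_sum/=.
rewrite (reindex (@enum_val J predT)) /=; last exact: (onW_bij _ (enum_val_bij _)).
by apply: eq_bigr => j _; rewrite mevalZ mevalX mxE.
Qed.

Lemma polyfun_line l f (x v : pt) : polyfun l f ->
  exists q : {poly R}, forall t, f (x + t *: v) = q.[t].
Proof.
move=> pf; move: l f pf x v; apply: polyfun_ind.
- by move=> l c x v; exists c%:P => t; rewrite hornerC.
- move=> l f g Hf Hg x v; have [p Hp] := Hf x v; have [q Hq] := Hg x v.
  by exists (p + q) => t; rewrite hornerD Hp Hq.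
- move=> l i f _ Hf x v; have [p Hp] := Hf x v.
  exists (((x ord0 i)%:P + (v ord0 i) *: 'X) * p) => t.
  by rewrite hornerM hornerD hornerC hornerZ hornerX Hp !mxE [_ * t]mulrC.
Qed.

End polyfun_algebra.

Lemma polyfun_affine (R : realType) (m d l : nat) (f : 'rV[R]_d -> R)
    (a : 'rV[R]_d) (B : 'M[R]_(m, d)) :
  polyfun l f -> polyfun l (fun y => f (a + y *m B)).
Proof.
move=> pf; move: l f pf; apply: polyfun_ind.
- by move=> l c; exact: polyfun_cst.
- by move=> l f g; exact: polyfunD.
- move=> l i f _ pf; rewrite -[l.+1]add1n; apply: (polyfunM _ pf).
  rewrite (_ : (fun=> _) = fun y : 'rV_m => a ord0 i + \sum_j B j i * y ord0 j).
    apply: polyfunD; first exact: polyfun_cst.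
    by apply: polyfun_sum => j _; apply: polyfunZ; exact: polyfun_coord.
  by apply/funext => y; rewrite !mxE; congr (_ + _); apply: eq_bigr => j _; rewrite mulrC.
Qed.

(** * Directional derivatives *)

Section directional_derivatives.
Context {R : realType} {d : nat}.
Local Notation pt := 'rV[R]_d.
Implicit Types (f g : pt -> R) (x v : pt).

Lemma derive_pderiv f x v : differentiable f x ->
  'D_v f x = \sum_i v ord0 i * pderiv i f x.
Proof.
move=> df; rewrite deriveE// {1}[v]row_sum_delta linear_sum/=.
by apply: eq_bigr => i _; rewrite linearZ/= /pderiv deriveE.
Qed.

Lemma pderiv_cst i (c : R) : pderiv i (fun _ : pt => c) = fun=> 0.
Proof. by apply/funext => x; rewrite /pderiv derive_cst. Qed.

Lemma pderivD i f g x : differentiable f x -> differentiable g x ->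
  pderiv i (fun x => f x + g x) x = pderiv i f x + pderiv i g x.
Proof. by move=> df dg; rewrite /pderiv deriveD//; exact: diff_derivable. Qed.

Lemma pderivZ i c f x : differentiable f x ->
  pderiv i (fun x => c * f x) x = c * pderiv i f x.
Proof. by move=> df; rewrite /pderiv (deriveZ c)//; exact: diff_derivable. Qed.

Lemma pderivM i f g x : differentiable f x -> differentiable g x ->
  pderiv i (fun x => f x * g x) x = f x * pderiv i g x + g x * pderiv i f x.
Proof. by move=> df dg; rewrite /pderiv deriveM//; exact: diff_derivable. Qed.

Lemma differentiable_rV_coord i x : differentiable (fun x : pt => x ord0 i) x.
Proof. exact: differentiable_coord. Qed.

Lemma pderiv_coord i j : pderiv i (fun x : pt => x ord0 j) = fun=> (i == j)%:R.
Proof.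
apply/funext => x; rewrite /pderiv; apply: cvg_lim => //.
apply: cvg_near_cst; near=> h => /=.
have h0 : h != 0 by near: h; exact: nbhs_dnbhs_neq.
by rewrite !mxE eqxx /= addrK eq_sym /GRing.scale/= mulKf.
Unshelve. all: by end_near. Qed.

Lemma pderivM_coord i j f x : differentiable f x ->
  pderiv i (fun x => x ord0 j * f x) x = (i == j)%:R * f x + x ord0 j * pderiv i f x.
Proof.
move=> df; rewrite pderivM ?pderiv_coord//; last exact: differentiable_rV_coord.
by rewrite addrC mulrC.
Qed.

Lemma is_derive_line f x v (t : R) : differentiable f (x + t *: v) ->
  is_derive t (1 : R) (fun s => f (x + s *: v)) ('D_v f (x + t *: v)).
Proof.
move=> df.
pose F s := f (x + s *: v).
pose L (h : R) := h^-1 *: ((F \o shift t) (h *: (1 : R)) - F t).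
have LE : L = fun h => h^-1 *: ((f \o shift (x + t *: v)) (h *: v) - f (x + t *: v)).
  apply/funext => h; rewrite /L /F /=; congr (_ *: (f _ - _)).
  have -> : h *: (1 : R) = h by rewrite /GRing.scale/= mulr1.
  by rewrite scalerDl addrCA.
split; first by change (cvg (L @ 0^')); rewrite LE; exact: diff_derivable.
by change (lim (L @ 0^') = 'D_v f (x + t *: v)); rewrite LE.
Qed.

Lemma line_MVT f x v (t : R) : (forall y, differentiable f y) ->
  exists2 s : R, `|s| <= `|t| & f (x + t *: v) - f x = t * 'D_v f (x + s *: v).
Proof.
move=> df.
pose F s := f (x + s *: v); pose dF s := 'D_v f (x + s *: v).
have dFP s : is_derive s (1 : R) F (dF s) by exact: is_derive_line.
have cF A : {within A, continuous F}.
  apply: continuous_subspaceT => s; apply: differentiable_continuous.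
  by apply/derivable1_diffP; have [] := dFP s.
have F0 : F 0 = f x by rewrite /F scale0r addr0.
case: (leP 0 t) => t0.
  have [s st E] := MVT_segment t0 (fun s _ => dFP s) (cF _).
  move: st; rewrite in_itv/= => /andP[s0 st].
  by exists s; rewrite ?ger0_norm// -[LHS]/(F t - f x) -F0 E subr0 mulrC.
have [s st E] := MVT_segment (ltW t0) (fun s _ => dFP s) (cF _).
move: st; rewrite in_itv/= => /andP[s0 st].
exists s; first by rewrite !ler0_norm ?lerN2// ltW.
rewrite -[LHS]/(F t - f x) -F0 -opprB E sub0r mulrN opprK mulrC//.
Qed.

(** Proved together, since the product rule in the induction step needs
differentiability. The derivative of a constant is treated apart because there
is no degree -1. *)
Lemma polyfun_diff l f : polyfun l f ->
  (forall x, differentiable f x) /\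
  (forall i, if l is l'.+1 then polyfun l' (pderiv i f) else pderiv i f = fun=> 0).
Proof.
move: l f; apply: polyfun_ind.
- move=> l c; split; first by move=> x; exact: differentiable_cst.
  by move=> i; rewrite pderiv_cst; case: l => // l; exact: polyfun_cst.
- move=> l f g [df pf] [dg pg]; split; first by move=> x; exact: differentiableD.
  move=> i; have -> : pderiv i (fun x => f x + g x) = fun x => pderiv i f x + pderiv i g x.
    by apply/funext => x; rewrite pderivD.
  case: l pf pg => [|l] pf pg; first by rewrite pf pg; apply/funext => x; rewrite addr0.
  exact: polyfunD.
- move=> l j f pf [df pdf]; split.
    by move=> x; apply: differentiableM => //; exact: differentiable_rV_coord.
  move=> i; have -> : pderiv i (fun x => x ord0 j * f x) =
      fun x => (i == j)%:R * f x + x ord0 j * pderiv i f x.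
    by apply/funext => x; rewrite pderivM_coord.
  apply: polyfunD; first exact: polyfunZ.
  case: l pf pdf => [|l] pf pdf.
    rewrite pdf; under eq_fun do rewrite mulr0; exact: polyfun_cst.
  by rewrite -add1n; apply: polyfunM; [exact: polyfun_coord|exact: pdf].
Qed.

Lemma polyfun_differentiable l f x : polyfun l f -> differentiable f x.
Proof. by move=> /polyfun_diff[]. Qed.

Lemma polyfun_pderiv l i f : polyfun l f -> polyfun l.-1 (pderiv i f).
Proof.
move=> /polyfun_diff[_ /(_ i)]; case: l => //= ->; exact: polyfun_cst.
Qed.

Lemma polyfun_continuous l f : polyfun l f -> continuous f.
Proof. by move=> pf x; exact/differentiable_continuous/(polyfun_differentiable _ pf). Qed.

(** On the line from x0 to any point, the polynomial in one variable has
infinitely many roots near x0. *)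
Lemma polyfun_eq0_ball l f (x0 : pt) (e : R) : polyfun l f -> 0 < e ->
  (forall x, (forall i, `|x ord0 i - x0 ord0 i| < e) -> f x = 0) -> forall x, f x = 0.
Proof.
move=> pf e0 f0 x.
have [q Hq] := polyfun_line x0 (x - x0) pf.
suff q0 : q = 0 by have := Hq 1; rewrite scale1r addrCA subrr addr0 q0 horner0.
pose M := 1 + \sum_i `|(x - x0) ord0 i|.
have M0 : 0 < M by rewrite ltr_wpDr// sumr_ge0.
have qroot (k : nat) : q.[e / M / k.+2%:R] = 0.
  rewrite -Hq; apply: f0 => i; rewrite !mxE addrAC subrr add0r.
  have iM : `|x ord0 i - x0 ord0 i| < M.
    rewrite /M (bigD1 i)//= !mxE; set S := \sum_(_ | _) _.
    have S0 : 0 <= S by exact: sumr_ge0.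
    by lra.
  have c0 : 0 < e / M / k.+2%:R by rewrite !divr_gt0.
  rewrite normrM ger0_norm ?ltW//.
  apply: (@lt_le_trans _ _ (e / M / k.+2%:R * M)); first by rewrite ltr_pM2l.
  rewrite mulrAC divfK ?gt_eqF// ler_pdivrMr//.
  by rewrite ler_peMr ?ler1n// ltW.
apply/eqP; apply/negPn/negP => qn0.
pose rs := [seq e / M / k.+2%:R | k <- iota 0 (size q)].
suff : (size rs < size q)%N by rewrite size_map size_iota ltnn.
apply: max_poly_roots => //.
  by apply/allP => _ /mapP[k _ ->]; apply/eqP/qroot.
rewrite map_inj_uniq ?iota_uniq// => k k' /(mulfI _) H.
have : e / M != 0 by rewrite gt_eqF// divr_gt0.
by move=> /H /invr_inj /eqP; rewrite eqr_nat => /eqP[].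
Qed.

End directional_derivatives.

Lemma pderiv_affine (R : realType) (m d : nat) (f : 'rV[R]_d -> R)
    (a : 'rV[R]_d) (B : 'M[R]_(m, d)) (j : 'I_m) (y : 'rV[R]_m) :
  differentiable f (a + y *m B) ->
  pderiv j (fun y => f (a + y *m B)) y = \sum_i B j i * pderiv i f (a + y *m B).
Proof.
move=> df; transitivity ('D_(row j B) f (a + y *m B)).
  pose F z := f (a + z *m B).
  pose L (h : R) := h^-1 *: ((F \o shift y) (h *: delta_mx ord0 j) - F y).
  change (lim (L @ 0^') = 'D_(row j B) f (a + y *m B)).
  rewrite /derive (_ : L = fun h => h^-1 *:
    ((f \o shift (a + y *m B)) (h *: row j B) - f (a + y *m B)))//.
  apply/funext => h; rewrite /L /F /=; congr (_ *: (f _ - _)).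
  by rewrite mulmxDl -scalemxAl -rowE addrCA.
by rewrite derive_pderiv//; apply: eq_bigr => i _; rewrite mxE.
Qed.

(** * Continuously differentiable functions and integration by parts *)

Section C1_functions.
Context {R : realType} {d : nat}.
Local Notation pt := 'rV[R]_d.
Implicit Types (f g : pt -> R).

Definition C1 f := (forall x, differentiable f x) /\ forall i, continuous (pderiv i f).

Lemma C1_continuous f : C1 f -> continuous f.
Proof. by move=> [df _] x; exact: differentiable_continuous. Qed.

Lemma polyfun_C1 l f : polyfun l f -> C1 f.
Proof.
move=> pf; split=> [x|i]; first exact: polyfun_differentiable pf.
exact: polyfun_continuous (polyfun_pderiv i pf).
Qed.

Lemma continuous_mulf f g : continuous f -> continuous g ->
  continuous (fun x => f x * g x).
Proof. by move=> cf cg x; exact: (continuousM (cf x) (cg x)). Qed.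

Lemma C1M f g : C1 f -> C1 g -> C1 (fun x => f x * g x).
Proof.
move=> Cf Cg; have [df cf] := Cf; have [dg cg] := Cg.
split=> [x|i]; first exact: differentiableM.
have -> : pderiv i (fun x => f x * g x) = fun x => f x * pderiv i g x + g x * pderiv i f x.
  by apply/funext => x; rewrite pderivM.
move=> x; apply: (@continuousD _ _ _ (f \* pderiv i g) (g \* pderiv i f)).
  exact: (continuous_mulf (C1_continuous Cf) (cg i) (x := x)).
exact: (continuous_mulf (C1_continuous Cg) (cf i) (x := x)).
Qed.

Lemma C1_prod (I : Type) (r : seq I) (F : I -> pt -> R) : (forall i, C1 (F i)) ->
  C1 (fun x => \prod_(i <- r) F i x).
Proof.
move=> CF; elim: r => [|i r ih].
  rewrite (_ : (fun=> _) = fun=> 1); first exact: (@polyfun_C1 0 _ (polyfun_cst _ _)).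
  by apply/funext => x; rewrite big_nil.
rewrite (_ : (fun=> _) = fun x => F i x * \prod_(i <- r) F i x); first exact: C1M.
by apply/funext => x; rewrite big_cons.
Qed.

Lemma pderiv_comp1 (th th' : R -> R) g i x :
  (forall t, is_derive t (1 : R) th (th' t)) -> differentiable g x ->
  differentiable (th \o g) x /\ pderiv i (th \o g) x = th' (g x) * pderiv i g x.
Proof.
move=> dth dg.
have dthg : differentiable th (g x) by apply/derivable1_diffP; have [] := dth (g x).
have dc : differentiable (th \o g) x by exact: differentiable_comp.
have key (v : R) : 'd th (g x) v = v * th' (g x).
  have [_ <-] := dth (g x); rewrite deriveE//.
  by rewrite -[RHS]linearZ /GRing.scale/= mulr1.
by split=> //; rewrite /pderiv [LHS]deriveE// diff_comp//= key -deriveE// mulrC.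
Qed.

Lemma C1_comp1 (th th' : R -> R) g :
  (forall t, is_derive t (1 : R) th (th' t)) -> continuous th' -> C1 g -> C1 (th \o g).
Proof.
move=> dth cth' Cg; have [dg cg] := Cg; split=> [x|i].
  case: (pickP (fun _ : 'I_d => true)) => [i _|H].
    by have [] := pderiv_comp1 i dth (dg x).
  by apply: differentiable_comp => //; apply/derivable1_diffP; have [] := dth (g x).
have -> : pderiv i (th \o g) = fun x => th' (g x) * pderiv i g x.
  by apply/funext => x; have [] := pderiv_comp1 i dth (dg x).
move=> x; apply: continuousM; last exact: cg.
by apply: continuous_comp; [exact: (C1_continuous Cg)|exact: cth'].
Qed.

Lemma smooth_C1 f : smooth f -> C1 f.
Proof.
move=> sf; split=> [x|i x]; first exact: (sf [::]).
exact: differentiable_continuous (sf [:: i] x).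
Qed.

Lemma compact_cube_bound (K : set pt) : compact K -> exists r : R, K `<=` cube r.
Proof.
move=> /compact_bounded[M [_ HM]]; exists (`|M| + 1) => x Kx i.
have /HM/(_ x Kx) : M < `|M| + 1 by rewrite (le_lt_trans (ler_norm M))// ltrDl.
apply: le_trans; rewrite [leRHS]mx_normrE.
by apply/(le_trans _ (@le_bigmax_cond _ _ _ _ (ord0, i) xpredT (fun ij => `|x ij.1 ij.2|) _)).
Qed.

Lemma cube_compact (r : R) : compact (@cube R d r).
Proof.
apply: bounded_closed_compact.
  exists `|r|; split; first exact: num_real.
  move=> M rM x xr /=; rewrite [leLHS]mx_normrE.
  apply: bigmax_le => [|[j i] _ /=]; first by rewrite (le_trans _ (ltW rM)).
  by rewrite (ord1 j) (le_trans (xr i))// (le_trans (ler_norm r))// ltW.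
rewrite (_ : cube r = \bigcap_(i in [set: 'I_d]) [set x : pt | `|x ord0 i| <= r]).
  apply: closed_bigI => i _.
  apply: (@preimage_closed _ _ (fun x : pt => `|x ord0 i|) [set t | t <= r]).
    move=> x _; apply: (@continuous_comp _ _ _ (fun x : pt => x ord0 i) (fun t : R => `|t|)).
      exact: coord_continuous.
    exact: norm_continuous.
  exact: closed_le.
by apply/seteqP; split => x H i; [move=> _; exact: H|exact: (H i I)].
Qed.

Lemma continuous_cube_bounded f (r : R) : continuous f ->
  exists L : R, 0 <= L /\ forall x, cube r x -> `|f x| <= L.
Proof.
move=> cf; have : compact (f @` cube r).
  by apply: continuous_compact (@cube_compact r) => //; exact: continuous_subspaceT.
move=> /compact_bounded[M [_ HM]]; exists (`|M| + 1); split; first exact: addr_ge0.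
move=> x xr; apply: (HM (`|M| + 1)); last by exists x.
by rewrite (le_lt_trans (ler_norm M))// ltrDl.
Qed.

End C1_functions.

Section bounded_integrable.
Context {R : realType}.

Lemma bounded_integrable d (T : measurableType d) (mu : {measure set T -> \bar R})
    (D : set T) (f : T -> R) (L : R) :
  measurable D -> (mu D < +oo)%E -> measurable_fun D f ->
  (forall x, D x -> `|f x| <= L) -> mu.-integrable D (EFin \o f).
Proof.
move=> mD Doo mf fL.
apply: (@le_integrable _ _ _ mu D mD _ (fun=> L%:E)).
- exact/measurable_EFinP.
- move=> x Dx /=; rewrite lee_fin; apply: le_trans (ler_norm L); exact: fL.
- apply/integrableP; split; first exact: measurable_cst.
  by rewrite integral_cst//= lte_mul_pinfty.
Qed.

Lemma integrable_bounded_support d (f : 'rV[R]_d -> R) (L r : R) :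
  measurable_fun setT f -> (forall x, ~ cube r x -> f x = 0) ->
  (forall x, cube r x -> `|f x| <= L) ->
  (lebesgue_rV d).-integrable setT (EFin \o f).
Proof.
move=> mf f0 fL.
have -> : EFin \o f = (EFin \o f) \_ (cube r).
  apply/funext => x; rewrite patchE; case: ifPn => //= /negP xr.
  by rewrite f0// => H; apply: xr; rewrite inE.
apply/(integrable_mkcond _ (measurable_cube r)).
apply: (bounded_integrable (measurable_cube r) (lebesgue_cube_fin r) _ fL).
exact: measurable_funS mf.
Qed.

End bounded_integrable.

Section integration_by_parts.
Context {R : realType} {n : nat}.
Local Notation pt := 'rV[R]_n.+1.
Local Notation leb := (@lebesgue_rV R n.+1).

(** The difference quotients of G have integral zero by translation invariance,
and they converge boundedly to the derivative. *)
Lemma integral_pderiv_eq0 (i : 'I_n.+1) (G : pt -> R) (r : R) : C1 G ->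
  (forall x, ~ cube r x -> G x = 0) -> \int[leb]_x pderiv i G x = 0.
Proof.
move=> CG G0; have [dG cG] := CG; have contG := C1_continuous CG.
pose e : pt := delta_mx ord0 i.
pose t (m : nat) : R := m.+1%:R^-1.
have t0 m : 0 < t m by rewrite invr_gt0.
have t1 m : t m <= 1 by rewrite invf_le1// ler1n.
pose h m (x : pt) := (t m)^-1 * (G (x + t m *: e) - G x).
have mG : measurable_fun setT G by exact: continuous_rV_measurable.
have mGs m : measurable_fun setT (fun x : pt => G (x + t m *: e)).
  exact: (measurableT_comp mG (measurable_rV_shift _)).
have [L [L0 HL]] := continuous_cube_bounded (r + 2) (cG i).
have [L' [L'0 HL']] := continuous_cube_bounded r contG.
have iG : leb.-integrable setT (EFin \o G).
  exact: (integrable_bounded_support mG G0 HL').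
have shift_cube x s k : `|s| <= 1 -> cube k x -> cube (k + 1) (x + s *: e).
  move=> s1 xk j; rewrite !mxE eqxx /=; apply: (le_trans (ler_normD _ _)).
  rewrite lerD// normrM; case: (_ == _); rewrite ?normr1 ?mulr1//.
  by rewrite normr0 mulr0.
have hb m x : `|h m x| <= L * \1_(cube (r + 1)) x.
  have [xr|xr] := pselect (cube (r + 1) x).
    rewrite indicE mem_set// mulr1 /h; have [s st ->] := line_MVT x e (t m) dG.
    rewrite mulKf ?gt_eqF//; apply: HL.
    rewrite (_ : r + 2 = (r + 1) + 1); last by ring.
    apply: shift_cube => //; apply: le_trans st _.
    by rewrite ger0_norm// ltW.
  rewrite indicE memNset// mulr0 /h.
  rewrite G0; last first.
    move=> xr'; apply: xr; have := shift_cube _ (- t m) _ _ xr'.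
    by rewrite scaleNr addrK; apply; rewrite normrN ger0_norm// ltW.
  rewrite G0 ?subrr ?mulr0 ?normr0// => xr'; apply: xr => j.
  by rewrite (le_trans (xr' j))// lerDl.
have hcvg x : h ^~ x @ \oo --> pderiv i G x.
  have := @diff_derivable _ _ _ G x e (dG x); rewrite /derivable -/(pderiv i G x) => cG'.
  have tcvg : t @ \oo --> 0^'.
    move=> A /= [eps /= eps0 HA].
    have := @cvg_harmonic R => /cvgrPdist_lt/(_ eps eps0) H.
    change (\forall m \near \oo, A (t m)).
    near=> m; apply: HA => /=; last by rewrite gt_eqF.
    by near: m; exact: H.
  pose q (u : R) := u^-1 *: ((G \o shift x) (u *: e) - G x).
  have -> : h ^~ x = q \o t.
    by apply/funext => m; rewrite /q /h /= [_ + x]addrC.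
  exact: (cvg_comp _ _ tcvg (cG' : q @ 0^' --> pderiv i G x)).
have mh m : measurable_fun setT (h m).
  by apply: measurable_funM => //; exact: measurable_funB.
have h0 m : (\int[leb]_x (h m x)%:E = 0)%E.
  have iGs : leb.-integrable setT (EFin \o (fun x : pt => G (x + t m *: e))).
    apply: (@integrable_bounded_support _ _ _ L' (r + 1)) => //.
      move=> x xr; apply: G0 => xr'; apply: xr; have := shift_cube _ (- t m) _ _ xr'.
      by rewrite scaleNr addrK; apply; rewrite normrN ger0_norm// ltW.
    move=> x _; have [xr|xr] := pselect (cube r (x + t m *: e)); first exact: HL'.
    by rewrite G0// normr0.
  under eq_integral do rewrite /h EFinM EFinB.
  rewrite integralZl//; last exact: integrableB.
  rewrite integralB_EFin// (integral_shift (t m *: e) (f := EFin \o G)).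
    by rewrite subee ?mule0//; exact: integrable_fin_num.
  exact/measurable_EFinP.
have i_dom : leb.-integrable setT (fun x => (L * \1_(cube (r + 1)) x)%:E).
  apply: (@integrable_bounded_support _ _ (fun x => L * \1_(cube (r + 1)) x) L (r + 1)).
  - apply: measurable_funM => //; apply: measurable_indic; exact: measurable_cube.
  - by move=> x xr; rewrite indicE memNset// mulr0.
  - by move=> x xr; rewrite indicE mem_set// mulr1 ger0_norm.
have mpG := continuous_rV_measurable (cG i).
have := Rintegral_dominated_cvg measurableT mh mpG i_dom (fun m x _ => hb m x)
  (aeW _ (fun x _ => hcvg x)).
rewrite (_ : (fun m => _) = cst 0); last by apply/funext => m; rewrite /Rintegral h0.
by move=> /(cvg_unique (@Rhausdorff R) (cvg_cst 0)).
Unshelve. all: by end_near. Qed.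

End integration_by_parts.

Section one_variable.
Context {R : realType}.

(** A quadratic error bound is convenient at the points where a function changes
its formula. *)
Lemma is_derive_quadratic (f : R -> R) (t c M : R) :
  (forall h, `|h| <= 1 -> `|f (t + h) - f t - c * h| <= M * h ^+ 2) ->
  is_derive t (1 : R) f c.
Proof.
move=> H.
have M0 : 0 <= M.
  have := H 1; rewrite normr1 lexx expr1n !mulr1 => /(_ isT) H1.
  exact: le_trans (normr_ge0 _) H1.
have cv : h^-1 *: ((f \o shift t) (h *: (1 : R)) - f t) @[h --> 0^'] --> c.
  apply/cvgrPdist_le => eps eps0.
  near=> h.
  have h0 : h != 0 by near: h; exact: nbhs_dnbhs_neq.
  have hs : `|h| <= Num.min 1 (eps / (M + 1)).
    near: h; apply: dnbhs0_le; rewrite lt_min ltr01/= divr_gt0//; lra.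
  rewrite /= /GRing.scale/= mulr1 [h + t]addrC.
  have -> : c - h^-1 * (f (t + h) - f t) = - h^-1 * (f (t + h) - f t - c * h).
    by field.
  move: hs; rewrite le_min => /andP[h1 h2].
  rewrite normrM normrN normfV; apply: (@le_trans _ _ (`|h|^-1 * (M * h ^+ 2))).
    by rewrite ler_wpM2l ?invr_ge0//; exact: H.
  rewrite -[h ^+ 2]real_normK ?num_real// expr2 mulrCA mulKf ?normr_eq0//.
  apply: (@le_trans _ _ ((M + 1) * `|h|)); first by rewrite ler_wpM2r// lerDl.
  by rewrite mulrC -ler_pdivlMr//; lra.
split; first by apply/cvg_ex; exists c.
exact: cvg_lim cv.
Unshelve. all: by end_near. Qed.

End one_variable.

(** * Square integrable functions *)

Section L2_functions.
Context {R : realType} {d : nat}.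
Local Notation pt := 'rV[R]_d.
Local Notation leb := (@lebesgue_rV R d).
Implicit Types (D E : set pt) (f g : pt -> R).

Let restrictM D f g : (fun x => f x * g x) \_ D = (f \_ D) \* (g \_ D).
Proof. by apply/funext => x; rewrite /= !patchE; case: ifP => _ //; rewrite mulr0. Qed.

Lemma L2P D f : measurable D ->
  L2 D f <-> measurable_fun D f /\
    leb.-integrable D (EFin \o (fun x => f x * f x)).
Proof.
move=> mD; rewrite /L2 /=; split.
  move=> L2f; split.
    apply/(measurable_restrictT _ mD).
    by move: L2f; rewrite inE => /andP[]; rewrite inE.
  apply/(integrable_mkcond _ mD).
  have -> : (EFin \o (fun x => f x * f x)) \_ D = EFin \o ((f \_ D) \* (f \_ D)).
    by rewrite -restrictM; apply/funext => x; rewrite /= !patchE; case: ifP.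
  apply/Lfun1_integrable; exact: Lfun2_mul_Lfun1.
move=> [mf iff].
have mfD : measurable_fun setT (f \_ D) by exact/(measurable_restrictT _ mD).
rewrite inE; apply/andP; split; rewrite inE//=.
rewrite /finite_norm unlock /Lnorm; apply: poweR_lty.
move: iff => /(integrable_mkcond _ mD) /(integrable_lty measurableT).
congr (_ < +oo)%E; apply: eq_integral => x _ /=; rewrite !patchE; case: ifP => _ /=.
  by rewrite powR_mulrn// -normrX expr2 ger0_norm// -expr2 sqr_ge0.
by rewrite normr0 powR0// gt_eqF.
Qed.

Lemma L2_measurable D f : measurable D -> L2 D f -> measurable_fun D f.
Proof. by move=> mD /(L2P _ mD)[]. Qed.

Lemma L2_integrableM D f g : measurable D -> L2 D f -> L2 D g ->
  leb.-integrable D (EFin \o (fun x => f x * g x)).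
Proof.
move=> mD L2f L2g; apply/(integrable_mkcond _ mD).
have -> : (EFin \o (fun x => f x * g x)) \_ D = EFin \o ((f \_ D) \* (g \_ D)).
  by rewrite -restrictM; apply/funext => x; rewrite /= !patchE; case: ifP.
apply/Lfun1_integrable; exact: Lfun2_mul_Lfun1.
Qed.

Lemma L2D D f g : measurable D -> L2 D f -> L2 D g -> L2 D (fun x => f x + g x).
Proof.
move=> mD Lf Lg; apply/(L2P _ mD); split.
  by apply: measurable_funD; exact: L2_measurable.
have -> : EFin \o (fun x => (f x + g x) * (f x + g x)) =
    ((EFin \o (fun x => f x * f x)) \+ (EFin \o (fun x => f x * g x))) \+
    ((EFin \o (fun x => g x * f x)) \+ (EFin \o (fun x => g x * g x))).
  by apply/funext => x /=; rewrite -!EFinD; congr EFin; ring.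
by do ![apply: integrableD => //]; exact: L2_integrableM.
Qed.

Lemma L2M D f g (L : R) : measurable D -> L2 D f -> measurable_fun D g ->
  (forall x, D x -> `|g x| <= L) -> L2 D (fun x => g x * f x).
Proof.
move=> mD Lf mg gL; apply/(L2P _ mD); split.
  by apply: measurable_funM => //; exact: L2_measurable.
apply: (@le_integrable _ _ _ _ D mD _ (fun x => (L ^+ 2)%:E * (f x * f x)%:E)%E).
- apply/measurable_EFinP.
  by do ![apply: measurable_funM => //]; exact: L2_measurable.
- move=> x Dx /=; rewrite lee_fin mulrACA -!expr2 normrM.
  rewrite [leRHS]ger0_norm; last by rewrite mulr_ge0// sqr_ge0.
  rewrite (ger0_norm (sqr_ge0 _)) (ger0_norm (sqr_ge0 _)).
  rewrite ler_wpM2r ?sqr_ge0// -[g x ^+ 2]real_normK ?num_real//.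
  by rewrite lerXn2r ?nnegrE//; [exact: le_trans (gL x Dx)|exact: gL].
- by apply: integrableZl => //; exact: L2_integrableM.
Qed.

Lemma L2Z D c f : measurable D -> L2 D f -> L2 D (fun x => c * f x).
Proof. by move=> mD Lf; apply: (@L2M D f (fun=> c) `|c|). Qed.

Lemma L2B D f g : measurable D -> L2 D f -> L2 D g -> L2 D (fun x => f x - g x).
Proof.
move=> mD Lf Lg; apply: L2D => //; have := L2Z (-1) mD Lg.
by congr L2; apply/funext => x; rewrite mulN1r.
Qed.

Lemma L2_bounded D f (L : R) : measurable D -> (leb D < +oo)%E ->
  measurable_fun D f -> (forall x, D x -> `|f x| <= L) -> L2 D f.
Proof.
move=> mD Doo mf fL.
have : L2 D (fun x => f x * 1).
  apply: (@L2M D (fun=> 1) f L mD) => //; apply/(L2P _ mD); split => //.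
  by apply: (bounded_integrable (L := 1)) => // x _ /=; rewrite mulr1 normr1.
by congr L2; apply/funext => x; rewrite mulr1.
Qed.

Lemma L2S D E f : measurable D -> measurable E -> E `<=` D -> L2 D f -> L2 E f.
Proof.
move=> mD mE ED /(L2P _ mD)[mf iff]; apply/(L2P _ mE); split.
  exact: measurable_funS mf.
exact: integrableS iff.
Qed.

Lemma L2_integrable D f : measurable D -> (leb D < +oo)%E -> L2 D f ->
  leb.-integrable D (EFin \o f).
Proof.
move=> mD Doo Lf; have L1 : L2 D (fun=> 1).
  by apply: (L2_bounded (L := 1)) => // x _; rewrite normr1.
have := L2_integrableM mD Lf L1; congr (_.-integrable).
by apply/funext => x /=; rewrite mulr1.
Qed.

Lemma L2_patch D E f : measurable D -> measurable E -> L2 E f -> L2 D (f \_ E).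
Proof.
move=> mD mE Lf.
have : L2 setT (f \_ E).
  by move: Lf; rewrite /L2/= patch_setT.
exact: L2S.
Qed.

End L2_functions.

(** * The fundamental lemma of the calculus of variations *)

Section flat_functions.
Context {R : realType}.

(** For t > 0 the derivative is of the same form, with the polynomial
X^2 (P - P'); at 0 all of them vanish to infinite order. *)
Definition flat (P : {poly R}) (t : R) : R :=
  if 0 < t then P.[t^-1] * expR (- t^-1) else 0.

(** The exponential of -s decays faster than any power of s = 1 / t. *)
Lemma flat_small (P : {poly R}) :
  exists M : R, forall t, `|flat P t| <= M * t ^+ 2.
Proof.
pose N := size P.
pose A := \sum_(i < N) `|P`_i|.
have A0 : 0 <= A by exact: sumr_ge0.
have [B [B0 HB]] : exists B : R, 0 <= B /\ forall t, 0 < t -> t <= 1 ->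
    `|flat P t| <= B * t ^+ 2.
  exists (A * (N.+2)`!%:R); split; first by rewrite mulr_ge0.
  move=> t t0 t1; rewrite /flat t0; set s := t^-1.
  have s0 : 0 < s by rewrite invr_gt0.
  have s1 : 1 <= s by rewrite invf_ge1.
  have Ps : `|P.[s]| <= A * s ^+ N.
    rewrite horner_coef mulr_suml; apply: le_trans (ler_norm_sum _ _ _) _.
    apply: ler_sum => i _; rewrite normrM ler_wpM2l// normrX (ger0_norm (ltW s0)).
    by rewrite ler_weXn2l// ltnW.
  have es : expR (- s) <= (N.+2)`!%:R * s^-1 ^+ N.+2.
    rewrite expRN exprVn -[leRHS]invrK lef_pV2 ?posrE ?expR_gt0//; last first.
      by rewrite invr_gt0 mulr_gt0 ?ltr0n ?fact_gt0// invr_gt0 exprn_gt0.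
    rewrite invfM invrK mulrC; apply: le_trans (expR_ge1Dxn N.+1 (ltW s0)).
    by rewrite lerDr.
  rewrite normrM (ger0_norm (expR_ge0 _)).
  apply: (le_trans (ler_pM _ (expR_ge0 _) Ps es)) => //.
  rewrite mulrACA [leRHS](_ : _ = A * N.+2`!%:R * (s ^+ N * s^-1 ^+ N.+2))//.
  by rewrite -addn2 exprD mulrA -exprMn divff ?gt_eqF// expr1n mul1r /s invrK.
have [C [C0 HC]] : exists C : R, 0 <= C /\ forall t, 1 <= t -> `|flat P t| <= C.
  exists A; split => // t t1; have t0 : 0 < t by apply: lt_le_trans t1.
  rewrite /flat t0 normrM (ger0_norm (expR_ge0 _)).
  have e1 : expR (- t^-1) <= 1 by rewrite expR_le1 oppr_le0 invr_ge0 ltW.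
  apply: (@le_trans _ _ `|P.[t^-1]|); first by rewrite ler_piMr.
  rewrite horner_coef; apply: le_trans (ler_norm_sum _ _ _) _.
  apply: ler_sum => i _; rewrite normrM ler_piMr// normrX.
  by rewrite exprn_ile1// ger0_norm ?invr_ge0 ?invf_le1// ltW.
exists (B + C) => t; have [t0|t0] := leP t 0.
  by rewrite /flat ltNge t0/= normr0 mulr_ge0 ?addr_ge0// sqr_ge0.
have [t1|/ltW t1] := leP t 1.
  by apply: le_trans (HB _ t0 t1) _; rewrite ler_wpM2r ?sqr_ge0// lerDl.
apply: le_trans (HC _ t1) _.
apply: (@le_trans _ _ (C * t ^+ 2)); first by rewrite ler_peMr// expr_ge1// ltW.
by rewrite ler_wpM2r ?sqr_ge0// lerDr.
Qed.

Lemma is_derive_flat (P : {poly R}) (t : R) :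
  is_derive t (1 : R) (flat P) (flat ('X^2 * (P - P^`())) t).
Proof.
have [t0|t0|<-] := ltgtP 0 t.
- rewrite {2}/flat t0.
  pose F := (fun t : R => P.[t^-1] * expR (- t^-1)).
  have tn0 : t != 0 by rewrite gt_eqF.
  have dF : is_derive t (1 : R) F (('X^2 * (P - P^`())).[t^-1] * expR (- t^-1)).
    have dV : is_derive t (1 : R) (fun t : R => t^-1) (- t ^- 2).
      split; first exact: derivableV.
      by rewrite deriveV// derive_id /GRing.scale/= mulr1.
    have dP : is_derive t (1 : R) (fun t : R => P.[t^-1]) (- t ^- 2 * P^`().[t^-1]).
      by apply: is_derive_eq (is_derive1_comp (is_derive_poly P t^-1) dV) _; rewrite mulrC.
    have dE : is_derive t (1 : R) (fun t : R => expR (- t^-1)) (t ^- 2 * expR (- t^-1)).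
      have dN : is_derive t (1 : R) (fun t : R => - t^-1) (t ^- 2).
        by have := is_deriveN dV; rewrite opprK.
      have dc := @is_derive1_comp _ expR (fun t => - t^-1) t _ _ (is_derive_expR (- t^-1)) dN.
      by apply: is_derive_eq dc _; rewrite mulrC.
    apply: is_derive_eq (is_deriveM dP dE) _.
    by rewrite hornerM hornerXn hornerD hornerN /GRing.scale/= exprVn; ring.
  apply: near_eq_is_derive dF => //.
  near=> s; rewrite /flat /F ifT//; near: s; exact: lt_nbhsr.
- rewrite {2}/flat ltNge (ltW t0)/=.
  apply: near_eq_is_derive (is_derive_cst 0 t 1) => //.
  near=> s; rewrite /flat ltNge ltW//=; near: s; exact: lt_nbhsl.
- rewrite {2}/flat ltxx; have [M HM] := flat_small P.
  apply: (@is_derive_quadratic _ _ _ _ M) => h _.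
  by rewrite add0r mul0r subr0 {2}/flat ltxx subr0; exact: HM.
Unshelve. all: by end_near. Qed.

Lemma flat1_itv (t : R) : 0 <= flat 1 t <= 1.
Proof.
rewrite /flat; case: ifP => t0; last by rewrite lexx ler01.
by rewrite hornerC mul1r expR_ge0 expR_le1 oppr_le0 invr_ge0 ltW.
Qed.

Lemma flat1_le0 (t : R) : t <= 0 -> flat 1 t = 0.
Proof. by move=> t0; rewrite /flat ltNge t0. Qed.

Lemma cvg_flat1 (t : R) : 0 < t -> flat 1 (m.+1%:R * t) @[m --> \oo] --> (1 : R).
Proof.
move=> t0.
rewrite (_ : (fun m => _) = (fun m : nat => expR (- (t^-1 * harmonic m)))).
  rewrite -[X in _ --> X]expR0 -oppr0 -(mulr0 t^-1).
  have H : - (t^-1 * harmonic m) @[m --> \oo] --> - (t^-1 * 0 : R).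
    by apply: cvgN; apply: cvgMr; exact: cvg_harmonic.
  exact: (cvg_comp _ _ H (@continuous_expR R _)).
apply/funext => m; rewrite /flat mulr_gt0// hornerC mul1r invfM.
by rewrite /harmonic mulrC.
Qed.

End flat_functions.

Section test_functions.
Context {R : realType} {d : nat}.
Local Notation pt := 'rV[R]_d.

(** A class of functions closed under partial derivatives, hence of smooth
functions, that contains bump functions supported in boxes. *)
Inductive bump : (pt -> R) -> Prop :=
| bump_cst c : bump (fun=> c)
| bump_flat P i c s : bump (fun x => flat P (c + s * x ord0 i))
| bumpD f g : bump f -> bump g -> bump (fun x => f x + g x)
| bumpM f g : bump f -> bump g -> bump (fun x => f x * g x).

Lemma bump_differentiable f : bump f ->
  (forall x, differentiable f x) /\ forall i, bump (pderiv i f).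
Proof.
elim=> {f} [c|P i c s|f g _ [df bf] _ [dg bg]|f g bpf [df bf] bpg [dg bg]].
- split=> [x|i]; first exact: differentiable_cst.
  by rewrite pderiv_cst; exact: bump_cst.
- have pl : polyfun 1 (fun x : pt => c + s * x ord0 i).
    by apply: polyfunD; [exact: polyfun_cst|apply: polyfunZ; exact: polyfun_coord].
  have dl x := polyfun_differentiable x pl.
  have H j x := pderiv_comp1 j (is_derive_flat P) (dl x).
  split=> [x|j]; first by have [] := H i x.
  have -> : pderiv j (fun x : pt => flat P (c + s * x ord0 i)) =
      fun x => (s * (j == i)%:R) * flat ('X^2 * (P - P^`())) (c + s * x ord0 i).
    apply/funext => x; have [_ ->] := H j x.
    rewrite mulrC; congr (_ * _).
    rewrite pderivD; last 2 first.
    + exact: differentiable_cst.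
    + exact: polyfun_differentiable (polyfunZ s (polyfun_coord 0 i)).
    rewrite pderiv_cst add0r pderivZ; last exact: differentiable_rV_coord.
    by rewrite pderiv_coord.
  by apply: bumpM; [exact: bump_cst|exact: bump_flat].
- split=> [x|i]; first exact: differentiableD.
  have -> : pderiv i (fun x => f x + g x) = fun x => pderiv i f x + pderiv i g x.
    by apply/funext => x; rewrite pderivD.
  exact: bumpD.
- split=> [x|i]; first exact: differentiableM.
  have -> : pderiv i (fun x => f x * g x) = fun x => f x * pderiv i g x + g x * pderiv i f x.
    by apply/funext => x; rewrite pderivM.
  by apply: bumpD; exact: bumpM.
Qed.

Lemma bump_smooth f : bump f -> smooth f.
Proof.
move=> bf l; suff /bump_differentiable[] : bump (pderivs l f) by [].
by elim: l => [//|i l /bump_differentiable[_]] /=.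
Qed.

Lemma bump_prod (I : Type) (r : seq I) (F : I -> pt -> R) :
  (forall i, bump (F i)) -> bump (fun x => \prod_(i <- r) F i x).
Proof.
move=> bF; elim: r => [|i r ih].
  rewrite (_ : (fun=> _) = fun=> 1); first exact: bump_cst.
  by apply/funext => x; rewrite big_nil.
rewrite (_ : (fun=> _) = fun x => F i x * \prod_(i <- r) F i x); first exact: bumpM.
by apply/funext => x; rewrite big_cons.
Qed.

(** Supported in a closed box, and tending to the indicator function of the open
box as m grows. *)
Definition box_bump (a b : pt) (m : nat) (x : pt) : R :=
  \prod_(i < d) (flat 1 (m.+1%:R * (x ord0 i - a ord0 i)) *
                 flat 1 (m.+1%:R * (b ord0 i - x ord0 i))).

Lemma box_bump_smooth a b m : smooth (box_bump a b m).
Proof.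
apply: bump_smooth; apply: bump_prod => i; apply: bumpM.
  have := bump_flat 1 i (- (m.+1%:R * a ord0 i)) m.+1%:R.
  by congr bump; apply/funext => x; congr flat; ring.
have := bump_flat 1 i (m.+1%:R * b ord0 i) (- m.+1%:R).
by congr bump; apply/funext => x; congr flat; ring.
Qed.

Lemma box_bump_itv a b m x : 0 <= box_bump a b m x <= 1.
Proof.
rewrite /box_bump; elim/big_ind : _ => [|y z /andP[y0 y1] /andP[z0 z1]|i _].
- by rewrite ler01 lexx.
- by rewrite mulr_ge0//= mulr_ile1.
- have /andP[u0 u1] := flat1_itv (m.+1%:R * (x ord0 i - a ord0 i)).
  have /andP[v0 v1] := flat1_itv (m.+1%:R * (b ord0 i - x ord0 i)).
  by rewrite mulr_ge0//= mulr_ile1.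
Qed.

Lemma box_bump_out a b m x : ~ obox a b x -> box_bump a b m x = 0.
Proof.
move=> xab; have [i Hi] : exists i, ~ (a ord0 i < x ord0 i < b ord0 i).
  by apply/existsNP.
rewrite /box_bump (bigD1 i)//=; have [ax|xa] := ltP (a ord0 i) (x ord0 i).
  have bx : b ord0 i <= x ord0 i by rewrite leNgt; apply/negP => xb; apply: Hi; rewrite ax.
  by rewrite (flat1_le0 (t := _ * (b _ _ - _))) ?mulr0 ?mul0r// mulr_ge0_le0// subr_le0.
by rewrite flat1_le0 ?mul0r// mulr_ge0_le0// subr_le0.
Qed.

Lemma cvg_box_bump a b x : obox a b x -> box_bump a b m x @[m --> \oo] --> (1 : R).
Proof.
move=> xab.
pose F i m : R := flat 1 (m.+1%:R * (x ord0 i - a ord0 i)) *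
  flat 1 (m.+1%:R * (b ord0 i - x ord0 i)).
have cF i : F i @ \oo --> (1 : R).
  have /andP[ax xb] := xab i; rewrite -(mulr1 (1 : R)).
  by apply: cvgM; apply: cvg_flat1; rewrite subr_gt0.
suff : forall r : seq 'I_d, (fun m => \prod_(i <- r) F i m) @ \oo --> (1 : R) by apply.
elim=> [|i r ih].
  by under eq_fun do rewrite big_nil; exact: cvg_cst.
have -> : (fun m => \prod_(j <- i :: r) F j m) = F i \* (fun m => \prod_(j <- r) F j m).
  by apply/funext => m; rewrite /= big_cons.
have H := cvgM (cF i) ih; rewrite mulr1 in H; exact: H.
Qed.

Lemma cbox_compact (a b : pt) : compact (cbox a b).
Proof.
rewrite cboxE; apply: (@rV_compact R d (fun i => `[a ord0 i, b ord0 i]%classic)).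
by move=> i; exact: segment_compact.
Qed.

Lemma box_bump_test Omega a b m : cbox a b `<=` Omega ->
  test_function Omega (box_bump a b m).
Proof.
move=> abO; split; first exact: box_bump_smooth.
exists (cbox a b); split => //; first exact: cbox_compact.
move=> x xab; apply: box_bump_out => H; apply: xab => i.
by have /andP[/ltW -> /ltW ->] := H i.
Qed.

End test_functions.

Section integral_measure.
Context d (T : measurableType d) (R : realType) (mu : {measure set T -> \bar R}).
Variable f : T -> \bar R.
Hypotheses (mf : measurable_fun setT f) (f0 : forall x, (0 <= f x)%E).

(** The hypotheses are arguments so that the measure structure can be inferred. *)
Definition integral_measure & (measurable_fun setT f) & (forall x, (0 <= f x)%E) :=
  fun E : set T => (\int[mu]_(x in E) f x)%E.

Let m := integral_measure mf f0.

Let m0 : m set0 = 0%E. Proof. exact: integral_set0. Qed.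

Let m_ge0 E : (0 <= m E)%E. Proof. by apply: integral_ge0 => x _; exact: f0. Qed.

Let m_sigma_additive : semi_sigma_additive m.
Proof.
move=> F mF tF mUF; rewrite /m /integral_measure ge0_integral_bigcup//; last first.
  exact: measurable_funS mf.
by apply: is_cvg_ereal_nneg_natsum_cond => n _ _; exact: integral_ge0.
Qed.

HB.instance Definition _ := isMeasure.Build _ _ _ (integral_measure mf f0)
  m0 m_ge0 m_sigma_additive.

End integral_measure.

Section fundamental_lemma.
Context {R : realType} {n : nat}.
Local Notation d := n.+1.
Local Notation pt := 'rV[R]_d.
Local Notation leb := (@lebesgue_rV R d).

Lemma obox_setI (a b a' b' : pt) : obox a b `&` obox a' b' =
  obox (\row_i Num.max (a ord0 i) (a' ord0 i)) (\row_i Num.min (b ord0 i) (b' ord0 i)).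
Proof.
apply/seteqP; split => x /=.
  move=> [H H'] i; rewrite !mxE gt_max lt_min.
  by have /andP[-> ->] := H i; have /andP[-> ->] := H' i.
move=> H; split => i; have := H i; rewrite !mxE gt_max lt_min.
  by move=> /andP[/andP[-> _] /andP[-> _]].
by move=> /andP[/andP[_ ->] /andP[_ ->]].
Qed.

Lemma measurable_rV_oboxE : @measurable _ pt =
  <<s [set B | exists a b : pt, B = obox a b] >>.
Proof.
apply/seteqP; split; last first.
  apply: smallest_sub; first exact: sigma_algebra_measurable.
  by move=> _ [a [b ->]]; exact: measurable_obox.
apply: smallest_sub; first exact: smallest_sigma_algebra.
move=> B; rewrite -bigcup_seq/= => -[i _ [A mA <-]].
set G := [set B | _].
pose f : g_sigma_algebraType G -> measurableTypeR R := fun x => x ord0 i.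
suff mf : measurable_fun setT f by exact: (mf measurableT A mA).
apply: (measurability _ (RGenOpens.measurableE R)).
move=> _ [_ [x [y ->]] <-]; rewrite setTI.
pose a k : pt := \row_j if j == i then x else - k%:R.
pose b k : pt := \row_j if j == i then y else k%:R.
rewrite (_ : f @^-1` _ = \bigcup_k (obox (a k) (b k) : set (g_sigma_algebraType G))).
  apply: bigcupT_measurable => k; apply: sub_sigma_algebra.
  by exists (a k), (b k).
apply/seteqP; split => z /=; rewrite in_itv/=; last first.
  by move=> [k _ /(_ i)]; rewrite !mxE eqxx.
move=> zxy; have [k zk] := @cube_natP R d z.
exists k.+1 => // j; rewrite !mxE; case: eqP => [->//|_].
have := zk j; rewrite ler_norml => /andP[h1 h2].
rewrite (lt_le_trans _ h1) ?(le_lt_trans h2) ?ltr_nat//.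
by rewrite ltrN2 ltr_nat.
Qed.

(** The positive and the negative part of g are the densities of two finite
measures that agree on boxes, hence on all Borel sets. *)
Lemma integral_obox_eq0 (g : pt -> R) : leb.-integrable setT (EFin \o g) ->
  (forall a b, (\int[leb]_(x in obox a b) (g x)%:E = 0)%E) ->
  {ae leb, forall x, g x = 0}.
Proof.
move=> ig H.
pose G := EFin \o g.
have mG : measurable_fun setT G by exact: measurable_int ig.
have mP := measurable_funepos mG; have mN := measurable_funeneg mG.
have P0 x : (0 <= G^\+ x)%E by exact: funepos_ge0.
have N0 x : (0 <= G^\- x)%E by exact: funeneg_ge0.
pose m1 := integral_measure leb mP P0.
pose m2 := integral_measure leb mN N0.
have fP : (m1 setT < +oo)%E by exact: integrable_lty (integrable_funepos _ ig).
have fN : (m2 setT < +oo)%E by exact: integrable_lty (integrable_funeneg _ ig).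
have m12 : forall E, measurable E -> m1 E = m2 E.
  move=> E mE.
  apply: (measure_unique _ (fun k : nat => obox (const_mx (- k%:R)) (const_mx k%:R))
    measurable_rV_oboxE) => //.
  - move=> _ _ [a [b ->]] [a' [b' ->]]; rewrite obox_setI.
    by do 2 eexists; reflexivity.
  - by move=> k; do 2 eexists; reflexivity.
  - rewrite predeqE => x; split => // _; have [k xk] := @cube_natP R d x.
    exists k.+1 => // j; rewrite !mxE.
    have := xk j; rewrite ler_norml => /andP[h1 h2].
    rewrite (lt_le_trans _ h1) ?(le_lt_trans h2) ?ltr_nat//.
    by rewrite ltrN2 ltr_nat.
  - move=> _ [a [b ->]]; have := H a b; rewrite integralE.
    have mab := measurable_obox a b.
    have iP : leb.-integrable (obox a b) G^\+%E.
      by apply: (integrableS measurableT) => //; exact: integrable_funepos.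
    have iN : leb.-integrable (obox a b) G^\-%E.
      by apply: (integrableS measurableT) => //; exact: integrable_funeneg.
    move=> /eqP; rewrite sube_eq ?add0e => [/eqP//||].
      exact: integrable_fin_num iP.
    rewrite fin_num_adde_defl//; exact: integrable_fin_num iN.
  - move=> k; apply: le_lt_trans fP; apply: le_measure => //; rewrite inE//.
    exact: measurable_obox.
have : ae_eq leb setT G (cst 0%E).
  apply: integral_ae_eq => // E _ mE; rewrite integral0 integralE.
  have iP : leb.-integrable E G^\+%E.
    by apply: (integrableS measurableT) => //; exact: integrable_funepos.
  rewrite -[X in (X - _)%E]/(m1 E) m12// subee//.
  rewrite -m12//; exact: integrable_fin_num iP.
by apply: filterS => x /(_ I) [].
Qed.

(** Bumps that tend to the indicator function of a box give integral zero over each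
box inside the open set, and countably many boxes cover it. *)
Lemma fundamental_lemma (Omega : set pt) (g : pt -> R) : open Omega -> L2 Omega g ->
  (forall phi, test_function Omega phi -> ip Omega g phi = 0) ->
  {ae leb, forall x, Omega x -> g x = 0}.
Proof.
move=> oO Lg Hg; have mO := open_rV_measurable oO.
have [a [b [OE subO]]] := open_bigcup_box oO.
suff : {ae leb, forall x, forall k, obox (a k) (b k) x -> g x = 0}.
  by apply: filterS => x Hx; rewrite OE => -[k _]; exact: Hx.
apply: ae_foralln => k.
have mk := measurable_obox (a k) (b k).
have subk : obox (a k) (b k) `<=` cbox (a k) (b k).
  by move=> x H i; have /andP[/ltW -> /ltW ->] := H i.
have koo : (leb (obox (a k) (b k)) < +oo)%E.
  apply: le_lt_trans (lebesgue_cbox_fin (a k) (b k)).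
  by apply: le_measure; rewrite ?inE//; exact: measurable_cbox.
have subkO : obox (a k) (b k) `<=` Omega by move=> x /subk /subO.
suff : {ae leb, forall x, (g \_ (obox (a k) (b k))) x = 0}.
  by apply: filterS => x + xk; rewrite patchE mem_set.
have Lgk : L2 (obox (a k) (b k)) g by apply: L2S Lg.
have igk := L2_integrable mk koo Lgk.
apply: integral_obox_eq0.
  have := (integrable_mkcond _ mk).1 igk; congr (_.-integrable).
  by apply/funext => x; rewrite /= !patchE; case: ifP.
move=> a' b'.
set ak := \row_i Num.max ((a k) ord0 i) (a' ord0 i).
set bk := \row_i Num.min ((b k) ord0 i) (b' ord0 i).
have subc : cbox ak bk `<=` Omega.
  move=> x H; apply: (subO k) => i; have := H i; rewrite !mxE ge_max le_min.
  by move=> /andP[/andP[-> _] /andP[-> _]].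
have subok : obox ak bk `<=` obox (a k) (b k) by rewrite -obox_setI; exact: subIsetl.
have mok := measurable_obox ak bk.
pose phi m := box_bump ak bk m.
have mphi m : measurable_fun setT (phi m).
  by apply: continuous_rV_measurable; apply: C1_continuous; apply: smooth_C1;
    exact: box_bump_smooth.
have phi_ip m : \int[leb]_(x in obox ak bk) (g x * phi m x) = 0.
  rewrite -(Hg _ (box_bump_test m subc)).
  apply: ae_eq_Rintegral; apply: aeW => x; rewrite !patchE.
  case: (boolP (x \in obox ak bk)) => [/set_mem xo|/negP nxo].
    by rewrite mem_set//; apply: subkO; exact: subok.
  case: ifP => // _; rewrite [box_bump _ _ _ _]box_bump_out ?mulr0// => H.
  by apply: nxo; rewrite inE.
have -> : (\int[leb]_(x in obox a' b') ((g \_ (obox (a k) (b k))) x)%:E =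
    \int[leb]_(x in obox ak bk) (g x)%:E)%E.
  apply: ae_eq_integral_nonmeasurable; apply: aeW => x.
  rewrite -[obox ak bk]obox_setI !patchE in_setI.
  by case: (x \in obox a' b'); case: (x \in obox (a k) (b k)).
have mg : measurable_fun (obox ak bk) g.
  by apply: measurable_funS (L2_measurable mk Lgk).
have mgp m : measurable_fun (obox ak bk) (fun x => g x * phi m x).
  by apply: measurable_funM => //; exact: measurable_funS (mphi m).
have cvgp : {ae leb, forall x, obox ak bk x -> (fun m => g x * phi m x) @ \oo --> g x}.
  apply: aeW => x xo; have : (fun m => g x * phi m x) @ \oo --> g x * 1.
    by apply: cvgMr; exact: cvg_box_bump.
  by rewrite mulr1.
have domp m x : obox ak bk x -> `|g x * phi m x| <= `|g x|.
  move=> _; rewrite normrM ler_piMr//.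
  by have /andP[h0 h1] := box_bump_itv ak bk m x; rewrite ger0_norm.
have igk' : leb.-integrable (obox ak bk) (EFin \o g) by apply: integrableS igk.
have igd : leb.-integrable (obox ak bk) (EFin \o (fun x => `|g x|)) := integrable_abse igk'.
apply/eqP; rewrite -fine_eq0 ?integrable_fin_num//; apply/eqP.
have := Rintegral_dominated_cvg mok mgp mg igd domp cvgp.
rewrite (_ : (fun m => _) = cst 0); last by apply/funext => m; exact: phi_ip.
rewrite -[fine _]/(\int[leb]_(x in obox ak bk) g x).
by move=> /(cvg_unique (@Rhausdorff R) (cvg_cst 0)) <-.
Qed.

End fundamental_lemma.

(** * Simplices and barycentric coordinates *)

Section dot_product.
Context {R : realType} {d : nat}.
Local Notation pt := 'rV[R]_d.
Implicit Types (x y z : pt).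

Lemma dotC x y : dot x y = dot y x.
Proof. by apply: eq_bigr => i _; rewrite mulrC. Qed.

Lemma dotDl x y z : dot (x + y) z = dot x z + dot y z.
Proof. by rewrite /dot -big_split; apply: eq_bigr => i _; rewrite mxE mulrDl. Qed.

Lemma dotZl c x y : dot (c *: x) y = c * dot x y.
Proof. by rewrite /dot mulr_sumr; apply: eq_bigr => i _; rewrite mxE -mulrA. Qed.

Lemma dotNl x y : dot (- x) y = - dot x y.
Proof. by rewrite -scaleN1r dotZl mulN1r. Qed.

Lemma dotBl x y z : dot (x - y) z = dot x z - dot y z.
Proof. by rewrite dotDl dotNl. Qed.

Lemma dot_suml (I : Type) (r : seq I) (P : pred I) (F : I -> pt) z :
  dot (\sum_(i <- r | P i) F i) z = \sum_(i <- r | P i) dot (F i) z.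
Proof.
elim/big_rec2 : _ => [|i y x _ <-]; last by rewrite dotDl.
by rewrite /dot big1// => i _; rewrite mxE mul0r.
Qed.

Lemma dot_mulmx m (t : 'rV[R]_m) (S : 'M[R]_(m, d)) z :
  dot (t *m S) z = \sum_i t ord0 i * dot (row i S) z.
Proof. by rewrite mulmx_sum_row dot_suml; apply: eq_bigr => i _; rewrite dotZl. Qed.

Lemma dot_delta (i : 'I_d) z : dot (delta_mx ord0 i) z = z ord0 i.
Proof.
rewrite /dot (bigD1 i)//= mxE !eqxx mul1r big1 ?addr0// => j ji.
by rewrite mxE (negbTE ji) andbF mul0r.
Qed.

Lemma dotxx_ge0 x : 0 <= dot x x.
Proof. by apply: sumr_ge0 => i _; rewrite -expr2 sqr_ge0. Qed.

Lemma dotxx_eq0 x : (dot x x == 0) = (x == 0).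
Proof.
apply/idP/eqP => [|->]; last by rewrite /dot big1// => i _; rewrite mxE mul0r.
rewrite psumr_eq0; last by move=> i _; rewrite -expr2 sqr_ge0.
move=> /allP H; apply/rowP => i; rewrite mxE; apply/eqP.
by have := H i (mem_index_enum i); rewrite /= -expr2 sqrf_eq0.
Qed.

Lemma sqr_enorm x : enorm x ^+ 2 = dot x x.
Proof. by rewrite /enorm sqr_sqrtr// dotxx_ge0. Qed.

Lemma enorm_ge0 x : 0 <= enorm x. Proof. exact: sqrtr_ge0. Qed.

Lemma normr_le_enorm x i : `|x ord0 i| <= enorm x.
Proof.
rewrite -sqrtr_sqr /enorm ler_sqrt ?dotxx_ge0// /dot (bigD1 i)//= -expr2 lerDl.
by apply: sumr_ge0 => j _; rewrite -expr2 sqr_ge0.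
Qed.

Lemma enorm_cube (r : R) x : 0 <= r -> cube r x -> enorm x <= d.+1%:R * r.
Proof.
move=> r0 xr; rewrite /enorm -[leRHS]ger0_norm; last by rewrite mulr_ge0.
rewrite -sqrtr_sqr ler_sqrt ?sqr_ge0//.
apply: (@le_trans _ _ (\sum_(i < d) r ^+ 2)).
  apply: ler_sum => i _; rewrite -expr2 -[_ ^+ 2]real_normK ?num_real//.
  by rewrite lerXn2r ?nnegrE//; exact: xr.
rewrite sumr_const card_ord exprMn -[r ^+ 2 *+ d]mulr_natl ler_wpM2r ?sqr_ge0//.
rewrite -natrX ler_nat expnS expn1; apply: (leq_trans (leqnSn d)).
by rewrite -{1}[d.+1]muln1 leq_mul2l.
Qed.

End dot_product.

Section simplex_points.
Context {R : realType} {d : nat}.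
Local Notation pt := 'rV[R]_d.

Lemma hull_vanish (V : seq pt) (c : R) (g : pt) : {in V, forall v, c + dot v g = 0} ->
  forall x, hull V x -> c + dot x g = 0.
Proof.
move=> HV x [t [_ t1 ->]]; rewrite dot_suml.
rewrite -[c]mulr1 -t1 mulr_sumr -big_split big1//= => i _.
have /HV H : V`_i \in V by rewrite mem_nth.
by rewrite dotZl [c * _]mulrC -mulrDr H mulr0.
Qed.

Lemma simplexP m (S : 'M[R]_(m, d)) x : simplex S x <->
  exists t : 'rV[R]_m, [/\ forall i, 0 <= t ord0 i, \sum_i t ord0 i = 1 & x = t *m S].
Proof.
have sz : size (vertices S) = m by rewrite size_map size_enum_ord.
have nthV (i : 'I_m) : (vertices S)`_i = row i S.
  by rewrite (nth_map i) ?size_enum_ord// nth_ord_enum.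
split.
  move=> [t [t0 t1 ->]]; exists (\row_i t (cast_ord (esym sz) i)); split.
  - by move=> i; rewrite mxE.
  - rewrite -t1 (reindex (cast_ord (esym sz)))/=.
      by apply: eq_bigr => i _; rewrite mxE.
    by exists (cast_ord sz) => i _; rewrite ?cast_ordK ?cast_ordKV.
  - rewrite mulmx_sum_row (reindex (cast_ord (esym sz)))/=.
      by apply: eq_bigr => i _; rewrite mxE nthV.
    by exists (cast_ord sz) => i _; rewrite ?cast_ordK ?cast_ordKV.
move=> [t [t0 t1 ->]]; exists (fun i => t ord0 (cast_ord sz i)); split => //.
- rewrite -t1 [RHS](reindex (cast_ord sz))//=.
  by exists (cast_ord (esym sz)) => i _; rewrite ?cast_ordK ?cast_ordKV.
- rewrite mulmx_sum_row (reindex (cast_ord sz))/=.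
    by apply: eq_bigr => i _; rewrite -nthV.
  by exists (cast_ord (esym sz)) => i _; rewrite ?cast_ordK ?cast_ordKV.
Qed.

Lemma mulmx_row0_edges m (S : 'M[R]_(m.+1, d)) (t : 'rV[R]_m.+1) :
  \sum_i t ord0 i = 1 ->
  t *m S = row ord0 S + (\row_j t ord0 (lift ord0 j)) *m edges S.
Proof.
move=> t1; rewrite !mulmx_sum_row big_ord_recl.
have -> : t ord0 ord0 = 1 - \sum_j t ord0 (lift ord0 j).
  by rewrite -t1 big_ord_recl addrK.
rewrite scalerBl scale1r -addrA; congr (_ + _).
rewrite scaler_suml -sumrN -big_split; apply: eq_bigr => j _ /=.
by rewrite mxE rowK scalerBr addrC.
Qed.

Lemma simplex_paramP m (S : 'M[R]_(m.+1, d)) x : simplex S x <->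
  exists2 y, @unit_simplex R m y & x = row ord0 S + y *m edges S.
Proof.
split.
  move=> /simplexP[t [t0 t1 ->]]; exists (\row_j t ord0 (lift ord0 j)).
    split=> [j|]; first by rewrite mxE.
    under eq_bigr do rewrite mxE.
    by rewrite -t1 big_ord_recl lerDr.
  exact: mulmx_row0_edges.
move=> [y [y0 y1] ->]; apply/simplexP.
pose t : 'rV[R]_m.+1 := \row_i oapp (fun j => y ord0 j) (1 - \sum_j y ord0 j) (unlift ord0 i).
have tl j : t ord0 (lift ord0 j) = y ord0 j by rewrite mxE liftK.
have t1 : \sum_i t ord0 i = 1.
  by rewrite big_ord_recl; under eq_bigr do rewrite tl; rewrite mxE unlift_none /= subrK.
exists t; split => //.
  by move=> i; rewrite mxE; case: unliftP => [j _|_] /=; rewrite ?subr_ge0.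
rewrite mulmx_row0_edges//; congr (_ + _ *m _).
by apply/rowP => j; rewrite mxE tl.
Qed.

End simplex_points.

Section barycentric.
Context {R : realType} {n : nat}.
Local Notation d := n.+1.
Local Notation pt := 'rV[R]_d.
Variable K : 'M[R]_(d.+1, d).

(** Vertices in homogeneous coordinates: the inverse matrix holds the
coefficients of the barycentric coordinates. *)
Definition homog m (S : 'M[R]_(m, d)) : 'M[R]_(m, d.+1) :=
  \matrix_(i, j) oapp (fun j' => S i j') 1 (unlift ord0 j).

Definition bgrad (i : 'I_d.+1) : pt := \row_j invmx (homog K) (lift ord0 j) i.

Definition bary (i : 'I_d.+1) (x : pt) : R := invmx (homog K) ord0 i + dot x (bgrad i).

Hypothesis ndK : nondegenerate K.

Lemma mulmx_homogP (t : 'rV[R]_d.+1) (x : pt) :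
  t *m homog K = homog x <-> t *m K = x /\ \sum_i t ord0 i = 1.
Proof.
have E0 : (t *m homog K) ord0 ord0 = \sum_i t ord0 i.
  by rewrite mxE; apply: eq_bigr => i _; rewrite mxE unlift_none /= mulr1.
have El j : (t *m homog K) ord0 (lift ord0 j) = (t *m K) ord0 j.
  by rewrite !mxE; apply: eq_bigr => i _; rewrite mxE liftK.
split=> [H|[tK t1]].
  split; last by rewrite -E0 H mxE unlift_none.
  by apply/rowP => j; rewrite -El H mxE liftK.
apply/rowP => j; rewrite [RHS]mxE; case: unliftP => [j' ->|->] /=.
  by rewrite El tK.
by rewrite E0.
Qed.

Lemma homog_unit : homog K \in unitmx.
Proof.
rewrite -row_free_unit; apply: inj_row_free => v vK.
have v1 : \sum_i v ord0 i = 0.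
  have := congr1 (fun z : 'rV_d.+1 => z ord0 ord0) vK; rewrite !mxE => H.
  by rewrite -[RHS]H; apply: eq_bigr => i _; rewrite mxE unlift_none /= mulr1.
have vK0 : v *m K = 0.
  apply/rowP => j; have := congr1 (fun z : 'rV_d.+1 => z ord0 (lift ord0 j)) vK.
  by rewrite !mxE => H; rewrite -[RHS]H; apply: eq_bigr => i _; rewrite mxE liftK.
pose w : 'rV[R]_d := \row_j v ord0 (lift ord0 j).
have w0 : w = 0.
  apply: (can_inj (mulmxK ndK)); rewrite mul0mx -vK0 !mulmx_sum_row.
  rewrite [RHS]big_ord_recl; have -> : v ord0 ord0 = - \sum_j v ord0 (lift ord0 j).
    by apply/eqP; rewrite -addr_eq0; move: v1; rewrite big_ord_recl => ->.
  rewrite scaleNr scaler_suml -sumrN -big_split; apply: eq_bigr => j _ /=.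
  by rewrite mxE rowK scalerBr addrC.
have vl j : v ord0 (lift ord0 j) = 0.
  by have := congr1 (fun z : 'rV_d => z ord0 j) w0; rewrite !mxE.
apply/rowP => i; rewrite mxE; case: (unliftP ord0 i) => [j ->|->]; first exact: vl.
by move: v1; rewrite big_ord_recl big1 ?addr0// => j _; exact: vl.
Qed.

Lemma baryE (x : pt) : \row_i bary i x = homog x *m invmx (homog K).
Proof.
apply/rowP => i; rewrite !mxE big_ord_recl mxE unlift_none /= mul1r; congr (_ + _).
by apply: eq_bigr => j _; rewrite !mxE liftK.
Qed.

Lemma bary_mulmx (x : pt) : (\row_i bary i x) *m K = x.
Proof. by have /mulmx_homogP[] : (\row_i bary i x) *m homog K = homog x
  by rewrite baryE mulmxKV// homog_unit. Qed.

Lemma bary_sum1 (x : pt) : \sum_i bary i x = 1.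
Proof.
have /mulmx_homogP[_] : (\row_i bary i x) *m homog K = homog x.
  by rewrite baryE mulmxKV// homog_unit.
by under eq_bigr do rewrite mxE.
Qed.

Lemma bary_uniq (t : 'rV[R]_d.+1) i : \sum_i t ord0 i = 1 -> bary i (t *m K) = t ord0 i.
Proof.
move=> t1; have /mulmx_homogP H : t *m K = t *m K /\ \sum_i t ord0 i = 1 by [].
have := congr1 (fun z : 'rV_d.+1 => z ord0 i) (baryE (t *m K)).
by rewrite -H mulmxK ?homog_unit// mxE.
Qed.

Lemma bary_vertex i j : bary i (row j K) = (i == j)%:R.
Proof.
rewrite rowE bary_uniq; first by rewrite mxE eqxx.
rewrite (bigD1 j)//= mxE !eqxx big1 ?addr0// => k kj.
by rewrite mxE (negbTE kj) andbF.
Qed.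

Lemma simplex_baryP x : simplex K x <-> forall i, 0 <= bary i x.
Proof.
split=> [/simplexP[t [t0 t1 ->]] i|x0]; first by rewrite bary_uniq.
apply/simplexP; exists (\row_i bary i x); split.
- by move=> i; rewrite mxE.
- by under eq_bigr do rewrite mxE; exact: bary_sum1.
- by rewrite bary_mulmx.
Qed.

Lemma bary_le1 x i : simplex K x -> bary i x <= 1.
Proof.
move=> /simplex_baryP x0; rewrite -(bary_sum1 x) (bigD1 i)//= lerDl.
by apply: sumr_ge0.
Qed.

Lemma facet_mulmx i (t : 'rV[R]_d) :
  t *m facet K i = (\row_j oapp (fun k => t ord0 k) 0 (unlift i j)) *m K.
Proof.
rewrite !mulmx_sum_row [RHS](bigD1_ord i)//= mxE unlift_none scale0r add0r.
apply: eq_bigr => j _; rewrite mxE liftK /=; congr (_ *: _).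
by apply/rowP => k; rewrite !mxE.
Qed.

Lemma facet_baryP i x : simplex (facet K i) x <-> simplex K x /\ bary i x = 0.
Proof.
split.
  move=> /simplexP[t [t0 t1 ->]]; rewrite facet_mulmx; set t' := \row__ _.
  have t'1 : \sum_j t' ord0 j = 1.
    rewrite (bigD1_ord i)//= mxE unlift_none add0r -t1.
    by apply: eq_bigr => j _; rewrite mxE liftK.
  split; last by rewrite bary_uniq// mxE unlift_none.
  apply/simplex_baryP => j; rewrite bary_uniq// mxE.
  by case: unliftP => [k _|_] //=.
move=> [/simplex_baryP x0 xi]; apply/simplexP.
have := bary_sum1 x; rewrite (bigD1_ord i)//= xi add0r => x1.
exists (\row_j bary (lift i j) x); split.
- by move=> j; rewrite mxE.
- by under eq_bigr do rewrite mxE.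
- rewrite facet_mulmx -{1}(bary_mulmx x); congr (_ *m K); apply/rowP => j.
  by rewrite !mxE; case: unliftP => [k ->|->]; rewrite /= ?mxE.
Qed.

Lemma baryB i x y : bary i x - bary i y = dot (x - y) (bgrad i).
Proof. by rewrite /bary dotBl; ring. Qed.

Lemma baryDZ i x v t : bary i (x + t *: v) = bary i x + t * dot v (bgrad i).
Proof. by rewrite /bary dotDl dotZl addrA. Qed.

(** A vector is the combination of the vertices whose coefficients are the
derivatives of the barycentric coordinates along it. *)
Lemma dot_bgrad_mulmx (v : pt) : (\row_i dot v (bgrad i)) *m K = v.
Proof.
have -> : \row_i dot v (bgrad i) = (\row_i bary i v) - (\row_i bary i 0).
  by apply/rowP => i; rewrite !mxE baryB subr0.
by rewrite mulmxBl !bary_mulmx subr0.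
Qed.

Lemma dot_bgrad_sum (v : pt) : \sum_i dot v (bgrad i) = 0.
Proof.
rewrite (eq_bigr (fun i => bary i v - bary i 0)); last by move=> i _; rewrite baryB subr0.
by rewrite sumrB !bary_sum1 subrr.
Qed.

Lemma dot_vertices_bgrad i a b :
  dot (row a K - row b K) (bgrad i) = (i == a)%:R - (i == b)%:R.
Proof. by rewrite -baryB !bary_vertex. Qed.

Lemma row_edges_facet i j :
  row j (edges (facet K i)) = row (lift i (lift ord0 j)) K - row (lift i ord0) K.
Proof. by rewrite rowK; apply/rowP => k; rewrite !mxE. Qed.

Lemma bgrad_neq0 i : bgrad i != 0.
Proof.
apply/eqP => g0; have := dot_vertices_bgrad i i (lift i ord0).
rewrite eqxx (negbTE (neq_lift _ _)) subr0 g0 dotC.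
by rewrite -(scale0r 0) dotZl mul0r => /eqP; rewrite eq_sym oner_eq0.
Qed.

Lemma unit_normal_bgrad i :
  unit_normal (facet K i) ((enorm (bgrad i))^-1 *: bgrad i).
Proof.
have g0 : enorm (bgrad i) != 0.
  have : enorm (bgrad i) ^+ 2 != 0 by rewrite sqr_enorm dotxx_eq0 bgrad_neq0.
  by rewrite expf_eq0.
split.
  apply/eqP; rewrite -(@eqrXn2 _ 2) ?enorm_ge0// sqr_enorm dotZl dotC dotZl -sqr_enorm.
  by rewrite mulrA -expr2 exprVn mulVf ?expr1n// expf_neq0.
move=> j; rewrite row_edges_facet dotC dotZl dotC dot_vertices_bgrad.
by rewrite !(negbTE (neq_lift _ _)) subrr mulr0.
Qed.

(** A linear form that vanishes on the edges of the facet is determined by its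
value on one further edge of the simplex. *)
Lemma unit_normalE i nu : unit_normal (facet K i) nu ->
  exists a, forall v, dot v nu = a * dot v (bgrad i).
Proof.
move=> [_ H]; exists (dot (row i K - row (lift i ord0) K) nu) => v.
rewrite -{1}(dot_bgrad_mulmx v) dot_mulmx.
have -> : \sum_j (\row_i0 dot v (bgrad i0)) ord0 j * dot (row j K) nu =
    \sum_j dot v (bgrad j) * dot (row j K - row (lift i ord0) K) nu.
  under eq_bigr do rewrite mxE.
  under [RHS]eq_bigr do rewrite dotBl mulrBr.
  by rewrite sumrB -mulr_suml dot_bgrad_sum mul0r subr0.
rewrite (bigD1_ord i)//= big1 ?addr0 1?mulrC// => j _.
case: (unliftP ord0 j) => [k ->|->]; last by rewrite subrr dotC -(scale0r 0) dotC dotZl !mul0r mulr0.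
by rewrite -row_edges_facet H mulr0.
Qed.

(** Completing the edges of the facet with its unit normal gives an invertible
matrix whose Gram matrix is that of the facet, up to a unit block. *)
Lemma facet_gram_gt0 i :
  0 < \det (edges (facet K i) *m (edges (facet K i))^T).
Proof.
set E := edges _; pose nu := (enorm (bgrad i))^-1 *: bgrad i.
have [nu1 nuE] := unit_normal_bgrad i; rewrite -/nu -/E in nu1 nuE.
pose M : 'M[R]_(1 + n, n.+1) := col_mx nu E.
have dotE (x y : pt) : x *m y^T = (dot x y)%:M.
  apply/matrixP => a b; rewrite !ord1 !mxE eqxx /dot.
  by apply: eq_bigr => j _; rewrite mxE.
have Enu : E *m nu^T = 0.
  apply/row_matrixP => j; rewrite row_mul dotE nuE row0.
  by apply/matrixP => a b; rewrite !mxE mul0rn.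
have nunu : nu *m nu^T = 1%:M by rewrite dotE -sqr_enorm nu1 expr1n.
have nuET : nu *m E^T = 0 by rewrite -[LHS]trmxK trmx_mul trmxK Enu trmx0.
have MM : M *m M^T = block_mx 1%:M 0 0 (E *m E^T).
  by rewrite tr_col_mx mul_col_row nunu nuET Enu.
have detM : \det (M : 'M[R]_(n.+1)) != 0.
  rewrite -unitfE -unitmxE -row_free_unit; apply: inj_row_free => v.
  pose vl := lsubmx (v : 'M[R]_(1, 1 + n)); pose vr := rsubmx (v : 'M[R]_(1, 1 + n)).
  have vM : v *m M = vl *m nu + vr *m E.
    by rewrite -(@mul_row_col R 1 1 n n.+1 vl vr nu E) hsubmxK.
  have vE : v = row_mx vl vr by rewrite hsubmxK.
  rewrite vM vE => H.
  have l0 : vl = 0.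
    have := congr1 (fun z => z *m nu^T) H.
    by rewrite mulmxDl -!mulmxA nunu Enu mulmx1 mulmx0 addr0 mul0mx.
  move: H; rewrite l0 mul0mx add0r => H.
  suff -> : vr = 0 by rewrite row_mx0.
  apply/rowP => j; rewrite [RHS]mxE.
  have := congr1 (fun z => dot z (bgrad (lift i (lift ord0 j)))) H.
  rewrite dot_mulmx (bigD1 j)//= big1 ?addr0; last first.
    move=> k kj; rewrite row_edges_facet dot_vertices_bgrad.
    rewrite !(inj_eq (@lift_inj _ _)) eq_sym (negbTE kj).
    by rewrite [_ == ord0]eq_sym (negbTE (neq_lift _ _)) subrr mulr0.
  rewrite row_edges_facet dot_vertices_bgrad eqxx (inj_eq (@lift_inj _ _)).
  rewrite [_ == ord0]eq_sym (negbTE (neq_lift _ _)) subr0 mulr1 => ->.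
  by rewrite -(scale0r 0) dotZl mul0r.
have : \det (M *m M^T : 'M[R]_(n.+1)) = \det (E *m E^T).
  by rewrite MM (@det_ublock _ 1 n) det1 mul1r.
rewrite det_mulmx det_tr => <-.
by rewrite -expr2 lt_neqAle sqr_ge0 andbT eq_sym expf_neq0.
Qed.

End barycentric.

(** * Integration on simplices *)

Lemma rV_continuous (R : realType) (T : topologicalType) (m : nat) (g : T -> 'rV[R]_m) :
  (forall i, continuous (fun x => g x ord0 i)) -> continuous g.
Proof.
move=> cg x; apply/cvg_ballP => e e0.
have : \forall y \near x, forall i, ball (g x ord0 i) e (g y ord0 i).
  apply: (@filter_forall _ _ (fun i y => ball (g x ord0 i) e (g y ord0 i)) (nbhs x)) => i.
  by have /cvg_ballP := cg i x; apply.
by apply: filterS => y H; split => // i j; rewrite (ord1 i); exact: H.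
Qed.

Section polynomials_integral.
Context {R : realType}.

Lemma polyfun_integrable d (D : set 'rV[R]_d.+1) l f (r : R) : measurable D ->
  D `<=` cube r -> polyfun l f -> (lebesgue_rV d.+1).-integrable D (EFin \o f).
Proof.
move=> mD Dr pf; have [L [L0 HL]] := continuous_cube_bounded r (polyfun_continuous pf).
apply: (bounded_integrable (L := L)) => //.
- apply: le_lt_trans (lebesgue_cube_fin r); apply: le_measure; rewrite ?inE//.
  exact: measurable_cube.
- apply: measurable_funTS; exact: continuous_rV_measurable (polyfun_continuous pf).
- by move=> x /Dr; exact: HL.
Qed.

Lemma measurable_polyfun_le d l (f : 'rV[R]_d -> R) (c : R) : polyfun l f ->
  measurable [set x : 'rV[R]_d | c <= f x].
Proof.
case: d f => [|d] f pf.
  have [H|H] := pselect (c <= f 0).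
    rewrite (_ : [set x | _] = setT)//; apply/seteqP; split => // x _ /=.
    by rewrite (_ : x = 0)//; apply/rowP => -[].
  rewrite (_ : [set x | _] = set0)//; apply/seteqP; split => // x /=.
  by rewrite (_ : x = 0)//; apply/rowP => -[].
have mf := continuous_rV_measurable (polyfun_continuous pf).
rewrite (_ : [set x | _] = f @^-1` `[c, +oo[%classic).
  by rewrite -[X in measurable X]setTI; exact: mf.
by apply/seteqP; split => x /=; rewrite in_itv/= andbT.
Qed.

Lemma lebesgue_cbox_gt0 d (a b : 'rV[R]_d) : (forall i, a ord0 i < b ord0 i) ->
  (0 < lebesgue_rV d (cbox a b))%E.
Proof.
move=> ab; rewrite cboxE (lebesgue_rV_box (A := fun i => `[a ord0 i, b ord0 i]%classic)).
  elim/big_ind : _ => [|x y|i _]; [exact: lte01|exact: mule_gt0|].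
  by rewrite lebesgue_measure_itv/= lte_fin ab -EFinB lte_fin subr_gt0.
by move=> i; exact: measurable_itv.
Qed.

Lemma unit_simplex_cube d : @unit_simplex R d `<=` cube 1.
Proof.
move=> y [y0 y1] i; rewrite ger0_norm//; apply: le_trans y1.
by rewrite (bigD1 i)//= lerDl; apply: sumr_ge0.
Qed.

Lemma measurable_unit_simplex d : measurable (@unit_simplex R d).
Proof.
have -> : @unit_simplex R d =
    (\bigcap_(i in [set: 'I_d]) [set y : 'rV[R]_d | 0 <= y ord0 i]) `&`
    [set y : 'rV[R]_d | -1 <= - \sum_i y ord0 i].
  apply/seteqP; split => y.
    by move=> [y0 y1]; split; [move=> i _; exact: y0|rewrite /= lerN2].
  by move=> [y0 y1]; split; [move=> i; exact: (y0 i I)|rewrite -lerN2].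
apply: measurableI.
  apply: fin_bigcap_measurable => // i _.
  exact: (measurable_polyfun_le _ (polyfun_coord 0 i)).
apply: (@measurable_polyfun_le _ 1); apply: polyfunN.
by apply: polyfun_sum => i _; exact: polyfun_coord.
Qed.

(** Every point of the simplex is a limit of interior points. *)
Lemma unit_simplex_integral0 d (f : 'rV[R]_d.+1 -> R) : continuous f ->
  (forall y, 0 <= f y) -> \int[lebesgue_rV d.+1]_(y in @unit_simplex R d.+1) f y = 0 ->
  forall y, unit_simplex y -> f y = 0.
Proof.
move=> cf f0 If y [y0 y1].
have mU : measurable (@unit_simplex R d.+1) by exact: measurable_unit_simplex.
have mf : measurable_fun setT f by exact: continuous_rV_measurable.
have [L [_ HL]] := continuous_cube_bounded 1 cf.
have intf : (lebesgue_rV d.+1).-integrable (@unit_simplex R d.+1) (EFin \o f).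
  apply: (bounded_integrable (L := L)) => //.
  - apply: le_lt_trans (lebesgue_cube_fin 1); apply: le_measure; rewrite ?inE//.
      exact: measurable_cube.
    exact: unit_simplex_cube.
  - exact: measurable_funTS.
  - by move=> x /unit_simplex_cube; exact: HL.
have : ae_eq (lebesgue_rV d.+1) (@unit_simplex R d.+1) (EFin \o f) (cst 0%E).
  apply/ae_eq_integral_abs => //; first exact/measurable_EFinP/measurable_funTS.
  under eq_integral do rewrite /= ger0_norm//.
  by move: If => /eqP; rewrite /Rintegral fine_eq0 ?integrable_fin_num// => /eqP.
move=> [N [mN N0 subN]].
apply/eqP; rewrite eq_le f0 andbT leNgt; apply/negP => fy.
have [e /= e0 He] : exists2 e : R, 0 < e & forall z : 'rV[R]_d.+1,
    (forall i, `|y ord0 i - z ord0 i| < e) -> 0 < f z.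
  have : nbhs y (f @^-1` [set t | 0 < t]) by apply: cf; exact: lt_nbhsr.
  move=> /nbhs_ballP[e /= e0 He]; exists e => // z Hz; apply: He.
  by split=> // i j; rewrite (ord1 i); exact: Hz.
pose D : R := d.+1%:R; have D1 : 1 <= D by rewrite ler1n.
(* z, at a small step t from y towards the point with all coordinates c, is the
   centre of a box contained in the simplex *)
pose t := Num.min (1 / 2) (e / 4).
have t0 : 0 < t by rewrite lt_min !divr_gt0.
have t1 : t <= 1 / 2 by rewrite ge_min lexx.
have te : t <= e / 4 by rewrite ge_min lexx orbT.
pose c : R := (2 * D)^-1.
have c0 : 0 < c by rewrite invr_gt0 mulr_gt0// (lt_le_trans ltr01).
have cD : c * D = 1 / 2 by rewrite /c; field; lra.
have c12 : c <= 1 / 2 by rewrite -cD ler_peMr// ltW.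
have yi1 i : y ord0 i <= 1.
  by have := unit_simplex_cube (conj y0 y1) i; rewrite ger0_norm.
pose z : 'rV[R]_d.+1 := \row_i ((1 - t) * y ord0 i + t * c).
pose a : 'rV[R]_d.+1 := \row_i (z ord0 i - t * c / 2).
pose b : 'rV[R]_d.+1 := \row_i (z ord0 i + t * c / 2).
have tc0 : 0 < t * c by exact: mulr_gt0.
have tce : t * c <= t / 2 by rewrite ler_wpM2l ?(ltW t0)//; lra.
have abU : cbox a b `<=` @unit_simplex R d.+1.
  move=> x Hx; split=> [i|].
    have := Hx i; rewrite !mxE => /andP[h _]; apply: le_trans h.
    have : 0 <= (1 - t) * y ord0 i by rewrite mulr_ge0//; lra.
    by move=> ?; lra.
  apply: (@le_trans _ _ (\sum_i ((1 - t) * y ord0 i + t * c * (3 / 2)))).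
    by apply: ler_sum => i _; have := Hx i; rewrite !mxE => /andP[_ h]; lra.
  rewrite big_split/= -mulr_sumr sumr_const card_ord -[_ *+ d.+1]mulr_natl -/D.
  have -> : D * (t * c * (3 / 2)) = t * (3 / 4).
    by rewrite (_ : D * _ = t * (c * D) * (3 / 2)); [rewrite cD; field|ring].
  have : (1 - t) * (\sum_i y ord0 i) <= (1 - t) * 1 by rewrite ler_wpM2l//; lra.
  by move=> ?; lra.
have abf x : cbox a b x -> 0 < f x.
  move=> Hx; apply: He => i; have := Hx i; rewrite !mxE => /andP[h1 h2].
  have ty : t * y ord0 i <= t by rewrite ler_piMr// ltW.
  have ty0 : 0 <= t * y ord0 i by rewrite mulr_ge0// ltW.
  by rewrite ltr_norml; apply/andP; split; lra.
have abN : cbox a b `<=` N.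
  move=> x Hx; apply: subN => /= /(_ (abU _ Hx)) [] fx0.
  by have := abf x Hx; rewrite fx0 ltxx.
have : (0 < lebesgue_rV d.+1 (cbox a b))%E.
  by apply: lebesgue_cbox_gt0 => i; rewrite !mxE; lra.
apply/negP; rewrite -leNgt -N0; apply: le_measure; rewrite ?inE//.
exact: measurable_cbox.
Qed.

End polynomials_integral.

Section simplex_measure.
Context {R : realType} {n : nat}.
Local Notation d := n.+1.
Local Notation pt := 'rV[R]_d.
Local Notation leb := (@lebesgue_rV R d).
Variable K : 'M[R]_(d.+1, d).
Implicit Types f : pt -> R.

Definition osimplex : set pt := [set x | forall i, 0 < bary K i x].

Definition aff (y : pt) : pt := row ord0 K + y *m edges K.

Lemma aff_continuous : continuous aff.
Proof.
apply: rV_continuous => i.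
exact: polyfun_continuous (polyfun_affine (row ord0 K) (edges K) (polyfun_coord 0 i)).
Qed.

Lemma polyfun_bary i : polyfun 1 (bary K i).
Proof.
apply: polyfunD; first exact: polyfun_cst.
apply: polyfun_sum => j _; rewrite (_ : (fun=> _) = fun x : pt => bgrad K i ord0 j * x ord0 j).
  by apply: polyfunZ; exact: polyfun_coord.
by apply/funext => x; rewrite mulrC.
Qed.

Lemma bary_continuous i : continuous (bary K i).
Proof. exact: polyfun_continuous (polyfun_bary i). Qed.

Lemma open_osimplex : open osimplex.
Proof.
rewrite openE => x x0.
apply: (@filter_forall _ _ (fun i x => 0 < bary K i x) (nbhs x)) => i.
have : nbhs x (bary K i @^-1` [set t | 0 < t]).
  by apply: bary_continuous; exact: lt_nbhsr (x0 i).
exact.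
Qed.

Lemma measurable_osimplex : measurable osimplex.
Proof. exact: open_rV_measurable open_osimplex. Qed.

Lemma simplex_cube : exists r : R, simplex K `<=` cube r.
Proof.
exists (\sum_j \sum_i `|K i j|) => x /simplexP[t [t0 t1 ->]] j.
rewrite mxE; apply: le_trans (ler_norm_sum _ _ _) _.
rewrite [leRHS](bigD1 j)//=; apply: ler_wpDr.
  by apply: sumr_ge0 => k _; apply: sumr_ge0.
apply: ler_sum => i _; rewrite normrM ler_piMl// ger0_norm//.
by rewrite -t1 (bigD1 i)//= lerDl; apply: sumr_ge0.
Qed.

Hypothesis ndK : nondegenerate K.

Lemma osimplex_sub : osimplex `<=` simplex K.
Proof. by move=> x x0; apply/simplex_baryP => // i; rewrite ltW. Qed.

Lemma simplexE : simplex K = \bigcap_(i in [set: 'I_d.+1]) (bary K i @^-1` [set t | 0 <= t]).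
Proof.
apply/seteqP; split => x.
  by move=> /simplex_baryP H i _; exact: H.
by move=> H; apply/simplex_baryP => // i; exact: (H i I).
Qed.

Lemma closed_simplex : closed (simplex K).
Proof.
rewrite simplexE; apply: closed_bigI => i _; apply: preimage_closed.
  by move=> x _; exact: bary_continuous.
exact: closed_ge.
Qed.

Lemma measurable_simplex : measurable (simplex K).
Proof.
rewrite simplexE; apply: fin_bigcap_measurable => // i _.
exact: (measurable_polyfun_le 0 (polyfun_bary i)).
Qed.

Lemma simplex_fin : (leb (simplex K) < +oo)%E.
Proof.
have [r Kr] := simplex_cube; apply: le_lt_trans (lebesgue_cube_fin r).
apply: le_measure; rewrite ?inE//; [exact: measurable_simplex|exact: measurable_cube].
Qed.

Lemma simplex_bounded f : continuous f ->
  exists L : R, 0 <= L /\ forall x, simplex K x -> `|f x| <= L.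
Proof.
move=> cf; have [r Kr] := simplex_cube; have [L [L0 HL]] := continuous_cube_bounded r cf.
by exists L; split => // x /Kr; exact: HL.
Qed.

Lemma integrable_simplex f : continuous f -> leb.-integrable (simplex K) (EFin \o f).
Proof.
move=> cf; have [L [_ HL]] := simplex_bounded cf.
apply: (bounded_integrable measurable_simplex simplex_fin _ HL).
by apply: measurable_funTS; exact: continuous_rV_measurable.
Qed.

Lemma polyfun_integrable_simplex l f : polyfun l f ->
  leb.-integrable (simplex K) (EFin \o f).
Proof. by move=> /polyfun_continuous; exact: integrable_simplex. Qed.

Lemma L2_simplex f : continuous f -> L2 (simplex K) f.
Proof.
move=> cf; have [L [_ HL]] := simplex_bounded cf.
apply: (L2_bounded measurable_simplex simplex_fin _ HL).
by apply: measurable_funTS; exact: continuous_rV_measurable.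
Qed.

Lemma bary0_negligible i : leb.-negligible [set x | bary K i x = 0].
Proof.
exists [set x | invmx (homog K) ord0 i + dot x (bgrad K i) = 0]; split => //.
  rewrite (_ : [set x | _] = [set x | 0 <= bary K i x] `&` [set x | 0 <= - bary K i x]).
    apply: measurableI; apply: measurable_polyfun_le; first exact: polyfun_bary.
    by apply: polyfunN; exact: polyfun_bary.
  apply/seteqP; split => x /=; first by rewrite -/(bary K i x) => ->; rewrite oppr0.
  by move=> [h1 h2]; apply/eqP; rewrite eq_le -/(bary K i x) h1 andbT -oppr_ge0.
by rewrite lebesgue_hyperplane// bgrad_neq0.
Qed.

Lemma ae_bary_neq0 : {ae leb, forall x, forall i, bary K i x != 0}.
Proof.
apply: (@filter_forall _ _ (fun i x => bary K i x != 0) (almost_everywhere leb)) => i.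
by apply: negligibleS (bary0_negligible i) => x /= /negP/negPn/eqP.
Qed.

Lemma ae_osimplex : {ae leb, forall x, simplex K x -> osimplex x}.
Proof.
apply: filterS ae_bary_neq0 => x x0 /simplex_baryP xK i.
by rewrite lt_neqAle eq_sym x0 xK.
Qed.

Lemma Rintegral_osimplex (f : pt -> R) :
  \int[leb]_(x in simplex K) f x = \int[leb]_(x in osimplex) f x.
Proof.
apply: ae_eq_Rintegral; apply: filterS ae_osimplex => x H; rewrite !patchE.
have [xK|xK] := boolP (x \in simplex K).
  by rewrite mem_set//; apply: H; rewrite inE in xK.
by rewrite memNset// => /osimplex_sub; rewrite notin_setE in xK.
Qed.

Lemma bary_aff i y : bary K i (aff y) = oapp (fun j => y ord0 j) (1 - \sum_j y ord0 j) (unlift ord0 i).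
Proof.
pose t : 'rV[R]_d.+1 := \row_i oapp (fun j => y ord0 j) (1 - \sum_j y ord0 j) (unlift ord0 i).
have tl j : t ord0 (lift ord0 j) = y ord0 j by rewrite mxE liftK.
have t1 : \sum_i t ord0 i = 1.
  by rewrite big_ord_recl; under eq_bigr do rewrite tl; rewrite mxE unlift_none /= subrK.
have -> : aff y = t *m K.
  rewrite mulmx_row0_edges//; congr (_ + _ *m _).
  by apply/rowP => j; rewrite [RHS]mxE tl.
by rewrite bary_uniq// mxE.
Qed.

Lemma simplex_aff y : simplex K (aff y) <-> unit_simplex y.
Proof.
split; last by move=> uy; apply/simplex_paramP; exists y.
move=> /simplex_baryP H; split=> [j|].
  by have := H ndK (lift ord0 j); rewrite bary_aff liftK.
by have := H ndK ord0; rewrite bary_aff unlift_none /= subr_ge0.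
Qed.

Definition affinv (x : pt) : pt := (x - row ord0 K) *m invmx (edges K).

Lemma affK : cancel aff affinv.
Proof. by move=> y; rewrite /aff /affinv addrC addKr mulmxK. Qed.

Lemma affinvK : cancel affinv aff.
Proof. by move=> y; rewrite /aff /affinv mulmxKV// addrC subrK. Qed.

Lemma affinv_unit x : simplex K x -> unit_simplex (affinv x).
Proof. by move=> xK; apply/simplex_aff; rewrite affinvK. Qed.

Lemma Rintegral_simplex : exists2 c : R, 0 < c &
  forall f, continuous f -> (forall x, 0 <= f x) ->
    \int[leb]_(x in simplex K) f x = c * \int[leb]_(y in @unit_simplex R d) f (aff y).
Proof.
have [c c0 Hc] := ge0_integral_linear ndK; exists c => // f cf f0.
have mf : measurable_fun setT f by exact: continuous_rV_measurable.
have mfK : measurable_fun setT ((EFin \o f) \_ (simplex K)).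
  apply/(measurable_restrictT _ measurable_simplex).
  exact/measurable_EFinP/measurable_funTS.
have fK0 x : (0 <= ((EFin \o f) \_ (simplex K)) x)%E.
  by rewrite patchE; case: ifP => //= _; rewrite lee_fin.
rewrite /Rintegral integral_mkcond (Hc (row ord0 K) _ mfK fK0).
rewrite [in RHS]integral_mkcond.
have -> : (\int[leb]_x ((EFin \o f) \_ (simplex K)) (row ord0 K + x *m edges K)%R =
   \int[leb]_x ((fun y => (f (aff y))%:E) \_ (@unit_simplex R d)) x)%E.
  apply: eq_integral => y _; rewrite !patchE -/(aff y).
  have [yU|yU] := boolP (y \in @unit_simplex R d).
    by rewrite mem_set//; apply/simplex_aff; rewrite inE in yU.
  by rewrite memNset// => /simplex_aff; rewrite notin_setE in yU.
rewrite -integral_mkcond fineM//.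
have cfa : continuous (fun y => f (aff y)).
  by move=> y; apply: (@continuous_comp _ _ _ aff f); [exact: aff_continuous|exact: cf].
have [L [_ HL]] := continuous_cube_bounded 1 cfa.
apply: integrable_fin_num => //; first exact: measurable_unit_simplex.
apply: (bounded_integrable (L := L)).
- exact: measurable_unit_simplex.
- apply: le_lt_trans (lebesgue_cube_fin 1); apply: le_measure; rewrite ?inE//.
  + exact: measurable_unit_simplex.
  + exact: measurable_cube.
  + exact: unit_simplex_cube.
- by apply: measurable_funTS; exact: continuous_rV_measurable.
- by move=> x /unit_simplex_cube; exact: HL.
Qed.

Lemma simplex_integral0 f : continuous f -> (forall x, 0 <= f x) ->
  \int[leb]_(x in simplex K) f x = 0 -> forall x, simplex K x -> f x = 0.
Proof.
move=> cf f0; have [c c0 Hc] := Rintegral_simplex; rewrite Hc// => /eqP.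
rewrite mulf_eq0 gt_eqF//= => /eqP If x xK.
have cfa : continuous (fun y => f (aff y)).
  by move=> y; apply: (@continuous_comp _ _ _ aff f); [exact: aff_continuous|exact: cf].
have := unit_simplex_integral0 cfa (fun y => f0 _) If (affinv_unit xK).
by rewrite affinvK.
Qed.

Lemma osimplex_ball : exists x0 : pt, exists2 e : R, 0 < e &
  forall x : pt, (forall i, `|x ord0 i - x0 ord0 i| < e) -> osimplex x.
Proof.
pose t : 'rV[R]_d.+1 := const_mx (d.+1%:R^-1).
have t1 : \sum_i t ord0 i = 1.
  under eq_bigr do rewrite mxE.
  by rewrite sumr_const card_ord -[LHS]mulr_natl mulfV.
have : nbhs (t *m K) osimplex.
  apply: open_nbhs_nbhs; split; first exact: open_osimplex.
  by move=> i; rewrite bary_uniq// mxE invr_gt0.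
move=> /nbhs_ballP[e /= e0 He]; exists (t *m K), e => // x Hx; apply: He.
by split=> // i j; rewrite (ord1 i) /ball/= distrC; exact: Hx.
Qed.

Lemma polyfun_eq0_simplex l f : polyfun l f -> (forall x, simplex K x -> f x = 0) ->
  forall x, f x = 0.
Proof.
move=> pf f0; have [x0 [e e0 He]] := osimplex_ball.
by apply: (polyfun_eq0_ball (x0 := x0) pf e0) => x /He /osimplex_sub; exact: f0.
Qed.

Lemma polyfun_ae_eq0 l f : polyfun l f ->
  {ae leb, forall x, simplex K x -> f x = 0} -> forall x, f x = 0.
Proof.
move=> pf f0; apply: (polyfun_eq0_simplex pf) => x xK.
apply/eqP; rewrite -sqrf_eq0 expr2; apply/eqP.
apply: (@simplex_integral0 (fun x => f x * f x)) => //.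
- exact: polyfun_continuous (polyfunM pf pf).
- by move=> y; rewrite -expr2 sqr_ge0.
- transitivity (\int[leb]_(x in simplex K) (0 : R)).
    apply: ae_eq_Rintegral; apply: filterS f0 => y; rewrite !patchE.
    by case: ifPn => // /set_mem yK ->//; rewrite mulr0.
  by rewrite /Rintegral integral0.
Qed.

(** A polynomial that vanishes almost everywhere on a simplex is zero: there is no
choice for the polynomial that represents f. *)
Lemma restrE l p f : polyfun l p -> {ae leb, forall x, simplex K x -> f x = p x} ->
  restr K f = p.
Proof.
move=> pp fp; rewrite /restr; case: xgetP => [q _ [[l' pq] fq]|H]; last first.
  by case: (H p); split => //; exists l.
apply/funext => x; apply/eqP; rewrite -subr_eq0; apply/eqP; move: x.
have pqp : polyfun (maxn l' l) (fun x => q x - p x).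
  by apply: polyfunB; [apply: polyfun_leq pq|apply: polyfun_leq pp];
    rewrite ?leq_maxl ?leq_maxr.
apply: (polyfun_ae_eq0 pqp).
by apply: filterS2 fp fq => x Hp Hq xK; rewrite -Hp// -Hq// subrr.
Qed.

Lemma poly_on_restr l f : poly_on l K f ->
  polyfun l (restr K f) /\ {ae leb, forall x, simplex K x -> f x = restr K f x}.
Proof. by move=> [p pp fp]; rewrite (restrE pp fp). Qed.

End simplex_measure.

(** * Comparison of quadratic forms in finite dimension *)

Section quadratic_forms.
Context {R : realType}.

Definition bform N (A : 'M[R]_N) (c e : 'rV[R]_N) : R := (c *m A *m e^T) ord0 ord0.

Lemma bformE N (A : 'M[R]_N) c e :
  bform A c e = \sum_i \sum_j c ord0 i * A i j * e ord0 j.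
Proof.
rewrite /bform mxE exchange_big; apply: eq_bigr => j _.
by rewrite !mxE mulr_suml.
Qed.

Lemma bformDl N (A : 'M[R]_N) c c' e : bform A (c + c') e = bform A c e + bform A c' e.
Proof. by rewrite /bform !mulmxDl mxE. Qed.

Lemma bformZl N (A : 'M[R]_N) t c e : bform A (t *: c) e = t * bform A c e.
Proof. by rewrite /bform -!scalemxAl mxE. Qed.

Lemma bformC N (A : 'M[R]_N) c e : A^T = A -> bform A c e = bform A e c.
Proof.
move=> AT; rewrite /bform -[in LHS](trmxK (c *m A *m e^T)) mxE.
by rewrite !trmx_mul trmxK AT mulmxA.
Qed.

Lemma discriminant_le (a b c : R) : 0 <= a -> 0 <= c ->
  (forall t, 0 <= a - 2 * t * b + t ^+ 2 * c) -> b ^+ 2 <= a * c.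
Proof.
move=> a0 c0 H; have [c00|cn0] := eqVneq c 0.
  suff -> : b = 0 by rewrite expr0n mulr_ge0.
  apply/eqP/negPn/negP => b0; have := H ((a + 1) / (2 * b)).
  rewrite c00 mulr0 addr0 (_ : 2 * _ * b = a + 1); last by field.
  lra.
have cp : 0 < c by rewrite lt_neqAle eq_sym cn0.
have := H (b / c); rewrite (_ : _ + _ = a - b ^+ 2 / c); last by field.
by rewrite subr_ge0 ler_pdivrMr.
Qed.

Lemma bform_CauchySchwarz N (A : 'M[R]_N) c e : A^T = A ->
  (forall c, 0 <= bform A c c) -> bform A c e ^+ 2 <= bform A c c * bform A e e.
Proof.
move=> AT A0; apply: discriminant_le => // t.
have -> : bform A c c - 2 * t * bform A c e + t ^+ 2 * bform A e e =
    bform A (c + (- t) *: e) (c + (- t) *: e).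
  rewrite !(bformDl, bformZl) !(bformC _ (c + _) AT) !(bformDl, bformZl).
  by rewrite (bformC e c AT); ring.
exact: A0.
Qed.

(** Subtracting from [c] the vector [c A2 A2^+], with [A2^+] the pseudo-inverse,
leaves an element of the kernel of [A2]; the coordinates of [c A2 A2^+] are values
of the bilinear form of [A2], hence controlled by its quadratic form. *)
Lemma bform_le N (A1 A2 : 'M[R]_N) : A1^T = A1 -> A2^T = A2 ->
  (forall c, 0 <= bform A1 c c) -> (forall c, 0 <= bform A2 c c) ->
  (forall c, bform A2 c c = 0 -> bform A1 c c = 0) ->
  exists2 C : R, 0 <= C & forall c, bform A1 c c <= C * bform A2 c c.
Proof.
move=> A1T A2T A10 A20 A21.
pose P := pinvmx A2; pose M i : R := bform A2 (row i P^T) (row i P^T).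
have M0 i : 0 <= M i by exact: A20.
pose C := 2 * \sum_i \sum_j `|A1 i j| * (M i + M j).
exists C.
  rewrite mulr_ge0// sumr_ge0// => i _; rewrite sumr_ge0// => j _.
  by rewrite mulr_ge0// addr_ge0.
move=> c; pose c' := c *m A2 *m P.
have c'E i : c' ord0 i = bform A2 c (row i P^T).
  by rewrite /bform /c' [in RHS]mxE [in LHS]mxE; apply: eq_bigr => j _; rewrite !mxE.
have c'2 i : c' ord0 i ^+ 2 <= bform A2 c c * M i.
  by rewrite c'E; exact: bform_CauchySchwarz.
have ker : (c - c') *m A2 = 0.
  by rewrite mulmxBl /c' /P mulmxKpV ?submxMl// subrr.
have [e Q1e cc] : exists2 e, bform A1 e e = 0 & c = c' + e.
  exists (c - c'); last by rewrite addrC subrK.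
  by apply: A21; rewrite /bform ker mul0mx mxE.
have par : bform A1 c c <= 2 * bform A1 c' c'.
  have := A10 (c' + (-1) *: e); rewrite cc.
  rewrite !(bformDl, bformZl) !(bformC _ (c' + _) A1T) !(bformDl, bformZl).
  by rewrite Q1e (bformC e c' A1T); lra.
apply: (le_trans par); rewrite /C -mulrA ler_wpM2l// bformE mulr_suml.
apply: ler_sum => i _; rewrite mulr_suml; apply: ler_sum => j _.
apply: (le_trans (ler_norm _)); rewrite mulrAC normrM -mulrA mulrC ler_wpM2l//.
have h1 := c'2 i; have h2 := c'2 j.
have Q20 := A20 c.
have h3 : `|c' ord0 i * c' ord0 j| <= c' ord0 i ^+ 2 + c' ord0 j ^+ 2.
  by rewrite ler_norml; apply/andP; split; nra.
by rewrite mulrDl; apply: (le_trans h3); lra.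
Qed.

(** The rows of the matrix span the subspace when their rank is maximal. *)
Lemma subspace_matrix N (S : set 'rV[R]_N) : S 0 ->
  (forall a c e, S c -> S e -> S (a *: c + e)) ->
  exists M : 'M[R]_N, forall c, S c <-> (c <= M)%MS.
Proof.
move=> S0 SD.
have Ssum (k : nat) (M : 'M[R]_(k, N)) (v : 'rV[R]_k) : (forall i, S (row i M)) -> S (v *m M).
  move=> HM; rewrite mulmx_sum_row; elim/big_ind : _ => // [x y Sx Sy|i _].
    by rewrite -[x]scale1r; exact: SD.
  by rewrite -[_ *: _]addr0; exact: SD.
pose good (r : nat) := `[< exists M : 'M[R]_N, (forall i, S (row i M)) /\ \rank M = r >].
have ex0 : exists r, good r.
  exists 0%N; apply/asboolP; exists 0; split; last by rewrite mxrank0.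
  by move=> i; rewrite row0.
have ub r : good r -> (r <= N)%N by move=> /asboolP[M [_ <-]]; exact: rank_leq_row.
have [r /asboolP[M [SM rM]] rmax] := ex_maxnP ex0 ub.
exists M => c; split=> [Sc|/submxP[v ->]]; last exact: Ssum.
apply/negPn/negP => cM.
have : (\rank (M + c)%MS <= r)%N.
  apply: rmax; apply/asboolP; exists (M + c)%MS; split => // i.
  have /sub_addsmxP[[u v] -> /=] : (row i (M + c)%MS <= M + c)%MS by exact: row_sub.
  rewrite -[u *m M]scale1r; apply: SD; first exact: Ssum.
  by apply: Ssum => j; rewrite (_ : row j c = c)//; apply/rowP => k; rewrite mxE (ord1 j).
rewrite -rM (geq_leqif (mxrank_leqif_sup (addsmxSl M c))) => H.
by move/negP: cM; apply; exact: submx_trans (addsmxSr M c) H.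
Qed.

End quadratic_forms.

Section Rintegral_linearity.
Context d (T : measurableType d) (R : realType) (mu : {measure set T -> \bar R}).
Variables (D : set T) (mD : measurable D).

Lemma integrable_sumR (I : Type) (s : seq I) (F : I -> T -> R) :
  (forall i, mu.-integrable D (EFin \o F i)) ->
  mu.-integrable D (EFin \o (fun x => \sum_(i <- s) F i x)).
Proof.
move=> iF; elim: s => [|i s ih].
  rewrite (_ : EFin \o _ = cst 0%E); first exact: integrable0.
  by apply/funext => x; rewrite /= big_nil.
have := integrableD mD (iF i) ih; congr (_.-integrable).
by apply/funext => x; rewrite /= big_cons EFinD.
Qed.

Lemma Rintegral_sum (I : Type) (s : seq I) (F : I -> T -> R) :
  (forall i, mu.-integrable D (EFin \o F i)) ->
  \int[mu]_(x in D) (\sum_(i <- s) F i x) = \sum_(i <- s) \int[mu]_(x in D) F i x.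
Proof.
move=> iF; elim: s => [|i s ih].
  by rewrite big_nil; under eq_Rintegral do rewrite big_nil; rewrite /Rintegral integral0.
rewrite big_cons; under eq_Rintegral do rewrite big_cons.
by rewrite RintegralD// ?ih//; exact: integrable_sumR.
Qed.

End Rintegral_linearity.

Section unit_simplex_polynomials.
Context {R : realType} {n : nat}.
Local Notation d := n.+1.
Local Notation pt := 'rV[R]_d.
Local Notation leb := (@lebesgue_rV R d).
Local Notation U := (@unit_simplex R d).

Lemma polyfun_integrable_unit l (f : pt -> R) : polyfun l f ->
  leb.-integrable U (EFin \o f).
Proof.
apply: (polyfun_integrable (r := 1)); first exact: measurable_unit_simplex.
exact: unit_simplex_cube.
Qed.

Let gram p N (F : 'I_p -> 'I_N -> pt -> R) : 'M[R]_N :=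
  \matrix_(j, k) \sum_a \int[leb]_(y in U) (F a j y * F a k y).

Let gramE p N l (F : 'I_p -> 'I_N -> pt -> R) (c : 'rV[R]_N) :
  (forall a j, polyfun l (F a j)) -> bform (gram F) c c =
  \sum_a \int[leb]_(y in U) (\sum_j c ord0 j * F a j y) ^+ 2.
Proof.
move=> pF.
have mU : measurable U by exact: measurable_unit_simplex.
have iF a j k : leb.-integrable U (EFin \o (fun y => F a j y * F a k y)).
  exact: polyfun_integrable_unit (polyfunM (pF a j) (pF a k)).
have iF' a j k : leb.-integrable U (EFin \o (fun y => c ord0 j * c ord0 k * (F a j y * F a k y))).
  exact: polyfun_integrable_unit (polyfunZ _ (polyfunM (pF a j) (pF a k))).
rewrite bformE; under eq_bigr do under eq_bigr do rewrite mxE mulr_sumr mulr_suml.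
under eq_bigr do rewrite exchange_big/=.
rewrite exchange_big/=; apply: eq_bigr => a _.
have sqE y : (\sum_j c ord0 j * F a j y) ^+ 2 =
    \sum_j \sum_k c ord0 j * c ord0 k * (F a j y * F a k y).
  rewrite expr2 mulr_suml; apply: eq_bigr => j _; rewrite mulr_sumr.
  by apply: eq_bigr => k _; ring.
under [RHS]eq_Rintegral => y _ do rewrite sqE.
rewrite Rintegral_sum//; last first.
  by move=> j; apply: integrable_sumR => // k; exact: iF'.
apply: eq_bigr => j _; rewrite Rintegral_sum//.
by apply: eq_bigr => k _; rewrite RintegralZl// mulrAC.
Qed.

(** The inequalities on the unit simplex come from the comparison of two
quadratic forms on coefficients: it suffices to compare their kernels. *)
Lemma unit_simplex_compare p q N l (F1 : 'I_p -> 'I_N -> pt -> R)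
    (F2 : 'I_q -> 'I_N -> pt -> R) :
  (forall a j, polyfun l (F1 a j)) -> (forall b j, polyfun l (F2 b j)) ->
  (forall c : 'rV[R]_N,
     (forall b y, U y -> \sum_j c ord0 j * F2 b j y = 0) ->
     forall a y, U y -> \sum_j c ord0 j * F1 a j y = 0) ->
  exists2 C : R, 0 <= C & forall c : 'rV[R]_N,
    \sum_a \int[leb]_(y in U) (\sum_j c ord0 j * F1 a j y) ^+ 2 <=
    C * \sum_b \int[leb]_(y in U) (\sum_j c ord0 j * F2 b j y) ^+ 2.
Proof.
move=> pF1 pF2 H.
have gT r (F : 'I_r -> 'I_N -> pt -> R) : (gram F)^T = gram F.
  apply/matrixP => j k; rewrite !mxE; apply: eq_bigr => a _.
  by apply: eq_Rintegral => y _; rewrite mulrC.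
have ge0 r (F : 'I_r -> 'I_N -> pt -> R) (c : 'rV[R]_N) :
    0 <= \sum_a \int[leb]_(y in U) (\sum_j c ord0 j * F a j y) ^+ 2.
  by apply: sumr_ge0 => a _; apply: Rintegral_ge0 => y _; exact: sqr_ge0.
have [C C0 HC] : exists2 C : R, 0 <= C & forall c,
    bform (gram F1) c c <= C * bform (gram F2) c c.
  apply: bform_le => //.
  - by move=> c; rewrite (gramE _ pF1).
  - by move=> c; rewrite (gramE _ pF2).
  - move=> c; rewrite (gramE _ pF1) (gramE _ pF2) => /eqP.
    rewrite psumr_eq0; last first.
      by move=> b _; apply: Rintegral_ge0 => y _; exact: sqr_ge0.
    move=> /allP F20; rewrite big1// => a _.
    have c1 : forall a y, U y -> \sum_j c ord0 j * F1 a j y = 0.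
      apply: H => b y Uy; apply/eqP; rewrite -sqrf_eq0; apply/eqP; move: y Uy.
      apply: unit_simplex_integral0.
      + have pF : polyfun l (fun y => \sum_j c ord0 j * F2 b j y).
          by apply: polyfun_sum => j _; exact: polyfunZ.
        exact: polyfun_continuous (polyfunM pF pF).
      + by move=> y; exact: sqr_ge0.
      + by apply/eqP; have := F20 b (mem_index_enum b).
    transitivity (\int[leb]_(y in U) (0 : R)); last by rewrite /Rintegral integral0.
    by apply: eq_Rintegral => y /set_mem Uy; rewrite c1// expr0n.
exists C => // c; rewrite -(gramE _ pF1) -(gramE _ pF2).
exact: HC.
Qed.

End unit_simplex_polynomials.

(** * Triangulations *)

Section triangulations.
Context {R : realType} {n : nat}.
Local Notation d := n.+1.
Local Notation pt := 'rV[R]_d.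
Local Notation leb := (@lebesgue_rV R d).
Implicit Types (K L : 'M[R]_(d.+1, d)) (T : seq 'M[R]_(d.+1, d)) (f : pt -> R).

Lemma vertices_uniq K : nondegenerate K -> uniq (vertices K).
Proof.
move=> ndK; rewrite map_inj_uniq ?enum_uniq// => i j ij.
have := bary_vertex ndK i j; rewrite -ij bary_vertex// eqxx.
by case: eqP => // _ /eqP; rewrite oner_eq0.
Qed.

(** The common points are spanned by the common vertices, hence lie on the facet
opposite to a vertex of K that is not a vertex of L. *)
Lemma simplexI_face T Omega K L : triangulation Omega T -> K \in T -> L \in T ->
  K != L -> exists j, forall x, simplex K x -> simplex L x -> bary K j x = 0.
Proof.
move=> [ndT _ TI TU] KT LT KL.
have ndK := ndT _ KT.
have [j Hj] : exists j, row j K \notin vertices L.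
  apply/existsP; rewrite -negb_forall; apply/negP => /forallP H.
  move/eqP : KL; apply; apply: TU => //; apply: uniq_perm.
  - exact: vertices_uniq.
  - exact: vertices_uniq (ndT _ LT).
  - have sub : {subset vertices K <= vertices L}.
      by move=> _ /mapP[i _ ->]; exact: H.
    have sz : (size (vertices L) <= size (vertices K))%N by rewrite !size_map.
    by have [_ KL'] := uniq_min_size (vertices_uniq ndK) sub sz; exact: KL'.
exists j => x Kx Lx; have : (simplex K `&` simplex L) x by [].
rewrite TI//; apply: hull_vanish => v; rewrite mem_filter => /andP[vL /mapP[i _ vE]].
rewrite -/(bary K j v) vE bary_vertex//; case: eqP => // ji.
by move/negP : Hj; case; rewrite ji -vE.
Qed.

Lemma closed_cell_union T : {in T, forall K, nondegenerate K} ->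
  closed (cell_union T).
Proof.
move=> ndT; apply: closed_bigcup; first exact: finite_seq.
by move=> K KT; exact/closed_simplex/ndT.
Qed.

Lemma open_polytope Omega : @polytope R d Omega -> open Omega.
Proof. by move=> [_ _ [S _ ->]]; exact: open_interior. Qed.

(** A polytope is the interior of its closure. *)
Lemma osimplex_sub_polytope Omega T K : polytope Omega -> triangulation Omega T ->
  K \in T -> osimplex K `<=` Omega.
Proof.
move=> [_ _ [S ndS OE]] [ndT TO _ _] KT x xK.
have sub : osimplex K `<=` cell_union S.
  apply: (@subset_trans _ (closure Omega)).
    move=> y /(osimplex_sub (ndT _ KT)) yK; rewrite -TO; by exists K.
  rewrite {1}OE => y yc.
  have : closure (cell_union S) y by apply: closureS yc; exact: interior_subset.
  by rewrite -((closure_id _).1 (closed_cell_union ndS)).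
rewrite OE /interior /=.
by apply: filterS sub _; apply: open_nbhs_nbhs; split => //; exact: open_osimplex.
Qed.

Lemma triangulation_neq_nil Omega T : polytope Omega -> triangulation Omega T -> T != [::].
Proof.
move=> [[x Ox] _ _] [_ TO _ _]; apply/eqP => T0.
have : cell_union T x by rewrite TO; exact: subset_closure.
by rewrite T0 => -[].
Qed.

Variables (Omega : set pt) (T : seq 'M[R]_(d.+1, d)).
Hypotheses (pO : polytope Omega) (tT : triangulation Omega T).

Let ndT : {in T, forall K, nondegenerate K}. Proof. by have [] := tT. Qed.

(** Cells overlap in their facets, which are negligible. *)
Lemma ae_osimplex_uniq : {ae leb, forall x, Omega x ->
  exists K, [/\ K \in T, osimplex K x & forall L, L \in T -> simplex L x -> L = K]}.
Proof.
have : {ae leb, forall x, forall k, (k < size T)%N -> forall i, bary (nth 0 T k) i x != 0}.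
  apply: ae_foralln => k; have [kT|kT] := ltnP k (size T).
    by apply: filterS (ae_bary_neq0 (ndT (mem_nth 0 kT))) => x H _.
  exact: aeW.
apply: filterS => x Hx Ox.
have : cell_union T x by have [_ -> _ _] := tT; exact: subset_closure.
have H K : K \in T -> forall i, bary K i x != 0.
  by move=> KT; have := Hx (index K T); rewrite index_mem KT nth_index//; exact.
move=> [K /= KT Kx]; exists K; split => //.
  move=> i; rewrite lt_neqAle eq_sym H//=.
  by move: Kx => /simplex_baryP; apply; exact: ndT.
move=> L LT Lx; apply/eqP/negPn/negP => LK.
have [j Hj] := simplexI_face tT LT KT LK.
by have := H L LT j; rewrite Hj// eqxx.
Qed.

(** A cell may occur several times in the list, whence the undup. *)
Lemma Rintegral_triangulation f : leb.-integrable Omega (EFin \o f) ->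
  \int[leb]_(x in Omega) f x = \sum_(K <- undup T) \int[leb]_(x in osimplex K) f x.
Proof.
move=> fi.
have mO : measurable Omega by exact: open_rV_measurable (open_polytope pO).
have -> : \int[leb]_(x in Omega) f x =
    \int[leb]_(x in Omega) (\sum_(K <- undup T) (f \_ (osimplex K)) x).
  apply: ae_eq_Rintegral; apply: filterS ae_osimplex_uniq => x Hx; rewrite !patchE.
  case: ifPn => // /set_mem /Hx[K [KT Kx KU]].
  rewrite (bigD1_seq K) ?undup_uniq ?mem_undup//= patchE mem_set// big1_seq ?addr0// => L.
  rewrite mem_undup => /andP[LK LT]; rewrite patchE memNset//.
  by move=> /(osimplex_sub (ndT LT)) /KU LK'; rewrite LK' ?eqxx in LK.
rewrite Rintegral_sum// => [|K].
  apply: eq_big_seq => K; rewrite mem_undup => KT.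
  rewrite -Rintegral_mkcondr setIC; congr (Rintegral _ _ _).
  by apply: setIidl; exact: (osimplex_sub_polytope pO tT KT).
have mK := measurable_osimplex K.
have fOK : leb.-integrable (Omega `&` osimplex K) (EFin \o f).
  by apply: integrableS fi => //; exact: measurableI.
apply/(integrable_mkcond _ mO); move/(integrable_mkcond _ (measurableI _ _ mO mK)) : fOK.
congr (_.-integrable); apply/funext => x; rewrite /= !patchE in_setI.
by case: (x \in Omega) => //=; rewrite patchE; case: (x \in osimplex K).
Qed.

Lemma L2_osimplex_sum f g : L2 Omega f -> L2 Omega g ->
  ip Omega f g = \sum_(K <- undup T) ip (osimplex K) f g.
Proof.
move=> Lf Lg; apply: Rintegral_triangulation; apply: L2_integrableM => //.
exact: open_rV_measurable (open_polytope pO).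
Qed.

End triangulations.

Section diameters.
Context {R : realType} {n : nat}.
Local Notation d := n.+1.
Local Notation pt := 'rV[R]_d.
Variable K : 'M[R]_(d.+1, d).
Hypothesis ndK : nondegenerate K.

Lemma diam_ge (x y : pt) : simplex K x -> simplex K y ->
  enorm (x - y) <= diam (simplex K).
Proof.
move=> Kx Ky; apply: ub_le_sup; last by exists x => //; exists y.
have [r Kr] := simplex_cube K.
exists (d.+1%:R * (`|r| + `|r|)) => _ [a Ka [b Kb <-]].
apply: enorm_cube; first by rewrite addr_ge0.
move=> i; rewrite !mxE; apply: le_trans (ler_normB _ _) _.
by apply: lerD; apply: le_trans (ler_norm r); exact: Kr.
Qed.

Lemma simplex_vertex i : simplex K (row i K).
Proof. by apply/simplex_baryP => // j; rewrite bary_vertex. Qed.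

Lemma edges_le_diam j i : `|edges K j i| <= diam (simplex K).
Proof.
apply: le_trans (diam_ge (simplex_vertex (lift ord0 j)) (simplex_vertex ord0)).
apply: le_trans (normr_le_enorm _ i).
by rewrite !mxE.
Qed.

Lemma diam_ge0 : 0 <= diam (simplex K).
Proof. exact: le_trans (edges_le_diam ord0 ord0). Qed.

Lemma diam_gt0 : 0 < diam (simplex K).
Proof.
rewrite lt_neqAle diam_ge0 andbT eq_sym; apply/eqP => d0.
have E0 : edges K = 0.
  apply/matrixP => i j; rewrite [RHS]mxE; apply/eqP; rewrite -normr_le0 -d0.
  exact: edges_le_diam.
by have := ndK; rewrite /nondegenerate E0 unitmxE det0 unitr0.
Qed.

(** A barycentric coordinate varies by at most 1 along a diameter of a ball
contained in the simplex. *)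
Lemma bgrad_ball i j (r : R) :
  (exists c : pt, forall x, enorm (x - c) <= r -> simplex K x) ->
  `|bgrad K i ord0 j| * (2 * r) <= 1.
Proof.
move=> [c Hc]; have [r0|r0] := ltP r 0.
  by apply: (@le_trans _ _ 0) => //; rewrite mulr_ge0_le0//; lra.
have in_ball s : `|s| <= r -> simplex K (c + s *: delta_mx ord0 j).
  move=> sr; apply: Hc; rewrite addrAC subrr add0r /enorm dotZl dotC dotZl dot_delta.
  by rewrite mxE !eqxx mulr1 -expr2 sqrtr_sqr.
have bb s : `|s| <= r -> 0 <= bary K i c + s * bgrad K i ord0 j <= 1.
  move=> sr; rewrite -[bgrad K i ord0 j]dot_delta -baryDZ.
  have Ks := in_ball s sr; rewrite bary_le1// andbT.
  by move: Ks => /simplex_baryP; apply.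
have rr : `|r| <= r by rewrite ger0_norm.
have /andP[p0 p1] := bb r rr.
have /andP[m0 m1] : 0 <= bary K i c + (- r) * bgrad K i ord0 j <= 1.
  by apply: bb; rewrite normrN.
have r20 : 0 <= 2 * r by rewrite mulr_ge0.
rewrite -[2 * r]ger0_norm// -normrM ler_norml.
by apply/andP; split; lra.
Qed.

Let balls := [set 2 * r | r in [set r | exists c : pt, forall x, enorm (x - c) <= r -> simplex K x]].

Let balls0 : balls 0.
Proof.
exists 0; last by rewrite mulr0.
exists (row ord0 K) => x; rewrite le_eqVlt ltNge enorm_ge0 orbF => /eqP x0.
have : dot (x - row ord0 K) (x - row ord0 K) == 0 by rewrite -sqr_enorm x0 expr0n.
by rewrite dotxx_eq0 subr_eq0 => /eqP ->; exact: simplex_vertex.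
Qed.

Let balls_ub i j : bgrad K i ord0 j != 0 -> ubound balls `|bgrad K i ord0 j|^-1.
Proof.
move=> g0 _ [r Hr <-]; rewrite -[leRHS]mul1r ler_pdivlMr ?normr_gt0// mulrC.
exact: bgrad_ball.
Qed.

Lemma indiam_ge0 : 0 <= indiam (simplex K).
Proof.
have [j gj] : exists j, bgrad K ord0 ord0 j != 0.
  apply/existsP; rewrite -negb_forall; apply/negP => /forallP H.
  have /eqP := bgrad_neq0 ndK ord0; apply; apply/rowP => j; rewrite [RHS]mxE.
  exact/eqP/H.
by apply: ub_le_sup balls0; exists `|bgrad K ord0 ord0 j|^-1; exact: balls_ub.
Qed.

Lemma bgrad_indiam i j : `|bgrad K i ord0 j| * indiam (simplex K) <= 1.
Proof.
have [->|g0] := eqVneq (bgrad K i ord0 j) 0; first by rewrite normr0 mul0r.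
rewrite mulrC -ler_pdivlMr ?normr_gt0// mul1r.
by apply: ge_sup; [exists 0; exact: balls0|exact: balls_ub].
Qed.

End diameters.

(** * Scaled inequalities on a simplex *)

Section reference_inequalities.
Context {R : realType} {n : nat}.
Local Notation d := n.+1.
Local Notation pt := 'rV[R]_d.
Local Notation leb := (@lebesgue_rV R d).
Local Notation U := (@unit_simplex R d).

Lemma sqr_sum_le m (x : 'I_m -> R) : (\sum_i x i) ^+ 2 <= m%:R * \sum_i x i ^+ 2.
Proof.
have H : 0 <= \sum_i \sum_j (x i - x j) ^+ 2.
  by apply: sumr_ge0 => i _; apply: sumr_ge0 => j _; exact: sqr_ge0.
have cross : \sum_i \sum_j 2 * (x i * x j) = 2 * (\sum_i x i) ^+ 2.
  transitivity (\sum_i 2 * (x i * \sum_j x j)).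
    by apply: eq_bigr => i _; rewrite !mulr_sumr.
  by rewrite -mulr_sumr -mulr_suml expr2.
have E : \sum_i \sum_j (x i - x j) ^+ 2 =
    2 * (m%:R * \sum_i x i ^+ 2) - 2 * (\sum_i x i) ^+ 2.
  transitivity (\sum_i \sum_j (x i ^+ 2 + x j ^+ 2 - 2 * (x i * x j))).
    by apply: eq_bigr => i _; apply: eq_bigr => j _; ring.
  under eq_bigr do rewrite sumrB big_split/= sumr_const card_ord.
  rewrite sumrB cross big_split/= sumr_const card_ord sumrMnl.
  by rewrite -[_ *+ m]mulr_natl; ring.
lra.
Qed.

Lemma pderiv_lincomb N (e : 'I_N -> pt -> R) (c : 'I_N -> R) i :
  (forall j x, differentiable (e j) x) ->
  pderiv i (fun x => \sum_j c j * e j x) = fun x => \sum_j c j * pderiv i (e j) x.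
Proof.
move=> de; apply/funext => x.
suff H : forall s : seq 'I_N,
    differentiable (fun x => \sum_(j <- s) c j * e j x) x /\
    pderiv i (fun x => \sum_(j <- s) c j * e j x) x = \sum_(j <- s) c j * pderiv i (e j) x.
  by have [_ ->] := H (index_enum _).
elim=> [|j s [ds ih]].
  rewrite (_ : (fun=> _) = fun=> 0); last by apply/funext => y; rewrite big_nil.
  by rewrite pderiv_cst big_nil; split => //; exact: differentiable_cst.
rewrite (_ : (fun=> _) = fun x => c j * e j x + \sum_(j <- s) c j * e j x); last first.
  by apply/funext => y; rewrite big_cons.
have dj : differentiable (fun x => c j * e j x) x.
  by apply: differentiableM => //; exact: differentiable_cst.
split; first exact: differentiableD.
by rewrite big_cons pderivD// pderivZ// ih.
Qed.

(** The unit simplex in the form of a cell, so that barycentric coordinates, weight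
and flux make sense for it. *)
Definition unit_cell : 'M[R]_(d.+1, d) :=
  \matrix_(i, j) oapp (fun k => (k == j)%:R) 0 (unlift ord0 i).

Lemma edges_unit_cell : edges unit_cell = 1%:M.
Proof.
by apply/matrixP => i j; rewrite !mxE liftK unlift_none /= subr0.
Qed.

Lemma nondegenerate_unit_cell : nondegenerate unit_cell.
Proof. by rewrite /nondegenerate edges_unit_cell unitmx1. Qed.

Lemma aff_unit_cell y : aff unit_cell y = y.
Proof.
rewrite /aff edges_unit_cell mulmx1 (_ : row _ _ = 0) ?add0r//.
by apply/rowP => j; rewrite !mxE unlift_none.
Qed.

Lemma simplex_unit_cell y : simplex unit_cell y <-> U y.
Proof. by rewrite -{1}[y]aff_unit_cell; apply: simplex_aff; exact: nondegenerate_unit_cell. Qed.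

Lemma bary_aff_unit (K : 'M[R]_(d.+1, d)) i y : nondegenerate K ->
  bary K i (aff K y) = bary unit_cell i y.
Proof.
move=> ndK; have := bary_aff nondegenerate_unit_cell i y.
by rewrite aff_unit_cell => ->; exact: bary_aff.
Qed.

Lemma polyfun_eq0_unit l (f : pt -> R) : polyfun l f -> (forall y, U y -> f y = 0) ->
  forall x, f x = 0.
Proof.
move=> pf f0; apply: (polyfun_eq0_simplex nondegenerate_unit_cell pf).
by move=> y /simplex_unit_cell; exact: f0.
Qed.

(** A polynomial whose gradient vanishes on the unit simplex is constant. *)
Lemma reference_poincare l : exists2 C : R, 0 <= C & forall p : pt -> R, polyfun l p ->
  \int[leb]_(y in U) (p y - p 0) ^+ 2 <=
  C * \sum_i \int[leb]_(y in U) pderiv i p y ^+ 2.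
Proof.
have [N [e [pe span]]] := @polyfun_basis R d l.
pose F1 (a : 'I_1) j (y : pt) := e j y - e j 0.
pose F2 (i : 'I_d) j := pderiv i (e j).
have de j x := polyfun_differentiable x (pe j).
have sumF1 (c : 'rV[R]_N) (p : pt -> R) a y : (forall x, p x = \sum_j c ord0 j * e j x) ->
    \sum_j c ord0 j * F1 a j y = p y - p 0.
  by move=> pE; rewrite !pE -sumrB; apply: eq_bigr => j _; rewrite mulrBr.
have sumF2 (c : 'rV[R]_N) (p : pt -> R) i y : (forall x, p x = \sum_j c ord0 j * e j x) ->
    \sum_j c ord0 j * F2 i j y = pderiv i p y.
  by move=> /funext ->; rewrite pderiv_lincomb.
have [||c H|C C0 HC] := @unit_simplex_compare R n 1 d N l F1 F2.
- by move=> a j; apply: polyfunB => //; exact: polyfun_cst.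
- by move=> i j; apply: polyfun_leq (polyfun_pderiv i (pe j)); exact: leq_pred.
- move=> a y Uy; set p := fun x => \sum_j c ord0 j * e j x.
  have pp : polyfun l p by apply: polyfun_sum => j _; exact: polyfunZ.
  rewrite (sumF1 c p)//.
  have dp0 i : forall x, pderiv i p x = 0.
    apply: (polyfun_eq0_unit (polyfun_pderiv i pp)) => z Uz.
    by rewrite -(sumF2 c p)//; exact: H.
  have dp x := polyfun_differentiable x pp.
  have [s _] := line_MVT 0 y 1 dp; rewrite scale1r !add0r mul1r => ->.
  by rewrite derive_pderiv// big1// => i _; rewrite dp0 mulr0.
- exists C => // p pp; have [c pE] := span p pp.
  have := HC c; rewrite big_ord1.
  under eq_Rintegral do rewrite (sumF1 c p)//.
  by under eq_bigr do under eq_Rintegral do rewrite (sumF2 c p)//.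
Qed.

(** The product of the squared barycentric coordinates vanishes to second order
on the boundary: extended by zero it is continuously differentiable. *)
Definition weight (K : 'M[R]_(d.+1, d)) (x : pt) : R := \prod_i bary K i x ^+ 2.

Lemma bary_prod_degree (r : seq 'I_d.+1) : exists m, forall K : 'M[R]_(d.+1, d),
  polyfun m (fun x => \prod_(i <- r) bary K i x ^+ 2).
Proof.
elim: r => [|i r [m ih]].
  exists 0%N => K; rewrite (_ : (fun=> _) = fun=> 1); first exact: polyfun_cst.
  by apply/funext => x; rewrite big_nil.
exists (1 + 1 + m)%N => K; rewrite (_ : (fun=> _) = fun x => (bary K i x * bary K i x) *
    \prod_(i <- r) bary K i x ^+ 2).
  by apply: polyfunM (ih K); apply: polyfunM; exact: polyfun_bary.
by apply/funext => x; rewrite big_cons expr2.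
Qed.

Lemma weight_degree : exists m, forall K, polyfun m (weight K).
Proof. exact: bary_prod_degree. Qed.

Lemma polyfun_weight K : exists m, polyfun m (weight K).
Proof. by have [m H] := weight_degree; exists m. Qed.

Lemma weight_itv K x : nondegenerate K -> simplex K x -> 0 <= weight K x <= 1.
Proof.
move=> ndK Kx; rewrite /weight; elim/big_ind : _ => [|y z /andP[y0 y1] /andP[z0 z1]|i _].
- by rewrite ler01 lexx.
- by rewrite mulr_ge0//= mulr_ile1.
- rewrite sqr_ge0/= expr_le1//; first exact: bary_le1.
  by move: Kx => /simplex_baryP; apply.
Qed.

Lemma weight_gt0 K x : osimplex K x -> 0 < weight K x.
Proof. by move=> x0; apply: prodr_gt0 => i _; rewrite exprn_gt0. Qed.

Lemma weight_aff K y : nondegenerate K -> weight K (aff K y) = weight unit_cell y.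
Proof. by move=> ndK; apply: eq_bigr => i _; rewrite bary_aff_unit. Qed.

(** The weight is positive inside the simplex, so that only p = 0 gives 0. *)
Lemma reference_weight l : exists2 C : R, 0 <= C & forall p : pt -> R, polyfun l p ->
  \int[leb]_(y in U) p y ^+ 2 <= C * \int[leb]_(y in U) (weight unit_cell y * p y) ^+ 2.
Proof.
have [N [e [pe span]]] := @polyfun_basis R d l.
have [m pw] := polyfun_weight unit_cell.
pose F1 (a : 'I_1) j := e j.
pose F2 (a : 'I_1) j (y : pt) := weight unit_cell y * e j y.
have sumF2 (c : 'rV[R]_N) a y :
    \sum_j c ord0 j * F2 a j y = weight unit_cell y * \sum_j c ord0 j * e j y.
  by rewrite mulr_sumr; apply: eq_bigr => j _; rewrite mulrCA.
have [||c H|C C0 HC] := @unit_simplex_compare R n 1 1 N (m + l) F1 F2.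
- by move=> a j; apply: polyfun_leq (pe j); exact: leq_addl.
- by move=> a j; exact: polyfunM.
- move=> a y _; have pp : polyfun l (fun x => \sum_j c ord0 j * e j x).
    by apply: polyfun_sum => j _; exact: polyfunZ.
  have [x0 [r r0 Hr]] := osimplex_ball nondegenerate_unit_cell.
  apply: (polyfun_eq0_ball (x0 := x0) pp r0) => x /Hr ox.
  have Ux : U x by apply/simplex_unit_cell; exact: (osimplex_sub nondegenerate_unit_cell).
  have /eqP := H ord0 x Ux; rewrite sumF2 mulf_eq0 gt_eqF ?weight_gt0//=.
  by move=> /eqP.
- exists C => // p pp; have [c pE] := span p pp.
  have := HC c; rewrite !big_ord1.
  under eq_Rintegral do rewrite /F1 -pE.
  by under [X in _ <= C * X]eq_Rintegral do rewrite sumF2 -pE.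
Qed.

Lemma reference_inverse l : exists2 C : R, 0 <= C & forall p : pt -> R, polyfun l p ->
  \sum_i \int[leb]_(y in U) pderiv i (fun y => weight unit_cell y * p y) y ^+ 2 <=
  C * \int[leb]_(y in U) p y ^+ 2.
Proof.
have [N [e [pe span]]] := @polyfun_basis R d l.
have [m pw] := polyfun_weight unit_cell.
pose F1 (i : 'I_d) j := pderiv i (fun y => weight unit_cell y * e j y).
pose F2 (a : 'I_1) j := e j.
have sumF1 (c : 'rV[R]_N) (p : pt -> R) i y : (forall x, p x = \sum_j c ord0 j * e j x) ->
    \sum_j c ord0 j * F1 i j y = pderiv i (fun y => weight unit_cell y * p y) y.
  move=> /funext ->; rewrite -[LHS]/((fun y => \sum_j c ord0 j * F1 i j y) y).
  rewrite -pderiv_lincomb; last first.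
    by move=> j x; exact: polyfun_differentiable (polyfunM pw (pe j)).
  congr pderiv; apply/funext => x; rewrite mulr_sumr.
  by apply: eq_bigr => j _; rewrite mulrCA.
have [||c H|C C0 HC] := @unit_simplex_compare R n d 1 N (m + l) F1 F2.
- move=> i j; apply: polyfun_leq (polyfun_pderiv i (polyfunM pw (pe j))).
  exact: leq_pred.
- by move=> a j; apply: polyfun_leq (pe j); exact: leq_addl.
- move=> i y Uy; set p := fun x => \sum_j c ord0 j * e j x.
  have pp : polyfun l p by apply: polyfun_sum => j _; exact: polyfunZ.
  rewrite (sumF1 c p)//.
  have -> : (fun y => weight unit_cell y * p y) = fun=> 0.
    apply/funext => x; rewrite (polyfun_eq0_unit pp) ?mulr0// => z Uz.
    exact: H ord0 z Uz.
  by rewrite pderiv_cst.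
- exists C => // p pp; have [c pE] := span p pp.
  have := HC c; rewrite big_ord1.
  under eq_Rintegral do rewrite /F2 -pE.
  by under eq_bigr do under eq_Rintegral do rewrite (sumF1 c p)//.
Qed.

(** The gradient of a barycentric coordinate is normal to the opposite facet:
these fields have no flux through the boundary. *)
Definition noflux (K : 'M[R]_(d.+1, d)) (w : pt -> pt) :=
  forall i x, simplex K x -> bary K i x = 0 -> dot (w x) (bgrad K i) = 0.

(** A right inverse of the divergence on the finite dimensional space of
polynomial fields without flux: a complement of the divergence free fields. *)
Lemma reference_divergence l : exists2 C : R, 0 <= C & forall w : pt -> pt,
  (forall i, polyfun l (comp w i)) -> noflux unit_cell w ->
  exists w', [/\ forall i, polyfun l (comp w' i), noflux unit_cell w',
    forall y, U y -> pdiv w' y = pdiv w y &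
    \sum_i \int[leb]_(y in U) comp w' i y ^+ 2 <=
      C * \int[leb]_(y in U) pdiv w y ^+ 2].
Proof.
have [N [e [pe span]]] := @polyfun_basis R d l.
pose field (c : 'rV[R]_(d * N)) (y : pt) : pt := \row_i \sum_k (vec_mx c) i k * e k y.
have compE c i : comp (field c) i = fun y => \sum_k (vec_mx c) i k * e k y.
  by apply/funext => y; rewrite /comp mxE.
have pcomp c i : polyfun l (comp (field c) i).
  by rewrite compE; apply: polyfun_sum => k _; exact: polyfunZ.
have de j x := polyfun_differentiable x (pe j).
have fieldD a c c' y : field (a *: c + c') y = a *: field c y + field c' y.
  apply/rowP => i; rewrite !mxE mulr_sumr -big_split; apply: eq_bigr => k _.
  by rewrite linearP !mxE /= mulrDl mulrA.
have field0 y : field 0 y = 0.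
  by apply/rowP => i; rewrite !mxE big1// => k _; rewrite linear0 mxE mul0r.
have pdivE c y : pdiv (field c) y = \sum_i \sum_k (vec_mx c) i k * pderiv i (e k) y.
  by apply: eq_bigr => i _; rewrite compE pderiv_lincomb.
have pdivD a c c' y : pdiv (field (a *: c + c')) y = a * pdiv (field c) y + pdiv (field c') y.
  rewrite !pdivE mulr_sumr -big_split; apply: eq_bigr => i _ /=.
  rewrite mulr_sumr -big_split; apply: eq_bigr => k _.
  by rewrite linearP !mxE /= mulrDl mulrA.
have pdiv0 y : pdiv (field 0) y = 0.
  by rewrite pdivE big1// => i _; rewrite big1// => k _; rewrite linear0 mxE mul0r.
pose S := [set c | noflux unit_cell (field c)].
pose Z := [set c | S c /\ forall y, U y -> pdiv (field c) y = 0].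
have S0 : S 0 by move=> i x _ _; rewrite field0 /dot big1// => j _; rewrite mxE mul0r.
have SD a c c' : S c -> S c' -> S (a *: c + c').
  move=> Sc Sc' i x Ux xi; rewrite fieldD dotDl dotZl.
  by rewrite (Sc i x Ux xi) (Sc' i x Ux xi) mulr0 addr0.
have Z0 : Z 0 by split => // y _; exact: pdiv0.
have ZD a c c' : Z c -> Z c' -> Z (a *: c + c').
  move=> [Sc Zc] [Sc' Zc']; split; first exact: SD.
  by move=> y Uy; rewrite pdivD Zc// Zc'// mulr0 addr0.
have [MS HMS] := subspace_matrix S0 SD.
have [MZ HMZ] := subspace_matrix Z0 ZD.
pose M := (MS :\: MZ)%MS.
have MS_M c : S (c *m M) by apply/HMS; apply: submx_trans (diffmxSl _ _); exact: submxMl.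
have M_Z c : Z (c *m M) -> c *m M = 0.
  move=> /HMZ cZ; apply/eqP; rewrite -submx0 -(capmx_diff MS MZ) sub_capmx cZ andbT.
  exact: submxMl.
have S_dec c : S c -> exists y, Z (c - y *m M).
  move=> /HMS cS.
  have : (c <= M + MS :&: MZ)%MS by rewrite addsmx_diff_cap_eq.
  move=> /sub_addsmxP[[u v] /= ->]; exists u; apply/HMZ.
  rewrite addrAC subrr add0r; apply: submx_trans (capmxSr MS MZ); exact: submxMl.
pose F1 (i : 'I_d) j := comp (field (row j M)) i.
pose F2 (a : 'I_1) j := pdiv (field (row j M)).
have row_sum (c : 'rV[R]_(d * N)) : c *m M = \sum_j c ord0 j *: row j M by exact: mulmx_sum_row.
have sumF1 (c : 'rV[R]_(d * N)) i (y : pt) : \sum_j c ord0 j * F1 i j y = comp (field (c *m M)) i y.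
  rewrite row_sum; elim: (index_enum _) => [|j s ih].
    by rewrite !big_nil /comp field0 mxE.
  by rewrite !big_cons ih /F1 /comp fieldD !mxE.
have sumF2 (c : 'rV[R]_(d * N)) a (y : pt) : \sum_j c ord0 j * F2 a j y = pdiv (field (c *m M)) y.
  rewrite row_sum; elim: (index_enum _) => [|j s ih]; first by rewrite !big_nil pdiv0.
  by rewrite !big_cons ih pdivD.
have [||c H|C C0 HC] := @unit_simplex_compare R n d 1 (d * N) l F1 F2.
- by move=> i j; exact: pcomp.
- move=> a j; apply: polyfun_sum => i _; apply: polyfun_leq (polyfun_pderiv i (pcomp _ i)).
  exact: leq_pred.
- move=> i y Uy; rewrite sumF1 (M_Z c).
    by rewrite /comp field0 mxE.
  by split => // z Uz; rewrite -(sumF2 c ord0); exact: H.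
- exists C => // w pw nfw.
  have /choice[X HX] : forall i, exists c : 'rV[R]_N, forall x,
      comp w i x = \sum_j c ord0 j * e j x by move=> i; exact: span.
  pose c := mxvec (\matrix_(i, k) X i ord0 k).
  have wE : w = field c.
    apply/funext => y; apply/rowP => i; rewrite mxE -[LHS]/(comp w i y) HX.
    by apply: eq_bigr => k _; rewrite mxvecK mxE.
  have [z [Sz Zz]] : exists z, Z (c - z *m M) by apply: S_dec; rewrite /S /= -wE.
  exists (field (z *m M)); split => //; first exact: MS_M.
  + move=> y Uy; have := Zz y Uy; rewrite -[c - _]addrC -scaleN1r pdivD mulN1r -wE.
    by move=> /eqP; rewrite addrC subr_eq0 => /eqP.
  + have := HC z; rewrite big_ord1.
    under eq_bigr do under eq_Rintegral do rewrite sumF1.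
    move=> /le_trans; apply; rewrite le_eqVlt; apply/orP; left; apply/eqP; congr (_ * _).
    apply: eq_Rintegral => y /set_mem Uy; rewrite sumF2.
    have := Zz y Uy; rewrite -[c - _]addrC -scaleN1r pdivD mulN1r -wE.
    by move=> /eqP; rewrite addrC subr_eq0 => /eqP ->.
Qed.

End reference_inequalities.

Section affine_transfer.
Context {R : realType} {n : nat}.
Local Notation d := n.+1.
Local Notation pt := 'rV[R]_d.
Local Notation leb := (@lebesgue_rV R d).
Local Notation U := (@unit_simplex R d).
Implicit Types (K : 'M[R]_(d.+1, d)).

Lemma le_sum_integral_mulmx (D : set pt) (l : nat) (B : 'M[R]_d) (b : R)
    (F G : 'I_d -> pt -> R) : measurable D ->
  (forall l f, polyfun l f -> leb.-integrable D (EFin \o f)) ->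
  (forall i j, `|B i j| <= b) -> (forall i, polyfun l (F i)) ->
  (forall j y, D y -> G j y = \sum_i B j i * F i y) ->
  \sum_j \int[leb]_(y in D) G j y ^+ 2 <=
  (d * d)%:R * b ^+ 2 * \sum_i \int[leb]_(y in D) F i y ^+ 2.
Proof.
move=> mD iD Bb pF GE.
have pF2 i : polyfun (l + l) (fun y => F i y ^+ 2).
  by under eq_fun do rewrite expr2; exact: polyfunM.
have pS : polyfun (l + l) (fun y => \sum_i F i y ^+ 2) by apply: polyfun_sum.
have pG j : polyfun (l + l) (fun y => (\sum_i B j i * F i y) ^+ 2).
  by under eq_fun do rewrite expr2; apply: polyfunM; apply: polyfun_sum => i _; exact: polyfunZ.
rewrite -(@Rintegral_sum _ _ R leb D mD _ _ (fun i y => F i y ^+ 2)); last by move=> i; exact: iD.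
have b0 : 0 <= b by apply: le_trans (Bb ord0 ord0).
apply: (@le_trans _ _ (\sum_(j < d) (d%:R * b ^+ 2 * \int[leb]_(y in D) \sum_i F i y ^+ 2))).
  apply: ler_sum => j _.
  under eq_Rintegral => y /set_mem Dy do rewrite GE//.
  rewrite -RintegralZl//; last exact: iD pS.
  apply: le_Rintegral => //; [exact: iD (pG j)|exact: iD (polyfunZ _ pS)|].
  move=> y _; apply: le_trans (sqr_sum_le _) _.
  rewrite -mulrA ler_wpM2l//.
  rewrite mulr_sumr; apply: ler_sum => i _; rewrite exprMn ler_wpM2r ?sqr_ge0//.
  by rewrite -[leLHS]real_normK ?num_real// ler_sqr ?nnegrE.
by rewrite sumr_const card_ord natrM -[leLHS]mulr_natl !mulrA.
Qed.

Lemma Rintegral_simplex_sqr K : nondegenerate K -> exists2 c : R, 0 < c &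
  forall l (f : pt -> R), polyfun l f ->
    \int[leb]_(x in simplex K) f x ^+ 2 = c * \int[leb]_(y in U) f (aff K y) ^+ 2.
Proof.
move=> ndK; have [c c0 H] := Rintegral_simplex ndK; exists c => // l f pf.
rewrite (H (fun x => f x ^+ 2))// => [|x]; last exact: sqr_ge0.
by apply: (@polyfun_continuous _ _ (l + l)); under eq_fun do rewrite expr2; exact: polyfunM.
Qed.

Lemma polyfun_aff K l (f : pt -> R) : polyfun l f -> polyfun l (f \o aff K).
Proof. exact: polyfun_affine. Qed.

Lemma affinvE K x : affinv K x = - row ord0 K *m invmx (edges K) + x *m invmx (edges K).
Proof. by rewrite /affinv mulmxBl addrC mulNmx. Qed.

Lemma polyfun_affinv K l (f : pt -> R) : polyfun l f -> polyfun l (f \o affinv K).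
Proof.
move=> pf; rewrite (_ : f \o affinv K =
    fun x => f (- row ord0 K *m invmx (edges K) + x *m invmx (edges K))).
  exact: polyfun_affine.
by apply/funext => x; rewrite /= affinvE.
Qed.

Lemma dot_edges_bgrad K v i : nondegenerate K ->
  dot (v *m edges K) (bgrad K i) = dot v (bgrad unit_cell i).
Proof.
move=> ndK.
have -> : v *m edges K = aff K v - aff K 0 by rewrite /aff mul0mx addr0 addrAC subrr add0r.
by rewrite -baryB// !bary_aff_unit// baryB ?subr0//; exact: nondegenerate_unit_cell.
Qed.

Lemma invmx_edges K i j : nondegenerate K ->
  invmx (edges K) i j = bgrad K (lift ord0 j) ord0 i.
Proof.
move=> ndK; rewrite -dot_delta -[delta_mx ord0 i](mulmxKV ndK) dot_edges_bgrad//.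
have -> : forall v : pt, dot v (bgrad unit_cell (lift ord0 j)) = v ord0 j.
  move=> v; rewrite -[X in dot X _]subr0 -baryB.
  rewrite -[X in bary _ _ X - _]aff_unit_cell -[X in _ - bary _ _ X]aff_unit_cell.
  by rewrite !bary_aff ?liftK/= ?mxE ?subr0//; exact: nondegenerate_unit_cell.
by rewrite -rowE mxE.
Qed.

(** The Piola transformation of a field by an affine map with linear part B, where
B' is the inverse of B. *)
Lemma pdiv_affine l (w : pt -> pt) (a : pt) (B B' : 'M[R]_d) (y : pt) : B' *m B = 1%:M ->
  (forall i, polyfun l (comp w i)) ->
  pdiv (fun y => w (a + y *m B) *m B') y = pdiv w (a + y *m B).
Proof.
move=> BB pw; rewrite /pdiv.
have dw i x := polyfun_differentiable x (pw i).
have dwa i x : differentiable (fun y => comp w i (a + y *m B)) x.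
  exact: polyfun_differentiable (polyfun_affine a B (pw i)).
transitivity (\sum_j \sum_i \sum_i' B' i j * B j i' * pderiv i' (comp w i) (a + y *m B)).
  apply: eq_bigr => j _.
  rewrite (_ : comp _ j = fun y => \sum_i B' i j * comp w i (a + y *m B)); last first.
    by apply/funext => x; rewrite /comp mxE; apply: eq_bigr => i _; rewrite mulrC.
  rewrite pderiv_lincomb//; apply: eq_bigr => i _.
  by rewrite pderiv_affine// mulr_sumr; apply: eq_bigr => i' _; rewrite mulrA.
rewrite exchange_big; apply: eq_bigr => i _; rewrite exchange_big/=.
transitivity (\sum_i' (B' *m B) i i' * pderiv i' (comp w i) (a + y *m B)).
  by apply: eq_bigr => i' _; rewrite mxE mulr_suml.
rewrite BB (bigD1 i)//= mxE eqxx mul1r big1 ?addr0// => i' ii'.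
by rewrite mxE eq_sym (negbTE ii') mul0r.
Qed.

(** Subtracting its mean minimizes the norm of a function among all constants,
so that the value at a vertex can be used on the unit simplex. *)
Lemma scaled_poincare l : exists2 C : R, 0 <= C & forall K (g : pt -> R),
  nondegenerate K -> polyfun l g -> \int[leb]_(x in simplex K) g x = 0 ->
  \int[leb]_(x in simplex K) g x ^+ 2 <=
  C * diam (simplex K) ^+ 2 * \sum_i \int[leb]_(x in simplex K) pderiv i g x ^+ 2.
Proof.
have [C C0 HC] := @reference_poincare R n l.
exists (C * (d * d)%:R); first by rewrite mulr_ge0.
move=> K g ndK pg g0; have [c c0 Hc] := Rintegral_simplex_sqr ndK.
set a := g (aff K 0).
have pga : polyfun l (fun x => g x - a) by apply: polyfunB => //; exact: polyfun_cst.
have mK := measurable_simplex ndK.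
have iK := polyfun_integrable_simplex ndK.
apply: (@le_trans _ _ (\int[leb]_(x in simplex K) (g x - a) ^+ 2)).
  have E x : (g x - a) ^+ 2 = g x ^+ 2 + (- (2 * a)) * g x + a ^+ 2 by ring.
  under [leRHS]eq_Rintegral do rewrite E.
  have ig2 : polyfun (l + l) (fun x => g x ^+ 2).
    by under eq_fun do rewrite expr2; exact: polyfunM.
  have ic : polyfun (l + l) (fun x : pt => a ^+ 2) by exact: polyfun_cst.
  have ig := polyfunZ (- (2 * a)) pg.
  rewrite RintegralD//; [|exact: iK _ _ (polyfunD ig2 (polyfun_leq (leq_addl _ _) ig))|exact: iK _ _ ic].
  rewrite RintegralD//; [|exact: iK _ _ ig2|exact: iK _ _ ig].
  rewrite RintegralZl//; last exact: iK _ _ pg.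
  by rewrite g0 mulr0 addr0 lerDl; apply: Rintegral_ge0 => // x _; exact: sqr_ge0.
rewrite (Hc l)//.
have := HC (g \o aff K) (polyfun_aff K pg); rewrite /= -/a => H.
have {}H := ler_wpM2l (ltW c0) H; apply: le_trans H _.
have dg i := polyfun_pderiv i pg.
have E : \sum_i \int[leb]_(x in simplex K) pderiv i g x ^+ 2 =
    c * \sum_i \int[leb]_(y in U) pderiv i g (aff K y) ^+ 2.
  by rewrite mulr_sumr; apply: eq_bigr => i _; exact: Hc (dg i).
rewrite [X in _ <= _ * X]E mulrA.
have H2 : \sum_i \int[leb]_(y in U) pderiv i (g \o aff K) y ^+ 2 <=
    (d * d)%:R * diam (simplex K) ^+ 2 * \sum_i \int[leb]_(y in U) pderiv i g (aff K y) ^+ 2.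
  apply: (@le_sum_integral_mulmx _ l.-1 (edges K)).
  - exact: measurable_unit_simplex.
  - by move=> m f; exact: polyfun_integrable_unit.
  - by move=> i j; exact: edges_le_diam.
  - by move=> i; exact: polyfun_aff (dg i).
  - move=> j y _; rewrite -[LHS]/(pderiv j (fun y => g (row ord0 K + y *m edges K)) y).
    by rewrite pderiv_affine//; exact: polyfun_differentiable pg.
apply: le_trans (ler_wpM2l (mulr_ge0 (ltW c0) C0) H2) _.
by rewrite le_eqVlt; apply/orP; left; apply/eqP; ring.
Qed.

Lemma scaled_weight l : exists2 C : R, 0 <= C & forall K (p : pt -> R),
  nondegenerate K -> polyfun l p ->
  \int[leb]_(x in simplex K) p x ^+ 2 <=
  C * \int[leb]_(x in simplex K) (weight K x * p x) ^+ 2.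
Proof.
have [C C0 HC] := @reference_weight R n l; exists C => // K p ndK pp.
have [c c0 Hc] := Rintegral_simplex_sqr ndK; have [m pw] := polyfun_weight K.
rewrite (Hc _ _ pp) (Hc _ _ (polyfunM pw pp)) mulrCA ler_wpM2l//; first exact: ltW.
under [X in _ <= C * X]eq_Rintegral do rewrite weight_aff//.
exact: HC (polyfun_aff K pp).
Qed.

Lemma diam_bgrad (kappa : R) K i j : nondegenerate K ->
  diam (simplex K) <= kappa * indiam (simplex K) ->
  diam (simplex K) * `|bgrad K i ord0 j| <= kappa.
Proof.
move=> ndK reg; have D0 := diam_gt0 ndK.
have k0 : 0 <= kappa.
  rewrite leNgt; apply/negP => k0; move: (lt_le_trans D0 reg); apply/negP; rewrite -leNgt.
  by rewrite mulr_le0_ge0// ?(ltW k0)// indiam_ge0.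
apply: le_trans (ler_wpM2r (normr_ge0 _) reg) _.
by rewrite -mulrA -[leRHS]mulr1 ler_wpM2l// mulrC bgrad_indiam.
Qed.

(** An inverse inequality, where shape regularity bounds the gradients of the
barycentric coordinates. *)
Lemma scaled_inverse l : exists2 C : R, 0 <= C & forall (kappa : R) K (p : pt -> R),
  nondegenerate K -> diam (simplex K) <= kappa * indiam (simplex K) -> polyfun l p ->
  diam (simplex K) ^+ 2 *
    \sum_i \int[leb]_(x in simplex K) pderiv i (fun x => weight K x * p x) x ^+ 2 <=
  C * kappa ^+ 2 * \int[leb]_(x in simplex K) p x ^+ 2.
Proof.
have [C C0 HC] := @reference_inverse R n l; exists ((d * d)%:R * C); first by rewrite mulr_ge0.
move=> kappa K p ndK reg pp; have D0 := diam_gt0 ndK.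
have [c c0 Hc] := Rintegral_simplex_sqr ndK; have [m pw] := polyfun_weight K.
set f := fun x => weight K x * p x; have pf : polyfun (m + l) f by exact: polyfunM.
rewrite (Hc _ _ pp).
have dg i := polyfun_pderiv i pf.
have -> : \sum_i \int[leb]_(x in simplex K) pderiv i f x ^+ 2 =
    c * \sum_i \int[leb]_(y in U) pderiv i f (aff K y) ^+ 2.
  by rewrite mulr_sumr; apply: eq_bigr => i _; exact: Hc (dg i).
rewrite !(mulrCA _ c) ler_wpM2l ?(ltW c0)//.
set D := diam _ in D0 reg *.
have pfa := polyfun_aff K pf.
have faE : f \o aff K = fun y => weight unit_cell y * (p \o aff K) y.
  by apply/funext => y; rewrite /f /= weight_aff.
apply: (@le_trans _ _ (D ^+ 2 * ((d * d)%:R * (kappa / D) ^+ 2 *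
    \sum_i \int[leb]_(y in U) pderiv i (f \o aff K) y ^+ 2))).
  rewrite ler_wpM2l ?sqr_ge0//.
  apply: (@le_sum_integral_mulmx _ (m + l).-1 (invmx (edges K))).
  - exact: measurable_unit_simplex.
  - by move=> m' f'; exact: polyfun_integrable_unit.
  - by move=> i j; rewrite invmx_edges// ler_pdivlMr// mulrC; exact: diam_bgrad.
  - by move=> i; exact: polyfun_pderiv pfa.
  - move=> j y _; have fE : (fun x => (f \o aff K) (- row ord0 K *m invmx (edges K) +
        x *m invmx (edges K))) = f.
      by apply/funext => x; rewrite -affinvE /= affinvK.
    have := @pderiv_affine R d d (f \o aff K) (- row ord0 K *m invmx (edges K))
      (invmx (edges K)) j (aff K y) (polyfun_differentiable _ pfa).
    by rewrite fE -affinvE (affK ndK).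
have := HC _ (polyfun_aff K pp); rewrite -faE => H.
have -> : forall S, D ^+ 2 * ((d * d)%:R * (kappa / D) ^+ 2 * S) = (d * d)%:R * kappa ^+ 2 * S.
  by move=> S; field; rewrite gt_eqF.
apply: le_trans (ler_wpM2l _ H) _; first by rewrite mulr_ge0// sqr_ge0.
by rewrite le_eqVlt; apply/orP; left; apply/eqP; ring.
Qed.

(** The Piola transformation carries the right inverse of the divergence from
the unit simplex to any simplex; the scaling gains a power of the diameter. *)
Lemma scaled_divergence l : exists2 C : R, 0 <= C & forall K (w : pt -> pt),
  nondegenerate K -> (forall i, polyfun l (comp w i)) -> noflux K w ->
  exists w', [/\ forall i, polyfun l (comp w' i), noflux K w',
    forall x, simplex K x -> pdiv w' x = pdiv w x &
    \sum_i \int[leb]_(x in simplex K) comp w' i x ^+ 2 <=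
      C * diam (simplex K) ^+ 2 * \int[leb]_(x in simplex K) pdiv w x ^+ 2].
Proof.
have [C C0 HC] := @reference_divergence R n l; exists ((d * d)%:R * C); first by rewrite mulr_ge0.
move=> K w ndK pw nfw; set E := edges K.
have mulE : invmx E *m E = 1%:M by exact: mulVmx.
have mulE' : E *m invmx E = 1%:M by exact: mulmxV.
pose v y := w (aff K y) *m invmx E.
have pv i : polyfun l (comp v i).
  rewrite (_ : comp v i = fun y => \sum_j invmx E j i * (comp w j \o aff K) y).
    by apply: polyfun_sum => j _; apply: polyfunZ; exact: polyfun_aff.
  by apply/funext => y; rewrite /comp mxE; apply: eq_bigr => j _; rewrite mulrC.
have nfv : noflux unit_cell v.
  move=> i y Uy yi; rewrite /v -(dot_edges_bgrad _ _ ndK) -mulmxA mulE mulmx1; apply: nfw.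
    by apply/(simplex_aff ndK)/simplex_unit_cell.
  by rewrite bary_aff_unit.
have [v' [pv' nfv' divv' bv']] := HC v pv nfv.
pose w' x := v' (affinv K x) *m E.
have divv y : pdiv v y = pdiv w (aff K y) by exact: pdiv_affine pw.
have divw' x : pdiv w' x = pdiv v' (affinv K x).
  rewrite affinvE -(pdiv_affine _ _ mulE' pv'); congr (pdiv _ x).
  by apply/funext => z; rewrite /w' affinvE.
have pw' i : polyfun l (comp w' i).
  rewrite (_ : comp w' i = fun y => \sum_j E j i * (comp v' j \o affinv K) y).
    by apply: polyfun_sum => j _; apply: polyfunZ; exact: polyfun_affinv.
  by apply/funext => y; rewrite /comp mxE; apply: eq_bigr => j _; rewrite mulrC.
exists w'; split; first exact: pw'.
- move=> i x Kx xi; rewrite dot_edges_bgrad//; apply: nfv'.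
    by apply/simplex_unit_cell; exact: affinv_unit.
  by rewrite -(bary_aff_unit _ _ ndK) affinvK.
- move=> x Kx; rewrite divw' divv' ?divv ?affinvK//.
  exact: affinv_unit.
- have [c c0 Hc] := Rintegral_simplex_sqr ndK.
  have -> : \sum_i \int[leb]_(x in simplex K) comp w' i x ^+ 2 =
      c * \sum_i \int[leb]_(y in U) comp w' i (aff K y) ^+ 2.
    by rewrite mulr_sumr; apply: eq_bigr => i _; exact: Hc (pw' i).
  have pdw : polyfun l (pdiv w).
    apply: polyfun_sum => i _; apply: polyfun_leq (polyfun_pderiv i (pw i)); exact: leq_pred.
  rewrite (Hc l (pdiv w) pdw) [leRHS]mulrCA; apply: ler_wpM2l; first exact: ltW.
  apply: (@le_trans _ _ ((d * d)%:R * diam (simplex K) ^+ 2 *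
      \sum_i \int[leb]_(y in U) comp v' i y ^+ 2)).
    apply: (@le_sum_integral_mulmx _ l E^T).
    + exact: measurable_unit_simplex.
    + by move=> m' f'; exact: polyfun_integrable_unit.
    + by move=> i j; rewrite mxE; exact: edges_le_diam.
    + by [].
    + move=> j y _; rewrite /comp /w' affK// mxE; apply: eq_bigr => i _.
      by rewrite [E^T _ _]mxE mulrC.
  have := ler_wpM2l (mulr_ge0 (ler0n _ (d * d)) (sqr_ge0 (diam (simplex K)))) bv'.
  move=> /le_trans; apply; under eq_Rintegral do rewrite divv.
  by rewrite le_eqVlt; apply/orP; left; apply/eqP; ring.
Qed.

End affine_transfer.

(** * Integration by parts on a simplex *)

Section cutoff.
Context {R : realType}.

(** Applied to the barycentric coordinates, it extends the weight of a simplex by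
zero to a continuously differentiable function. *)
Definition sqr_pos (t : R) : R := Num.max t 0 ^+ 2.

Lemma is_derive_sqr_pos (t : R) : is_derive t (1 : R) sqr_pos (2 * Num.max t 0).
Proof.
apply: (@is_derive_quadratic _ _ _ _ 1) => h _; rewrite /sqr_pos mul1r ler_norml.
by have [t0|t0] := leP t 0; have [h0|h0] := leP (t + h) 0; apply/andP; split; nra.
Qed.

(** The factor 1 - y cancels the geometric sum 1 + y + ... + y^m, whose m + 1 terms
are at least y^m. *)
Lemma natr_exp_le (y : R) m : 0 <= y <= 1 -> m.+1%:R * y ^+ m * (1 - y) <= 1.
Proof.
move=> /andP[y0 y1].
have -> : m.+1%:R * y ^+ m = \sum_(k < m.+1) y ^+ m by rewrite sumr_const card_ord mulr_natl.
apply: (@le_trans _ _ ((\sum_(k < m.+1) y ^+ k) * (1 - y))).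
  rewrite ler_wpM2r ?subr_ge0//; apply: ler_sum => k _.
  by rewrite ler_wiXn2l//; rewrite -ltnS.
rewrite mulrC -opprB mulNr -subrX1 opprB lerBlDr lerDl exprn_ge0//.
Qed.

(** For y the square root of x, the factors (m + 1) y^m are bounded by 1 / (1 - y). *)
Lemma cvg_natr_exp (x : R) : 0 <= x < 1 -> m.+1%:R * x ^+ m @[m --> \oo] --> (0 : R).
Proof.
move=> /andP[x0 x1]; pose y := Num.sqrt x.
have y0 : 0 <= y := sqrtr_ge0 x.
have y1 : y < 1 by rewrite -sqrtr1 ltr_sqrt.
have xE : x = y * y by rewrite -expr2 sqr_sqrtr.
have ym : (fun m => (1 - y)^-1 * y ^+ m) @ \oo --> (0 : R).
  rewrite -[X in _ --> X](mulr0 (1 - y)^-1); apply: cvgMr.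
  by apply: cvg_expr; rewrite ger0_norm.
apply: (@squeeze_cvgr _ _ _ _ (cst 0) (fun m => (1 - y)^-1 * y ^+ m)) => //; last exact: cvg_cst.
apply: nearW => m; rewrite mulr_ge0 ?exprn_ge0//= xE exprMn mulrA ler_wpM2r ?exprn_ge0//.
rewrite -[leRHS]mul1r ler_pdivlMr ?subr_gt0//.
by apply: natr_exp_le; rewrite y0 ltW.
Qed.

End cutoff.

Section simplex_integration_by_parts.
Context {R : realType} {n : nat}.
Local Notation d := n.+1.
Local Notation pt := 'rV[R]_d.
Local Notation leb := (@lebesgue_rV R d).
Variable K : 'M[R]_(d.+1, d).
Hypothesis ndK : nondegenerate K.

Lemma pderiv_open_eq (O : set pt) (f g : pt -> R) i x : open O -> O x ->
  (forall y, O y -> f y = g y) -> pderiv i f x = pderiv i g x.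
Proof.
move=> oO Ox fg; apply: near_eq_derive; near=> y; apply: fg.
by near: y; apply: open_nbhs_nbhs; split.
Unshelve. all: by end_near. Qed.

(** Extended by zero, weight K * f is continuously differentiable on the whole
space, and derivatives of such functions have integral zero. *)
Lemma integral_pderiv_weight (f : pt -> R) i : C1 f ->
  \int[leb]_(x in simplex K) pderiv i (fun x => weight K x * f x) x = 0.
Proof.
move=> Cf; pose P (x : pt) := \prod_j sqr_pos (bary K j x); pose G x := P x * f x.
have CG : C1 G.
  apply: C1M => //; apply: (@C1_prod _ _ _ _ (fun j => sqr_pos \o bary K j)) => j.
  apply: (C1_comp1 is_derive_sqr_pos); last exact: polyfun_C1 (polyfun_bary K j).
  move=> t; apply: cvgM; first exact: cvg_cst.
  by apply: (@continuous_max _ _ id (cst 0)); [exact: cvg_id|exact: cvg_cst].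
have P0 x : ~ simplex K x -> P x = 0.
  move=> nKx; have [j xj] : exists j, bary K j x < 0.
    apply: contrapT => H; apply: nKx; apply/(simplex_baryP ndK) => j.
    by rewrite leNgt; apply/negP => xj; apply: H; exists j.
  rewrite /P (bigD1 j)//= /sqr_pos (_ : Num.max _ 0 = 0) ?expr0n ?mul0r//.
  by apply/max_idPr; exact: ltW.
have [r Kr] := simplex_cube K.
have G0 x : ~ cube r x -> G x = 0.
  by move=> xr; rewrite /G P0 ?mul0r// => /Kr.
rewrite -[RHS](integral_pderiv_eq0 i CG G0).
apply: ae_eq_Rintegral; apply: filterS (ae_osimplex ndK) => x Hx; rewrite !patchE mem_setT.
case: ifPn => [/set_mem/Hx ox|/negP xK].
  have := @pderiv_open_eq (osimplex K) (fun x => weight K x * f x) G i x (@open_osimplex _ _ K) ox.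
  apply => y oy.
  rewrite /G /weight /P; congr (_ * _); apply: eq_bigr => j _.
  by rewrite /sqr_pos (max_idPl (ltW (oy j))).
have nK : ~ simplex K x by move=> H; apply: xK; rewrite inE.
rewrite (@pderiv_open_eq (~` simplex K) G (fun=> 0))//; first by rewrite pderiv_cst.
  by apply: closed_openC; exact: closed_simplex.
by move=> y Ky; rewrite /G P0 ?mul0r.
Qed.

Lemma pderiv_bary i j : pderiv i (bary K j) = fun=> bgrad K j ord0 i.
Proof.
apply/funext => x.
have -> : bary K j = fun x : pt => invmx (homog K) ord0 j + \sum_k bgrad K j ord0 k * x ord0 k.
  by apply/funext => y; rewrite /bary; congr (_ + _); apply: eq_bigr => k _; rewrite mulrC.
have dc (k : 'I_d) (y : pt) : differentiable (fun y : pt => y ord0 k) y by exact: differentiable_rV_coord.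
have ds (y : pt) : differentiable (fun y : pt => \sum_k bgrad K j ord0 k * y ord0 k) y.
  apply: (@polyfun_differentiable _ _ 1); apply: polyfun_sum => k _; apply: polyfunZ.
  exact: polyfun_coord.
rewrite pderivD// pderiv_cst add0r pderiv_lincomb// (bigD1 i)//= pderiv_coord eqxx mulr1.
rewrite big1 ?addr0// => k ki; rewrite pderiv_coord.
by rewrite eq_sym (negbTE ki) mulr0.
Qed.

Lemma polyfun_exp l (f : pt -> R) m : polyfun l f -> polyfun (l * m) (fun x => f x ^+ m).
Proof.
move=> pf; elim: m => [|m ih]; first by rewrite muln0; exact: polyfun_cst.
rewrite mulnS (_ : (fun=> _) = fun x => f x * f x ^+ m); first exact: polyfunM.
by apply/funext => x; rewrite exprS.
Qed.

Lemma pderiv_exp l (f : pt -> R) m i x : polyfun l f ->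
  pderiv i (fun x => f x ^+ m.+1) x = m.+1%:R * f x ^+ m * pderiv i f x.
Proof.
move=> pf; elim: m => [|m ih].
  rewrite expr0 !mul1r; congr (pderiv i _ x); apply/funext => y; exact: expr1.
rewrite (_ : (fun=> _) = fun x => f x * f x ^+ m.+1); last first.
  by apply/funext => y; rewrite exprS.
rewrite pderivM; [|exact: polyfun_differentiable pf|exact: polyfun_differentiable (polyfun_exp _ pf)].
by rewrite ih -[m.+2%:R]natr1 exprS; ring.
Qed.

(** Move from x in the direction of an edge until the facet is reached, and apply
the mean value theorem. *)
Lemma facet_bound l (f : pt -> R) j : polyfun l f ->
  (forall x, simplex K x -> bary K j x = 0 -> f x = 0) ->
  exists L : R, 0 <= L /\ forall x, simplex K x -> `|f x| <= L * bary K j x.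
Proof.
move=> pf f0; pose v := row (lift j ord0) K - row j K.
have pD : polyfun l.-1 (fun x => \sum_i v ord0 i * pderiv i f x).
  by apply: polyfun_sum => i _; apply: polyfunZ; exact: polyfun_pderiv.
have [r Kr] := simplex_cube K.
have [L [L0 HL]] := continuous_cube_bounded (r + enorm v) (polyfun_continuous pD).
exists L; split => // x Kx; set t := bary K j x.
have t0 : 0 <= t by move: Kx => /(simplex_baryP ndK); exact.
have t1 : t <= 1 by exact: bary_le1.
have vj i : dot v (bgrad K i) = (i == lift j ord0)%:R - (i == j)%:R by exact: dot_vertices_bgrad.
have y0 : f (x + t *: v) = 0.
  apply: f0; last by rewrite baryDZ vj eqxx (negbTE (neq_lift _ _)) sub0r mulrN1 subrr.
  apply/(simplex_baryP ndK) => i; rewrite baryDZ vj.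
  have [->|ij] := eqVneq i j; first by rewrite (negbTE (neq_lift _ _)) sub0r mulrN1 subrr.
  rewrite subr0 addr_ge0 ?mulr_ge0 ?ler0n//.
  by move: Kx => /(simplex_baryP ndK); exact.
have df y := polyfun_differentiable y pf.
have [s st] := line_MVT x v t df; rewrite y0 sub0r => fE.
rewrite -normrN fE normrM ger0_norm// mulrC ler_wpM2r//.
rewrite derive_pderiv//; apply: HL => i; rewrite mxE (le_trans (ler_normD _ _))// lerD ?Kr//.
rewrite mxE normrM -[leRHS]mul1r ler_pM//; last exact: normr_le_enorm.
by apply: le_trans st _; rewrite ger0_norm.
Qed.

Lemma noflux_bound l (w : pt -> pt) : (forall i, polyfun l (comp w i)) -> noflux K w ->
  exists L : R, 0 <= L /\ forall j x, simplex K x -> `|dot (w x) (bgrad K j)| <= L * bary K j x.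
Proof.
move=> pw nfw.
have /choice[L HL] : forall j, exists L : R, 0 <= L /\ forall x, simplex K x ->
    `|dot (w x) (bgrad K j)| <= L * bary K j x.
  move=> j; apply: (@facet_bound l (fun x => dot (w x) (bgrad K j))).
    rewrite (_ : (fun=> _) = fun x => \sum_i bgrad K j ord0 i * comp w i x).
      by apply: polyfun_sum => i _; exact: polyfunZ.
    by apply/funext => x; apply: eq_bigr => i _; rewrite mulrC.
  exact: nfw.
exists (\sum_j L j); split; first by apply: sumr_ge0 => j _; have [] := HL j.
move=> j x Kx; have [_ H] := HL j; apply: le_trans (H x Kx) _.
rewrite ler_wpM2r//; first by move: Kx => /(simplex_baryP ndK); exact.
rewrite (bigD1 j)//= lerDl; apply: sumr_ge0 => i _; by have [] := HL i.
Qed.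

(** By the product rule: the derivative along w of each squared barycentric
coordinate is at most a multiple of this square. *)
Lemma noflux_weight l (w : pt -> pt) : (forall i, polyfun l (comp w i)) -> noflux K w ->
  exists L : R, 0 <= L /\ forall x, simplex K x ->
    `|\sum_i comp w i x * pderiv i (weight K) x| <= L * weight K x.
Proof.
move=> pw nfw; have [L [L0 HL]] := noflux_bound pw nfw.
exists ((2 * L) *+ size (index_enum 'I_d.+1)); split.
  by rewrite mulrn_wge0// mulr_ge0.
move=> x Kx; have b0 j : 0 <= bary K j x by move: Kx => /(simplex_baryP ndK); exact.
have pb j := polyfun_bary K j.
rewrite /weight; elim: (index_enum 'I_d.+1) => [|j r ih].
  rewrite big_nil mulr0n mul0r normr_le0 big1// => i _.
  rewrite (_ : (fun=> _) = fun=> 1); first by rewrite pderiv_cst mulr0.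
  by apply/funext => y; rewrite big_nil.
have [m /(_ K) pr] := @bary_prod_degree R n r.
set P := fun x => \prod_(j <- r) _ in ih pr *.
have PE : (fun x => \prod_(k <- j :: r) bary K k x ^+ 2) = fun x => bary K j x ^+ 2 * P x.
  by apply/funext => y; rewrite big_cons.
rewrite PE big_cons -/(P x).
have dP := polyfun_differentiable x pr.
have db := polyfun_differentiable x (polyfun_exp 2 (pb j)).
have -> : \sum_i comp w i x * pderiv i (fun x => bary K j x ^+ 2 * P x) x =
    bary K j x ^+ 2 * (\sum_i comp w i x * pderiv i P x) +
    P x * (2 * bary K j x * dot (w x) (bgrad K j)).
  rewrite /dot !mulr_sumr -big_split; apply: eq_bigr => i _ /=.
  rewrite pderivM// (pderiv_exp _ _ _ (pb j)) pderiv_bary expr1 /comp; ring.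
have P0 : 0 <= P x by apply: prodr_ge0 => k _; exact: sqr_ge0.
apply: le_trans (ler_normD _ _) _; rewrite [size _]/= [_ *+ (size r).+1]mulrSr [leRHS]mulrDl.
apply: lerD.
  rewrite normrM (ger0_norm (sqr_ge0 _)) mulrCA ler_wpM2l ?sqr_ge0//.
rewrite normrM (ger0_norm P0) [leRHS]mulrA [leRHS]mulrC ler_wpM2l//.
rewrite normrM ger0_norm ?mulr_ge0//.
have -> : 2 * L * bary K j x ^+ 2 = 2 * bary K j x * (L * bary K j x) by ring.
by rewrite ler_wpM2l ?mulr_ge0// HL.
Qed.

(** The divergence theorem for a polynomial field without flux, by means of the
cutoffs 1 - (1 - weight K)^m: the absence of flux bounds the field times their
gradients. *)
Lemma integral_noflux l (w : pt -> pt) : (forall i, polyfun l (comp w i)) ->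
  noflux K w -> \int[leb]_(x in simplex K) pdiv w x = 0.
Proof.
move=> pw nfw; have [L [L0 HL]] := noflux_weight pw nfw.
have [l' pW] := polyfun_weight K; set W := weight K in HL pW *.
pose V x := 1 - W x.
have pV : polyfun l' V by apply: polyfunB => //; exact: polyfun_cst.
pose Q m x := \sum_(k < m.+1) V x ^+ k.
have FE m x : W x * Q m x = 1 - V x ^+ m.+1.
  have := subrX1 (V x) m.+1; rewrite -/(Q m x) => H.
  by rewrite -[1 - _]opprB H -mulNr opprB /V; congr (_ * _); ring.
pose A x := \sum_i comp w i x * pderiv i W x.
pose h m x := (1 - V x ^+ m.+1) * pdiv w x + m.+1%:R * V x ^+ m * A x.
have pQ m : polyfun (l' * m) (Q m).
  apply: polyfun_sum => k _; apply: polyfun_leq (polyfun_exp k pV).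
  by rewrite leq_mul2l -ltnS ltn_ord orbT.
have pd : polyfun l (pdiv w).
  by apply: polyfun_sum => i _; apply: polyfun_leq (polyfun_pderiv i (pw i)); exact: leq_pred.
have pA : polyfun (l + l') A.
  apply: polyfun_sum => i _; apply: polyfunM => //.
  by apply: polyfun_leq (polyfun_pderiv i pW); exact: leq_pred.
have ch m : continuous (h m).
  apply: (@polyfun_continuous _ _ (l' * m.+1 + l + (l' * m + (l + l')))); apply: polyfunD.
    apply: polyfun_leq (polyfunM (polyfunB (polyfun_cst _ 1) (polyfun_exp m.+1 pV)) pd).
    exact: leq_addr.
  apply: polyfun_leq (polyfunM (polyfunZ m.+1%:R (polyfun_exp m pV)) pA).
  exact: leq_addl.
have mK := measurable_simplex ndK.
have hE m x : \sum_i pderiv i (fun x => W x * (Q m x * comp w i x)) x = h m x.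
  rewrite /h /pdiv /A !mulr_sumr -big_split; apply: eq_bigr => i _ /=.
  rewrite (_ : (fun=> _) = fun x => (1 - V x ^+ m.+1) * comp w i x); last first.
    by apply/funext => y; rewrite mulrA FE.
  have pF : polyfun (l' * m.+1) (fun x => 1 - V x ^+ m.+1).
    by apply: polyfunB; [exact: polyfun_cst|exact: polyfun_exp].
  rewrite pderivM; [|exact: polyfun_differentiable pF|exact: polyfun_differentiable (pw i)].
  congr (_ + _); rewrite [RHS]mulrCA; congr (_ * _).
  have -> : (fun x => 1 - V x ^+ m.+1) = fun x => 1 + (-1) * V x ^+ m.+1.
    by apply/funext => y; rewrite mulN1r.
  have pVm := polyfun_exp m.+1 pV.
  rewrite pderivD; [|exact: differentiable_cst|exact: polyfun_differentiable (polyfunZ _ pVm)].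
  rewrite pderiv_cst add0r pderivZ; last exact: polyfun_differentiable pVm.
  rewrite (pderiv_exp _ _ _ pV) /V.
  have -> : (fun x => 1 - W x) = fun x => 1 + (-1) * W x.
    by apply/funext => y; rewrite mulN1r.
  rewrite pderivD; [|exact: differentiable_cst|exact: polyfun_differentiable (polyfunZ _ pW)].
  rewrite pderiv_cst add0r pderivZ; last exact: polyfun_differentiable pW.
  by rewrite /=; ring.
have h0 m : \int[leb]_(x in simplex K) h m x = 0.
  under eq_Rintegral do rewrite -hE.
  have pQw i := polyfunM (pQ m) (pw i).
  rewrite (@Rintegral_sum _ _ R leb _ mK _ _ (fun i => pderiv i (fun x => W x * (Q m x * comp w i x)))).
    by rewrite big1// => i _; apply: integral_pderiv_weight; exact: polyfun_C1 (pQw i).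
  by move=> i; exact: polyfun_integrable_simplex (polyfun_pderiv i (polyfunM pW (pQw i))).
have [D [D0 HD]] := simplex_bounded K (polyfun_continuous pd).
have W01 x : simplex K x -> 0 <= W x <= 1 by exact: weight_itv.
have V01 x : simplex K x -> 0 <= V x <= 1.
  by move=> /W01 /andP[? ?]; rewrite /V; apply/andP; split; lra.
have bh m x : simplex K x -> `|h m x| <= D + L.
  move=> Kx; have /andP[w0 w1] := W01 _ Kx; have /andP[v0 v1] := V01 _ Kx.
  apply: le_trans (ler_normD _ _) _; rewrite lerD//.
    rewrite normrM -[leRHS]mul1r ler_pM ?HD// ger0_norm ?subr_ge0 ?exprn_ile1//.
    by rewrite lerBlDr lerDl exprn_ge0.
  have c0 : 0 <= m.+1%:R * V x ^+ m by rewrite mulr_ge0 ?exprn_ge0.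
  rewrite normrM (ger0_norm c0); apply: le_trans (ler_wpM2l c0 (HL _ Kx)) _.
  rewrite mulrCA -[leRHS]mulr1 ler_wpM2l//.
  have -> : W x = 1 - V x by rewrite /V; ring.
  by apply: natr_exp_le; exact: V01.
have cvh : {ae leb, forall x, simplex K x -> h ^~ x @ \oo --> pdiv w x}.
  apply: filterS (ae_osimplex ndK) => x H Kx; have w0 := weight_gt0 (H Kx).
  have /andP[_ w1] := W01 _ Kx; have /andP[v0 v1] := V01 _ Kx.
  have v1' : V x < 1 by rewrite /V ltrBlDr ltrDl.
  have c1 : (fun m => (1 - V x ^+ m.+1) * pdiv w x) @ \oo --> (1 - 0) * pdiv w x.
    apply: cvgMl; apply: cvgB; first exact: cvg_cst.
    rewrite (_ : (fun m => V x ^+ m.+1) = fun m => V x * V x ^+ m); last first.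
      by apply/funext => m; rewrite exprS.
    by rewrite -(mulr0 (V x)); apply: cvgMr; apply: cvg_expr; rewrite ger0_norm.
  have c2 : (fun m => m.+1%:R * V x ^+ m * A x) @ \oo --> 0 * A x.
    by apply: cvgMl; apply: cvg_natr_exp; rewrite v0.
  have := cvgD c1 c2; rewrite subr0 mul1r mul0r addr0; exact.
have mh m : measurable_fun (simplex K) (h m).
  by apply: measurable_funS (continuous_rV_measurable (ch m)).
have md : measurable_fun (simplex K) (pdiv w).
  by apply: measurable_funS (continuous_rV_measurable (polyfun_continuous pd)).
have iDL := integrable_simplex ndK (@polyfun_continuous _ _ 0 _ (polyfun_cst 0 (D + L))).
have := Rintegral_dominated_cvg mK mh md iDL bh cvh.
rewrite (_ : (fun m => _) = cst 0); last by apply/funext => m; exact: h0.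
by move=> /(cvg_unique (@Rhausdorff R) (cvg_cst 0)) <-.
Qed.

End simplex_integration_by_parts.

(** * The weak divergence of piecewise polynomial fields *)

Section weak_divergence.
Context {R : realType} {n : nat}.
Local Notation d := n.+1.
Local Notation pt := 'rV[R]_d.
Local Notation leb := (@lebesgue_rV R d).
Implicit Types (K : 'M[R]_(d.+1, d)) (Omega : set pt) (phi g : pt -> R) (tau w : pt -> pt).

Lemma test_function_support Omega phi : test_function Omega phi ->
  exists r : R, forall x, ~ cube r x \/ ~ Omega x -> phi x = 0 /\ grad phi x = 0.
Proof.
move=> [sphi [S [cS SO phi0]]]; have [r Sr] := compact_cube_bound cS; exists r.
move=> x Hx; have nS : ~ S x by case: Hx => H Sx; apply: H; [exact: Sr|exact: SO].
split; first exact: phi0.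
apply/rowP => i; rewrite !mxE.
have oS : open (~` S) by apply: closed_openC; apply: compact_closed => //; exact: norm_hausdorff.
by rewrite (@pderiv_open_eq _ _ (~` S) phi (fun=> 0) i x oS nS phi0) pderiv_cst.
Qed.

Lemma test_function_L2 Omega phi : open Omega -> test_function Omega phi -> L2 Omega phi.
Proof.
move=> oO tphi; have mO := open_rV_measurable oO.
have cphi : continuous phi by apply: C1_continuous; apply: smooth_C1; have [] := tphi.
have [r Hr] := test_function_support tphi.
have cpp : continuous (fun x => phi x * phi x) by exact: continuous_mulf.
have [L [L0 HL]] := continuous_cube_bounded r cpp.
apply/(L2P _ mO); split; first exact: measurable_funS (continuous_rV_measurable cphi).
apply: (@integrableS _ _ _ _ setT) => //.
apply: (@integrable_bounded_support _ _ _ L r) => //; first exact: continuous_rV_measurable.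
by move=> x xr; have [-> _] := Hr x (or_introl xr); rewrite mul0r.
Qed.

Lemma Hdiv_div Omega tau : Hdiv Omega tau ->
  L2 Omega (div Omega tau) /\ is_div Omega tau (div Omega tau).
Proof.
move=> [_ [g Lg dg]].
by have := @xgetPex _ (fun=> 0) [set g | L2 Omega g /\ is_div Omega tau g]; apply; exists g.
Qed.

Lemma ae_div_unique Omega tau g : open Omega -> Hdiv Omega tau -> L2 Omega g ->
  is_div Omega tau g -> {ae leb, forall x, Omega x -> div Omega tau x = g x}.
Proof.
move=> oO Ht Lg dg; have mO := open_rV_measurable oO; have [Ld dd] := Hdiv_div Ht.
have := @fundamental_lemma R n Omega (fun x => div Omega tau x - g x) oO (L2B mO Ld Lg).
move=> H; have {H} : {ae leb, forall x, Omega x -> div Omega tau x - g x = 0}.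
  apply: H => phi tphi; have Lp := test_function_L2 oO tphi.
  rewrite /ip; under eq_Rintegral do rewrite mulrBl.
  rewrite RintegralB//; [|exact: L2_integrableM Ld Lp|exact: L2_integrableM Lg Lp].
  have := dd _ tphi; rewrite (dg _ tphi) => /oppr_inj /eqP.
  by rewrite eq_sym -subr_eq0 => /eqP.
by apply: filterS => x H /H /eqP; rewrite subr_eq0 => /eqP.
Qed.

(** A test function of the interior of a cell sees only the polynomial that
represents the field on this cell. *)
Lemma ae_div_poly Omega l tau p K : open Omega -> nondegenerate K ->
  osimplex K `<=` Omega -> Hdiv Omega tau -> (forall i, polyfun l (comp p i)) ->
  {ae leb, forall x, simplex K x -> tau x = p x} ->
  {ae leb, forall x, simplex K x -> div Omega tau x = pdiv p x}.
Proof.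
move=> oO ndK KO Ht pp taup; have [Ld dd] := Hdiv_div Ht.
have mO := open_rV_measurable oO; have oK := @open_osimplex _ _ K.
have mK := measurable_simplex ndK.
have poK := measurable_osimplex K.
have pd : polyfun l (pdiv p).
  by apply: polyfun_sum => i _; apply: polyfun_leq (polyfun_pderiv i (pp i)); exact: leq_pred.
have Lp : L2 (osimplex K) (pdiv p).
  by apply: L2S (L2_simplex ndK (polyfun_continuous pd)) => //; exact: osimplex_sub.
have Lg : L2 (osimplex K) (div Omega tau) by apply: L2S Ld.
suff : {ae leb, forall x, osimplex K x -> div Omega tau x - pdiv p x = 0}.
  move=> H; apply: filterS2 (ae_osimplex ndK) H => x Kx H /Kx /H /eqP.
  by rewrite subr_eq0 => /eqP.
apply: fundamental_lemma => //; first exact: L2B.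
move=> phi tphi; have Lphi := test_function_L2 oK tphi.
have tO : test_function Omega phi.
  have [sphi [S [cS SK phi0]]] := tphi; split => //; exists S; split => //.
  exact: subset_trans KO.
have [r Hr] := test_function_support tphi.
have Cphi : C1 phi by apply: smooth_C1; have [] := tphi.
have cphi := C1_continuous Cphi.
rewrite /ip; under eq_Rintegral do rewrite mulrBl.
rewrite RintegralB//; [|exact: L2_integrableM Lg Lphi|exact: L2_integrableM Lp Lphi].
have gE : \int[leb]_(x in osimplex K) (div Omega tau x * phi x) = ip Omega (div Omega tau) phi.
  apply: ae_eq_Rintegral; apply: aeW => x; rewrite !patchE.
  case: ifPn => [/set_mem/KO xO|/negP nK]; first by rewrite mem_set.
  case: ifP => // _; have [|-> _] := Hr x; last by rewrite mulr0.
  by right => xK; apply: nK; rewrite inE.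
have tE : vip Omega tau (grad phi) =
    \int[leb]_(x in simplex K) \sum_i comp p i x * pderiv i phi x.
  apply: ae_eq_Rintegral; apply: filterS2 (ae_osimplex ndK) taup => x Kx tx; rewrite !patchE.
  case: (boolP (x \in simplex K)) => [/set_mem sx|/negP nK].
    rewrite mem_set; last exact/KO/Kx.
    by rewrite tx//; apply: eq_bigr => i _; rewrite mxE.
  case: ifP => // _; have [|_ ->] := Hr x.
    by right => xK; apply: nK; rewrite inE; exact: osimplex_sub.
  by rewrite dotC /dot big1// => i _; rewrite mxE mul0r.
have cM i : C1 (fun x => comp p i x * phi x) by apply: C1M => //; exact: polyfun_C1 (pp i).
have z i : \int[leb]_(x in simplex K) pderiv i (fun x => comp p i x * phi x) x = 0.
  rewrite -[RHS](@integral_pderiv_eq0 R n i (fun x => comp p i x * phi x) r (cM i)).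
    apply: ae_eq_Rintegral; apply: filterS (ae_osimplex ndK) => x Kx; rewrite !patchE mem_setT.
    case: ifPn => // /negP nK; have [|p0 g0] := Hr x.
      by right => xK; apply: nK; rewrite inE; exact: osimplex_sub.
    have [dphi _] := Cphi.
    rewrite pderivM//; last exact: polyfun_differentiable (pp i).
    by have := congr1 (fun v : pt => v ord0 i) g0; rewrite /grad !mxE p0 => ->; rewrite mulr0 mul0r addr0.
  by move=> x xr; have [-> _] := Hr x (or_introl xr); rewrite mulr0.
have ci i : continuous (fun x => comp p i x * pderiv i phi x).
  by have [_ H] := Cphi; apply: continuous_mulf (H i); exact: polyfun_continuous (pp i).
have cd : continuous (fun x => pdiv p x * phi x).
  by apply: continuous_mulf cphi; exact: polyfun_continuous pd.
have S0 : \int[leb]_(x in simplex K) (\sum_i comp p i x * pderiv i phi x) +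
    \int[leb]_(x in simplex K) (pdiv p x * phi x) = 0.
  rewrite -RintegralD//; last 2 first.
  - by apply: integrable_sumR => // i; exact: integrable_simplex.
  - exact: integrable_simplex.
  transitivity (\int[leb]_(x in simplex K) \sum_i pderiv i (fun x => comp p i x * phi x) x).
    apply: eq_Rintegral => x _; rewrite mulr_suml -big_split; apply: eq_bigr => i _ /=.
    have [dphi _] := Cphi; rewrite pderivM//; last exact: polyfun_differentiable (pp i).
    by rewrite [phi x * _]mulrC.
  rewrite (@Rintegral_sum _ _ R leb _ mK _ _ (fun i => pderiv i (fun x => comp p i x * phi x))).
    by rewrite big1.
  by move=> i; apply: integrable_simplex => //; have [_ H] := cM i; exact: H.
have := dd _ tO; rewrite tE -gE => H; rewrite H in S0.
rewrite -(Rintegral_osimplex ndK (fun x => pdiv p x * phi x)).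
by apply/eqP; rewrite -oppr_eq0 opprB addrC; apply/eqP.
Qed.

Lemma ibp_weight K l w phi : nondegenerate K -> (forall i, polyfun l (comp w i)) ->
  C1 phi -> vip (simplex K) (fun x => weight K x *: w x) (grad phi) =
  - ip (simplex K) (pdiv (fun x => weight K x *: w x)) phi.
Proof.
move=> ndK pw Cphi; have [m pW] := polyfun_weight K; have mK := measurable_simplex ndK.
have cphi := C1_continuous Cphi.
have compE i : comp (fun x => weight K x *: w x) i = fun x => weight K x * comp w i x.
  by apply/funext => x; rewrite /comp mxE.
have pc i : polyfun (m + l) (comp (fun x => weight K x *: w x) i).
  by rewrite compE; exact: polyfunM.
set v := fun x => weight K x *: w x in compE pc *.
have pd : polyfun (m + l) (pdiv v).
  by apply: polyfun_sum => i _; apply: polyfun_leq (polyfun_pderiv i (pc i)); exact: leq_pred.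
apply/eqP; rewrite -addr_eq0; apply/eqP; rewrite /vip /ip.
have ci i : continuous (fun x => comp v i x * pderiv i phi x).
  by have [_ H] := Cphi; apply: continuous_mulf (H i); exact: polyfun_continuous (pc i).
have cd : continuous (fun x => pdiv v x * phi x).
  by apply: continuous_mulf cphi; exact: polyfun_continuous pd.
have dE x : dot (v x) (grad phi x) = \sum_i comp v i x * pderiv i phi x.
  by apply: eq_bigr => i _; rewrite [grad phi x _ _]mxE.
under eq_Rintegral do rewrite dE.
have Cw i : C1 (fun x => comp w i x * phi x) by apply: C1M => //; exact: polyfun_C1 (pw i).
rewrite -RintegralD//; last 2 first.
- by apply: integrable_sumR => // i; exact: integrable_simplex.
- exact: integrable_simplex.
transitivity (\int[leb]_(x in simplex K)
    \sum_i pderiv i (fun x => weight K x * (comp w i x * phi x)) x).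
  apply: eq_Rintegral => x _; rewrite mulr_suml -big_split; apply: eq_bigr => i _ /=.
  rewrite (_ : (fun x => weight K x * _) = fun x => comp v i x * phi x); last first.
    by apply/funext => y; rewrite compE mulrA.
  have [dphi _] := Cphi; rewrite pderivM//; last exact: polyfun_differentiable (pc i).
  by rewrite [phi x * _]mulrC.
rewrite (@Rintegral_sum _ _ R leb _ mK _ _
  (fun i => pderiv i (fun x => weight K x * (comp w i x * phi x)))).
  by rewrite big1// => i _; exact: integral_pderiv_weight.
move=> i; apply: integrable_simplex => //.
by have [_ H] := C1M (polyfun_C1 pW) (Cw i); exact: H.
Qed.

(** The extension by zero of weight K * w, a field of H(div) for polynomial w since
it is continuously differentiable. *)
Definition cell_field K w : pt -> pt :=
  fun x => \row_i ((fun x => weight K x * comp w i x) \_ (simplex K)) x.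

Lemma cell_field_Hdiv Omega K l w : open Omega -> nondegenerate K ->
  osimplex K `<=` Omega -> (forall i, polyfun l (comp w i)) ->
  Hdiv Omega (cell_field K w) /\
  {ae leb, forall x, Omega x -> div Omega (cell_field K w) x =
    (pdiv (fun x => weight K x *: w x) \_ (simplex K)) x}.
Proof.
move=> oO ndK KO pw; have mO := open_rV_measurable oO; have mK := measurable_simplex ndK.
have [m pW] := polyfun_weight K.
pose v x := weight K x *: w x.
have compE i : comp v i = fun x => weight K x * comp w i x.
  by apply/funext => x; rewrite /comp mxE.
have pc i : polyfun (m + l) (comp v i) by rewrite compE; exact: polyfunM.
have pd : polyfun (m + l) (pdiv v).
  by apply: polyfun_sum => i _; apply: polyfun_leq (polyfun_pderiv i (pc i)); exact: leq_pred.
have Lg : L2 Omega (pdiv v \_ (simplex K)).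
  by apply: L2_patch => //; apply: L2_simplex => //; exact: polyfun_continuous pd.
have dg : is_div Omega (cell_field K w) (pdiv v \_ (simplex K)).
  move=> phi tphi; have Cphi : C1 phi by apply: smooth_C1; have [] := tphi.
  have := ibp_weight ndK pw Cphi; rewrite -/v.
  have -> : vip (simplex K) v (grad phi) = vip Omega (cell_field K w) (grad phi).
    apply: ae_eq_Rintegral; apply: filterS (ae_osimplex ndK) => x Kx; rewrite !patchE.
    case: (boolP (x \in simplex K)) => [/[dup] xK /set_mem sx|xK].
      rewrite mem_set; last exact/KO/Kx.
      by apply: eq_bigr => i _; rewrite [cell_field _ _ _ _ _]mxE patchE xK [v x _ _]mxE.
    case: ifP => // _; rewrite /dot big1// => i _.
    by rewrite [cell_field _ _ _ _ _]mxE patchE (negbTE xK) mul0r.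
  have -> // : ip (simplex K) (pdiv v) phi = ip Omega (pdiv v \_ (simplex K)) phi.
  apply: ae_eq_Rintegral; apply: filterS (ae_osimplex ndK) => x Kx; rewrite !patchE.
  case: (boolP (x \in simplex K)) => [/set_mem sx|xK].
    by rewrite mem_set//; exact/KO/Kx.
  by case: ifP => // _; rewrite mul0r.
have HH : Hdiv Omega (cell_field K w).
  split; last by exists (pdiv v \_ (simplex K)).
  move=> i; rewrite (_ : comp _ i = (comp v i) \_ (simplex K)); last first.
    by rewrite compE; apply/funext => x; rewrite /comp [LHS]mxE.
  by apply: L2_patch => //; apply: L2_simplex => //; exact: polyfun_continuous (pc i).
by split => //; exact: ae_div_unique.
Qed.

End weak_divergence.

(** * The post-processed fields on a cell *)

Section inner_products.
Context {R : realType} {d : nat}.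
Local Notation pt := 'rV[R]_d.
Local Notation leb := (@lebesgue_rV R d).
Implicit Types (D : set pt) (f g : pt -> R).

Lemma ip_ae D f f' g g' : {ae leb, forall x, D x -> f x = f' x} ->
  {ae leb, forall x, D x -> g x = g' x} -> ip D f g = ip D f' g'.
Proof.
move=> Hf Hg; apply: ae_eq_Rintegral; apply: filterS2 Hf Hg => x Hf Hg; rewrite !patchE.
by case: ifPn => // /set_mem Dx; rewrite Hf// Hg.
Qed.

Lemma ipC D f g : ip D f g = ip D g f.
Proof. by apply: eq_Rintegral => x _; rewrite mulrC. Qed.

Lemma ipBl D f f' g : measurable D -> L2 D f -> L2 D f' -> L2 D g ->
  ip D (fun x => f x - f' x) g = ip D f g - ip D f' g.
Proof.
move=> mD Lf Lf' Lg; rewrite /ip; under eq_Rintegral do rewrite mulrBl.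
by rewrite RintegralB//; [exact: L2_integrableM Lf Lg|exact: L2_integrableM Lf' Lg].
Qed.

Lemma ip_ge0 D f : 0 <= ip D f f.
Proof. by apply: Rintegral_ge0 => x _; rewrite -expr2 sqr_ge0. Qed.

Lemma ip_young D f g (a : R) : measurable D -> L2 D f -> L2 D g -> 0 < a ->
  ip D f g <= a * ip D f f + (4 * a)^-1 * ip D g g.
Proof.
move=> mD Lf Lg a0; have iff := L2_integrableM mD Lf Lf; have igg := L2_integrableM mD Lg Lg.
rewrite /ip -!RintegralZl//.
have iZ c h : leb.-integrable D (EFin \o h) -> leb.-integrable D (EFin \o (fun x => c * h x)).
  by move=> ih; exact: (integrableZl mD c ih).
rewrite -RintegralD//; [|exact: iZ|exact: iZ].
apply: le_Rintegral => //.
- exact: L2_integrableM.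
- exact: (integrableD mD (iZ _ _ iff) (iZ _ _ igg)).
- move=> x _; rewrite -subr_ge0.
  have -> : a * (f x * f x) + (4 * a)^-1 * (g x * g x) - f x * g x =
      (4 * a)^-1 * (2 * a * f x - g x) ^+ 2 by field; rewrite gt_eqF.
  by rewrite mulr_ge0 ?sqr_ge0// invr_ge0 mulr_ge0// ltW.
Qed.

Lemma vip_sum D (v w : pt -> pt) : measurable D -> (forall i, L2 D (comp v i)) ->
  (forall i, L2 D (comp w i)) ->
  vip D v w = \sum_i ip D (comp v i) (comp w i).
Proof.
move=> mD Lv Lw; rewrite /vip /dot.
rewrite (@Rintegral_sum _ _ R leb _ mD _ _ (fun i x => comp v i x * comp w i x))//.
by move=> i; exact: L2_integrableM.
Qed.

End inner_products.

Section broken_spaces.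
Context {R : realType} {n : nat}.
Local Notation d := n.+1.
Local Notation pt := 'rV[R]_d.
Local Notation leb := (@lebesgue_rV R d).
Variables (Omega : set pt) (T : seq 'M[R]_(d.+1, d)).
Hypotheses (pO : polytope Omega) (tT : triangulation Omega T).
Implicit Types (K : 'M[R]_(d.+1, d)).

Let ndT : {in T, forall K, nondegenerate K}. Proof. by have [] := tT. Qed.
Let mO : measurable Omega. Proof. exact: open_rV_measurable (open_polytope pO). Qed.

Lemma ae_cells (P : pt -> Prop) :
  (forall K, K \in T -> {ae leb, forall x, simplex K x -> P x}) ->
  {ae leb, forall x, Omega x -> P x}.
Proof.
move=> HP.
have : {ae leb, forall x, forall k, (k < size T)%N -> simplex (nth 0 T k) x -> P x}.
  apply: ae_foralln => k; have [kT|kT] := ltnP k (size T).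
    by apply: filterS (HP _ (mem_nth 0 kT)) => x H _.
  exact: aeW.
move=> HT; have HU := ae_osimplex_uniq tT.
apply: filterS2 HU HT => x Hx H /Hx[K [KT oK _]].
by apply: (H (index K T)); rewrite ?index_mem// nth_index//; exact: (osimplex_sub (ndT KT)).
Qed.

Lemma broken_patch l p K : K \in T -> polyfun l p -> broken Omega T l (p \_ (simplex K)).
Proof.
move=> KT pp; have ndK := ndT KT; split.
  apply: L2_patch => //; first exact: measurable_simplex.
  by apply: L2_simplex => //; exact: polyfun_continuous pp.
move=> L LT; have [->|LK] := eqVneq L K.
  by exists p => //; apply: aeW => x Kx; rewrite patchE mem_set.
exists (fun=> 0); first exact: polyfun_cst.
have HL := ae_osimplex (ndT LT); have HU := ae_osimplex_uniq tT.
apply: filterS2 HL HU => x oL Hx Lx.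
have [K0 [_ _ K0U]] := Hx (osimplex_sub_polytope pO tT LT (oL Lx)).
rewrite patchE memNset// => Kx; move/eqP: LK; apply.
by rewrite (K0U L LT Lx) (K0U K KT Kx).
Qed.

Lemma ip_patch f p K : K \in T -> ip Omega f (p \_ (simplex K)) = ip (osimplex K) f p.
Proof.
move=> KT; have ndK := ndT KT; apply: ae_eq_Rintegral.
apply: filterS (ae_osimplex ndK) => x Kx; rewrite !patchE.
case: (boolP (x \in osimplex K)) => [/set_mem ox|/negP nox].
  rewrite mem_set; last exact: (osimplex_sub_polytope pO tT KT).
  by rewrite mem_set//; exact: (osimplex_sub ndK).
case: ifP => // _; rewrite memNset ?mulr0// => /Kx ox.
by apply: nox; rewrite inE.
Qed.

Lemma L2_osimplex f K : K \in T -> L2 Omega f -> L2 (osimplex K) f.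
Proof.
move=> KT; apply: L2S => //; first exact: measurable_osimplex.
exact: (osimplex_sub_polytope pO tT).
Qed.

End broken_spaces.

Lemma comp_restrv (R : realType) n (K : 'M[R]_(n.+2, n.+1)) (tau : 'rV[R]_n.+1 -> 'rV[R]_n.+1) i :
  comp (restrv K tau) i = restr K (comp tau i).
Proof. by apply/funext => x; rewrite /comp mxE. Qed.

Lemma poly_on_restrv (R : realType) n (K : 'M[R]_(n.+2, n.+1)) l
    (tau : 'rV[R]_n.+1 -> 'rV[R]_n.+1) : nondegenerate K ->
  (forall i, poly_on l K (comp tau i)) ->
  (forall i, polyfun l (comp (restrv K tau) i)) /\
  {ae lebesgue_rV n.+1, forall x, simplex K x -> tau x = restrv K tau x}.
Proof.
move=> ndK pt; split; first by move=> i; rewrite comp_restrv; have [] := poly_on_restr ndK (pt i).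
have H : {ae lebesgue_rV n.+1, forall x, forall i, simplex K x -> tau x ord0 i = restr K (comp tau i) x}.
  apply: (@filter_forall _ _ (fun i x => simplex K x -> tau x ord0 i =
    restr K (comp tau i) x) (almost_everywhere (lebesgue_rV n.+1))) => i.
  by have [_ H] := poly_on_restr ndK (pt i).
by apply: filterS H => x H Kx; apply/rowP => i; rewrite H// mxE.
Qed.

Lemma L2_poly_osimplex (R : realType) n (K : 'M[R]_(n.+2, n.+1)) l f :
  nondegenerate K -> polyfun l f -> L2 (osimplex K) f.
Proof.
move=> ndK pf; apply: L2S (L2_simplex ndK (polyfun_continuous pf)).
- exact: measurable_simplex.
- exact: measurable_osimplex.
- exact: osimplex_sub.
Qed.

Lemma ip_osimplex (R : realType) n (K : 'M[R]_(n.+2, n.+1)) f g :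
  nondegenerate K -> ip (simplex K) f g = ip (osimplex K) f g.
Proof. by move=> ndK; exact: Rintegral_osimplex. Qed.

Lemma sqr_osimplex (R : realType) n (K : 'M[R]_(n.+2, n.+1)) f :
  nondegenerate K -> \int[lebesgue_rV n.+1]_(x in simplex K) f x ^+ 2 = ip (osimplex K) f f.
Proof. by move=> ndK; rewrite -ip_osimplex. Qed.

Lemma ip_poly_eq0 (R : realType) n (K : 'M[R]_(n.+2, n.+1)) l f :
  nondegenerate K -> polyfun l f -> ip (osimplex K) f f = 0 ->
  forall x, f x = 0.
Proof.
move=> ndK pf; rewrite -sqr_osimplex// => f0; apply: (polyfun_eq0_simplex ndK pf) => x Kx.
have pff : polyfun (l * 2) (fun x => f x ^+ 2) by exact: polyfun_exp.
have /eqP := simplex_integral0 ndK (polyfun_continuous pff) (fun x => sqr_ge0 (f x)) f0 Kx.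
by rewrite sqrf_eq0 => /eqP.
Qed.

Section cell_polynomials.
Context {R : realType} {n' : nat}.
Local Notation n := n'.+1.
Local Notation d := n.+1.
Local Notation pt := 'rV[R]_d.
Local Notation leb := (@lebesgue_rV R d).
Variables (k : nat) (Omega : set pt) (T : seq 'M[R]_(d.+1, d)).
Hypotheses (pO : polytope Omega) (tT : triangulation Omega T).
Variables (lamh : R) (uh us : pt -> R) (sigmah sigmas : pt -> pt).
Hypothesis eigh : discrete_eigenpair Omega T k lamh uh sigmah.
Hypothesis hus : postprocessed_eigenfunction Omega T k uh sigmah us.
Hypothesis hss : postprocessed_flux Omega T k lamh us sigmah sigmas.
Variable K : 'M[R]_(d.+1, d).
Hypothesis KT : K \in T.

Local Notation O := (osimplex K).
Local Notation sh := (restrv K sigmah).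
Local Notation ss := (restrv K sigmas).
Local Notation q := (restr K uh).
Local Notation w := (restr K us).

Let ndK : nondegenerate K. Proof. by have [+ _ _ _] := tT; apply. Qed.
Let KO : O `<=` Omega. Proof. exact: (osimplex_sub_polytope pO tT KT). Qed.
Let oO : open Omega. Proof. exact: open_polytope pO. Qed.
Let mO : measurable Omega. Proof. exact: open_rV_measurable. Qed.
Let mK : measurable O. Proof. exact: measurable_osimplex. Qed.

Lemma polyfun_pdiv l (v : pt -> pt) : (forall i, polyfun l (comp v i)) ->
  polyfun l.-1 (pdiv v).
Proof. by move=> pv; apply: polyfun_sum => i _; exact: polyfun_pderiv. Qed.

Lemma comp_sub (v v' : pt -> pt) i :
  comp (fun x => v x - v' x) i = fun x => comp v i x - comp v' i x.
Proof. by apply/funext => y; rewrite /comp mxE [X in _ + X]mxE. Qed.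

Lemma pdivB l l' (v v' : pt -> pt) x : (forall i, polyfun l (comp v i)) ->
  (forall i, polyfun l' (comp v' i)) ->
  pdiv (fun x => v x - v' x) x = pdiv v x - pdiv v' x.
Proof.
move=> pv pv'; rewrite /pdiv -sumrB; apply: eq_bigr => i _; rewrite comp_sub.
rewrite (_ : (fun x => _) = fun x => comp v i x + (-1) * comp v' i x); last first.
  by apply/funext => z; rewrite mulN1r.
rewrite pderivD ?pderivZ ?mulN1r//.
- exact: polyfun_differentiable (pv' i).
- exact: polyfun_differentiable (pv i).
- exact: polyfun_differentiable (polyfunZ _ (pv' i)).
Qed.

Lemma sigmah_poly : (forall i, polyfun k.+1 (comp sh i)) /\
  {ae leb, forall x, simplex K x -> sigmah x = sh x}.
Proof. by have [_ [_ p] _ _] := eigh; apply: poly_on_restrv => // i; exact: p. Qed.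

Lemma sigmas_poly : (forall i, polyfun k.+3 (comp ss i)) /\
  {ae leb, forall x, simplex K x -> sigmas x = ss x}.
Proof. by have [[[_ p] _] _ _ _] := hss; apply: poly_on_restrv => // i; exact: p. Qed.

Lemma uh_poly : polyfun k q /\ {ae leb, forall x, simplex K x -> uh x = q x}.
Proof. by have [[_ p] _ _ _] := eigh; apply: poly_on_restr => //; exact: p. Qed.

Lemma us_poly : polyfun k.+2 w /\ {ae leb, forall x, simplex K x -> us x = w x}.
Proof. by have [[_ p] _ _] := hus; apply: poly_on_restr => //; exact: p. Qed.

Lemma div_sigmas : {ae leb, forall x, simplex K x -> div Omega sigmas x = pdiv ss x}.
Proof.
have [[[HH _] _] _ _ _] := hss; have [ps ae] := sigmas_poly.
exact: (ae_div_poly oO ndK KO HH ps ae).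
Qed.

Let toO (P : pt -> Prop) : {ae leb, forall x, simplex K x -> P x} ->
  {ae leb, forall x, O x -> P x}.
Proof. by apply: filterS => x H Ox; apply: H; exact: (osimplex_sub ndK). Qed.

(** Both sides are polynomials of degree k, and the discrete equation may be tested
with their difference, extended by zero outside the cell. *)
Lemma pdiv_sigmah x : pdiv sh x = - lamh * q x.
Proof.
have [ps aes] := sigmah_poly; have [pq aeq] := uh_poly.
have [_ [HH _] _ eqh] := eigh.
have dsh := ae_div_poly oO ndK KO HH ps aes.
pose e x := pdiv sh x + lamh * q x.
have pd : polyfun k (pdiv sh) := polyfun_pdiv ps.
have pe : polyfun k e by apply: polyfunD => //; exact: polyfunZ.
have := eqh _ (broken_patch pO tT KT pe); rewrite !(ip_patch pO tT) //.
rewrite (ip_ae (f' := pdiv sh) (g' := e) (toO dsh)); last exact: aeW.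
rewrite (ip_ae (f' := q) (g' := e) (toO aeq)); last exact: aeW.
move=> H.
suff e0 : ip O e e = 0.
  have := ip_poly_eq0 ndK pe e0 x; rewrite /e => /eqP; rewrite addr_eq0 => /eqP ->.
  by rewrite mulNr.
have Ld := L2_poly_osimplex ndK pd; have Lq := L2_poly_osimplex ndK pq.
have Le := L2_poly_osimplex ndK pe.
have -> : ip O e e = ip O (fun x => pdiv sh x - (- lamh) * q x) e.
  by apply: eq_Rintegral => y _; rewrite /e mulNr opprK.
rewrite ipBl//; last exact: L2Z.
have -> : ip O (fun x => - lamh * q x) e = - lamh * ip O q e.
  rewrite /ip; under eq_Rintegral do rewrite -mulrA.
  by rewrite RintegralZl//; exact: L2_integrableM.
by rewrite mulNr -H opprK subrr.
Qed.

(** On a facet both normal components are polynomials of degree k + 1, determined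
by their moments of this order. *)
Lemma noflux_difference : noflux K (fun x => ss x - sh x).
Proof.
move=> i x Kx xi; have [[_ fl] fc _ _] := hss; have [psh _] := sigmah_poly.
set nu : pt := (enorm (bgrad K i))^-1 *: bgrad K i.
have un : unit_normal (facet K i) nu by exact: unit_normal_bgrad.
have [r pr rE] := fl K KT i nu un.
pose r0 y := r y - dot (sh y) nu.
have pr0 : polyfun k.+1 r0.
  apply: polyfunB => //.
  rewrite (_ : (fun=> _) = fun y => \sum_j nu ord0 j * comp sh j y).
    by apply: polyfun_sum => j _; exact: polyfunZ.
  by apply/funext => y; apply: eq_bigr => j _; rewrite mulrC.
have r0E y : simplex (facet K i) y -> dot (ss y - sh y) nu = r0 y.
  by move=> Fy; rewrite dotBl rE.
have := fc K KT i nu r0 un pr0; rewrite /simplex_int => /eqP.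
rewrite mulf_eq0 sqrtr_eq0 leNgt facet_gram_gt0//= => /eqP I0.
pose c y := row ord0 (facet K i) + y *m edges (facet K i).
have pc : polyfun k.+1 (fun y => r0 (c y)) by exact: polyfun_affine.
have I1 : \int[lebesgue_rV n]_(y in @unit_simplex R n) r0 (c y) ^+ 2 = 0.
  rewrite -[RHS]I0; apply: eq_Rintegral => y /set_mem Uy.
  by rewrite r0E ?expr2//; apply/simplex_paramP; exists y.
have [y Uy xE] := (simplex_paramP _ _).1 ((facet_baryP ndK i x).2 (conj Kx xi)).
have := unit_simplex_integral0 (polyfun_continuous (polyfun_exp 2 pc)) (fun y => sqr_ge0 _) I1 Uy.
rewrite /c -xE => /eqP; rewrite sqrf_eq0 -r0E; last exact: (facet_baryP ndK i x).2.
rewrite dotC dotZl mulf_eq0 invr_eq0 => /orP[|/eqP]; last by rewrite dotC.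
by rewrite /enorm sqrtr_eq0 leNgt lt0r dotxx_ge0 dotxx_eq0 bgrad_neq0.
Qed.

Lemma projection_cell v : polyfun k v -> ip O (fun x => w x - q x) v = 0.
Proof.
move=> pv; have [_ _ [_ H]] := hus; have := H _ (broken_patch pO tT KT pv).
rewrite (ip_patch pO tT)// => <-; apply: ip_ae; last exact: aeW.
have [_ aes] := us_poly; have [_ aeh] := uh_poly.
by apply: filterS2 (toO aes) (toO aeh) => x H1 H2 Ox; rewrite /= -H1// -H2.
Qed.

(** Both sides are polynomials of degree k + 2; their difference is orthogonal
to the polynomials of mean zero, and its own mean vanishes by the divergence
theorem, the normal components of the two fluxes being equal. *)
Lemma pdiv_sigmas x : pdiv ss x = - lamh * w x.
Proof.
have [pss _] := sigmas_poly; have [psh _] := sigmah_poly; have [pq _] := uh_poly.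
have [pw aew] := us_poly.
pose e x := pdiv ss x + lamh * w x.
have pds : polyfun k.+2 (pdiv ss) := polyfun_pdiv pss.
have pdh : polyfun k (pdiv sh) := polyfun_pdiv psh.
have pe : polyfun k.+2 e by apply: polyfunD => //; exact: polyfunZ.
have iK l f := @polyfun_integrable_simplex R n K ndK l f.
have mSK := measurable_simplex ndK.
pose I f := \int[leb]_(x in simplex K) f x.
have IB l f g : polyfun l f -> polyfun l g -> I (fun x => f x - g x) = I f - I g.
  by move=> pf pg; rewrite /I RintegralB//; [exact: iK pf|exact: iK pg].
have IZ l c f : polyfun l f -> I (fun x => c * f x) = c * I f.
  by move=> pf; rewrite /I RintegralZl//; exact: iK pf.
have pdq : polyfun k.+2 (pdiv sh) by apply: polyfun_leq pdh; rewrite -addn2 leq_addr.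
have pq2 : polyfun k.+2 q by apply: polyfun_leq pq; rewrite -addn2 leq_addr.
have Ie : I e = 0.
  have p3 : forall i, polyfun k.+3 (comp (fun x => ss x - sh x) i).
    move=> i; rewrite comp_sub; apply: polyfunB => //; apply: polyfun_leq (psh i).
    by rewrite -addn2 leq_addr.
  have D0 : I (pdiv (fun x => ss x - sh x)) = 0.
    exact: (integral_noflux ndK p3 noflux_difference).
  have dB y := pdivB y pss psh.
  have M0 : I (fun x => w x - q x) = 0.
    have := projection_cell (polyfun_cst k 1); rewrite -ip_osimplex// => <-.
    by apply: eq_Rintegral => y _; rewrite mulr1.
  rewrite (_ : e = fun y => pdiv (fun x => ss x - sh x) y - (- lamh) * (w y - q y)).
    rewrite (IB k.+2) ?D0; first by rewrite (IZ k.+2) ?M0 ?mulr0 ?subr0//; exact: polyfunB.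
    - by rewrite (funext dB); exact: polyfunB.
    - by apply: polyfunZ; exact: polyfunB.
  by apply/funext => y; rewrite /e dB pdiv_sigmah; ring.
pose V := I (fun=> 1).
have V0 : V != 0.
  apply/eqP => V0.
  have /eqP := simplex_integral0 ndK (@polyfun_continuous _ _ 0 _ (polyfun_cst 0 (1 : R)))
    (fun=> ler01) V0 (simplex_vertex ndK ord0).
  by rewrite oner_eq0.
suff e0 : ip O e e = 0.
  have := ip_poly_eq0 ndK pe e0 x; rewrite /e => /eqP; rewrite addr_eq0 => /eqP ->.
  by rewrite mulNr.
have pVe : polyfun k.+2 (fun x => V * e x) by exact: polyfunZ.
have [_ _ Hq _] := hss; have := Hq K KT e pe Ie.
rewrite ip_osimplex// => <-; apply: ip_ae; last exact: aeW.
apply: filterS2 (toO div_sigmas) (toO aew) => y H1 H2 Oy.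
by rewrite H1// H2.
Qed.

Variables (lam : R) (u : pt -> R) (sigma : pt -> pt).
Hypothesis eig : laplace_eigenpair Omega lam u sigma.

Let Lp l f : polyfun l f -> L2 O f. Proof. exact: L2_poly_osimplex. Qed.

Lemma comp_scale (f : pt -> R) (v : pt -> pt) i :
  comp (fun x => f x *: v x) i = fun x => f x * comp v i x.
Proof. by apply/funext => y; rewrite /comp mxE. Qed.

Lemma flux_correction_poly i : polyfun k.+3 (comp (fun x => ss x - sh x) i).
Proof.
have [ps _] := sigmas_poly; have [ph _] := sigmah_poly.
rewrite comp_sub; apply: polyfunB => //; apply: polyfun_leq (ph i).
by rewrite -addn2 leq_addr.
Qed.

Lemma pdiv_flux_correction x : pdiv (fun x => ss x - sh x) x = - lamh * (w x - q x).
Proof.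
have [ps _] := sigmas_poly; have [ph _] := sigmah_poly.
rewrite (pdivB _ ps ph).
by rewrite (pdiv_sigmas) (pdiv_sigmah); ring.
Qed.

Lemma orthogonal_norm_le (m l : nat) (f g : 'I_m -> pt -> R) :
  (forall i, polyfun l (f i)) -> (forall i, polyfun l (g i)) ->
  \sum_i ip O (fun x => f i x - g i x) (f i) = 0 ->
  \sum_i ip O (f i) (f i) <= \sum_i ip O (g i) (g i).
Proof.
move=> pf pg H.
have {}H : \sum_i ip O (f i) (f i) = \sum_i ip O (g i) (f i).
  apply/eqP; rewrite -subr_eq0 -sumrB -[X in _ == X]H; apply/eqP; apply: eq_bigr => i _.
  by rewrite ipBl//; [exact: Lp (pf i)|exact: Lp (pg i)|exact: Lp (pf i)].
have h0 : (0 : R) < 2^-1 by rewrite invr_gt0.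
have : \sum_i ip O (g i) (f i) <= \sum_i (2^-1 * ip O (g i) (g i) + (4 * 2^-1)^-1 * ip O (f i) (f i)).
  by apply: ler_sum => i _; apply: ip_young => //; [exact: Lp (pg i)|exact: Lp (pf i)].
rewrite big_split -!mulr_sumr -H /=.
have -> : (4 * 2^-1)^-1 = 2^-1 :> R by field.
lra.
Qed.

(** The interior moments make the correction of the flux orthogonal to the
divergence free fields without flux: it has the least norm for its divergence. *)
Lemma flux_correction_min (v : pt -> pt) : (forall i, polyfun k.+3 (comp v i)) -> noflux K v ->
  (forall x, simplex K x -> pdiv v x = pdiv (fun x => ss x - sh x) x) ->
  \sum_i ip O (comp (fun x => ss x - sh x) i) (comp (fun x => ss x - sh x) i) <=
  \sum_i ip O (comp v i) (comp v i).
Proof.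
move=> pv nfv dv; set e := fun x => ss x - sh x in dv *.
have pe i : polyfun k.+3 (comp e i) := flux_correction_poly i.
apply: (orthogonal_norm_le pe pv).
have pb i : polyfun k.+3 (comp (fun x => e x - v x) i).
  by rewrite comp_sub; exact: polyfunB.
have bub : bubble k K (fun x => e x - v x).
  split => //.
  - by move=> x Kx; rewrite (pdivB _ pe pv) (dv x Kx) subrr.
  - move=> i nu un x Fx; have [a aE] := unit_normalE ndK un.
    have [Kx xi] := (facet_baryP ndK i x).1 Fx.
    by rewrite aE dotBl (noflux_difference Kx xi) (nfv i x Kx xi) subrr mulr0.
have [_ _ _ H] := hss; have := H K KT _ bub.
rewrite /vip Rintegral_osimplex// => H0.
have [_ aes] := sigmas_poly; have [_ aeh] := sigmah_poly.
transitivity (vip O e (fun x => e x - v x)).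
  rewrite vip_sum//; [|by move=> i; exact: Lp (pe i)|by move=> i; exact: Lp (pb i)].
  by apply: eq_bigr => i _; rewrite ipC comp_sub.
rewrite -[RHS]H0; apply: ae_eq_Rintegral.
apply: filterS2 (toO aes) (toO aeh) => x H1 H2; rewrite !patchE.
by case: ifPn => // /set_mem Ox; rewrite /= H1// H2.
Qed.

Local Notation g := (fun x => w x - q x).
Local Notation W := (fun i x => comp sh i x - pderiv i q x).

Lemma correction_poly : polyfun k.+2 g.
Proof.
have [pq _] := uh_poly; have [pw _] := us_poly.
by apply: polyfunB => //; apply: polyfun_leq pq; rewrite -addn2 leq_addr.
Qed.

Lemma residual_poly i : polyfun k.+1 (W i).
Proof.
have [pq _] := uh_poly; have [ph _] := sigmah_poly.
apply: polyfunB => //; apply: polyfun_leq (polyfun_pderiv i pq).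
by apply: leq_trans (leq_pred _) _.
Qed.

Lemma pderiv_correction i x : pderiv i g x = pderiv i w x - pderiv i q x.
Proof.
have [pq _] := uh_poly; have [pw _] := us_poly.
rewrite (_ : (fun x => _) = fun x => w x + (-1) * q x); last first.
  by apply/funext => z; rewrite mulN1r.
rewrite pderivD ?pderivZ ?mulN1r//.
- exact: polyfun_differentiable pq.
- exact: polyfun_differentiable pw.
- exact: polyfun_differentiable (polyfunZ _ pq).
Qed.

(** The definition of the post-processed eigenfunction makes the gradient of its
correction a projection of the residual sigmah - grad uh. *)
Lemma grad_correction_min : \sum_i ip O (pderiv i g) (pderiv i g) <= \sum_i ip O (W i) (W i).
Proof.
have [pq _] := uh_poly; have [pw _] := us_poly.
have [ph aeh] := sigmah_poly.
have pg i : polyfun k.+1 (pderiv i g) := polyfun_pderiv i correction_poly.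
apply: (orthogonal_norm_le pg residual_poly).
have [_ H _] := hus.
have prj : is_L2proj (simplex K) (polyfun k) w q.
  by split => // v pv; rewrite ip_osimplex//; exact: (projection_cell).
have := H K KT w q pw prj; rewrite /vip !Rintegral_osimplex// => H0.
have compg i : comp (grad (w \- q)) i = pderiv i g.
  by apply/funext => x; rewrite /comp mxE.
have compw i : comp (grad w) i = pderiv i w.
  by apply/funext => x; rewrite /comp mxE.
have L1 i : L2 O (pderiv i w) by exact: Lp (polyfun_pderiv i pw).
have L2' i : L2 O (pderiv i g) by exact: Lp (pg i).
have L3 i : L2 O (comp sh i) by exact: Lp (ph i).
have E1 : vip O (grad w) (grad (w \- q)) = \sum_i ip O (pderiv i w) (pderiv i g).
  rewrite vip_sum//; last 2 first.
  - by move=> i; rewrite compw.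
  - by move=> i; rewrite compg.
  by apply: eq_bigr => i _; rewrite compg compw.
have E2 : \int[leb]_(x in O) dot (sigmah x) (grad (w \- q) x) =
    \sum_i ip O (comp sh i) (pderiv i g).
  transitivity (vip O sh (grad (w \- q))).
    apply: ae_eq_Rintegral; apply: filterS (toO aeh) => x Hx; rewrite !patchE.
    by case: ifPn => // /set_mem Ox; rewrite Hx.
  rewrite vip_sum//; last by move=> i; rewrite compg.
  by apply: eq_bigr => i _; rewrite compg.
apply/eqP; rewrite (eq_bigr (fun i => ip O (pderiv i w) (pderiv i g) - ip O (comp sh i) (pderiv i g))).
  by rewrite sumrB -E1 -E2 -H0 subrr.
move=> i _; rewrite -ipBl//; apply: eq_Rintegral => x _; rewrite pderiv_correction; congr (_ * _).
by ring.
Qed.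

(** The field tau vanishes on the boundary of the cell: it is a test function of
the continuous problem, and no jumps of uh occur when it is integrated by parts
against uh on the cell. *)
Lemma residual_identity l (p : pt -> pt) : (forall i, polyfun l (comp p i)) ->
  let tau := fun x => weight K x *: p x in
  \sum_i ip O (W i) (comp tau i) =
  \sum_i ip O (fun x => comp sigmah i x - comp sigma i x) (comp tau i) +
  ip O (fun x => uh x - u x) (pdiv tau).
Proof.
move=> pp tau; have [pq aeq] := uh_poly.
have [ph aeh] := sigmah_poly.
have [m pW] := polyfun_weight K.
have pt i : polyfun (m + l) (comp tau i) by rewrite comp_scale; exact: polyfunM.
have pd : polyfun (m + l).-1 (pdiv tau) := polyfun_pdiv pt.
have Lt i : L2 O (comp tau i) := Lp (pt i).
have Ld : L2 O (pdiv tau) := Lp pd.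
have [Lu HS eqc _] := eig; have [Ls _] := HS.
have LuO : L2 O u by exact: (L2_osimplex pO tT KT).
have LsO i : L2 O (comp sigma i) by exact: (L2_osimplex pO tT KT).
have [[Luh _] [[Lsh _] _] _ _] := eigh.
have LuhO : L2 O uh by exact: (L2_osimplex pO tT KT).
have LshO i : L2 O (comp sigmah i) by exact: (L2_osimplex pO tT KT (Lsh i)).
have [Hc dc] := cell_field_Hdiv oO ndK KO pp.
have := eqc _ Hc.
have -> : vip Omega sigma (cell_field K p) = vip O sigma tau.
  apply: ae_eq_Rintegral; apply: filterS (ae_osimplex ndK) => x Kx; rewrite !patchE.
  case: (boolP (x \in O)) => [/set_mem ox|/negP nox].
    rewrite mem_set; last exact: KO.
    apply: eq_bigr => i _; rewrite [cell_field _ _ _ _ _]mxE patchE mem_set.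
      by rewrite [tau x _ _]mxE.
    exact: (osimplex_sub ndK).
  case: ifP => // _; rewrite /dot big1// => i _; rewrite [cell_field _ _ _ _ _]mxE patchE memNset ?mulr0//.
  by move=> /Kx ox; apply: nox; rewrite inE.
have -> : ip Omega (div Omega (cell_field K p)) u = ip O (pdiv tau) u.
  apply: ae_eq_Rintegral; apply: filterS2 dc (ae_osimplex ndK) => x dx Kx; rewrite !patchE.
  case: (boolP (x \in O)) => [/set_mem ox|/negP nox].
    rewrite mem_set; last exact: KO.
    by rewrite (dx (KO ox)) patchE mem_set//; exact: (osimplex_sub ndK).
  case: ifPn => // /set_mem Ox; rewrite (dx Ox) patchE memNset ?mul0r//.
  by move=> /Kx ox; apply: nox; rewrite inE.
rewrite vip_sum// => /eqP; rewrite -opprD oppr_eq0 addr_eq0 => /eqP Es.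
have Eq : vip O tau (grad q) = - ip O (pdiv tau) q.
  by have := ibp_weight ndK pp (polyfun_C1 pq); rewrite /vip /ip !Rintegral_osimplex.
have compq i : comp (grad q) i = pderiv i q.
  by apply/funext => x; rewrite /comp mxE.
have Lq i : L2 O (pderiv i q) by exact: Lp (polyfun_pderiv i pq).
rewrite vip_sum// in Eq; last by move=> i; rewrite compq.
have E1 : \sum_i ip O (W i) (comp tau i) =
    \sum_i ip O (comp sigmah i) (comp tau i) - \sum_i ip O (pderiv i q) (comp tau i).
  rewrite -sumrB; apply: eq_bigr => i _; rewrite ipBl//; last exact: Lp (ph i).
  congr (_ - _); apply: ip_ae; last exact: aeW.
  by apply: filterS (toO aeh) => x Hx Ox; rewrite /comp Hx.
have E2 : \sum_i ip O (pderiv i q) (comp tau i) = - ip O q (pdiv tau).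
  rewrite [ip O q _]ipC -Eq; apply: eq_bigr => i _.
  by rewrite compq ipC.
have E3 : ip O (fun x => uh x - u x) (pdiv tau) =
    ip O q (pdiv tau) - ip O u (pdiv tau).
  rewrite ipBl//; congr (_ - _); apply: ip_ae; last exact: aeW.
  exact: toO aeq.
have E4 : \sum_i ip O (fun x => comp sigmah i x - comp sigma i x) (comp tau i) =
    \sum_i ip O (comp sigmah i) (comp tau i) - \sum_i ip O (comp sigma i) (comp tau i).
  by rewrite -sumrB; apply: eq_bigr => i _; rewrite ipBl.
rewrite E1 E2 E3 E4 Es [ip O u _]ipC; ring.
Qed.

Lemma pdiv_sqr_le l (v : pt -> pt) : (forall i, polyfun l (comp v i)) ->
  ip O (pdiv v) (pdiv v) <=
  d%:R * \sum_i \sum_j \int[leb]_(x in simplex K) pderiv j (comp v i) x ^+ 2.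
Proof.
move=> pv; rewrite -sqr_osimplex//.
have mSK := measurable_simplex ndK.
have pdd i : polyfun (l.-1 * 2) (fun x => pderiv i (comp v i) x ^+ 2).
  by apply: polyfun_exp; exact: polyfun_pderiv.
apply: (@le_trans _ _ (d%:R * \sum_i \int[leb]_(x in simplex K) pderiv i (comp v i) x ^+ 2)).
  rewrite -(@Rintegral_sum _ _ R leb _ mSK _ _ (fun i x => pderiv i (comp v i) x ^+ 2)); last first.
    by move=> i; exact: polyfun_integrable_simplex (pdd i).
  have pS : polyfun (l.-1 * 2) (fun x => \sum_i pderiv i (comp v i) x ^+ 2).
    by apply: polyfun_sum => i _; exact: pdd.
  rewrite -RintegralZl//; last exact: polyfun_integrable_simplex pS.
  apply: le_Rintegral => //.
  - exact: polyfun_integrable_simplex (polyfun_exp 2 (polyfun_pdiv pv)).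
  - exact: polyfun_integrable_simplex (polyfunZ d%:R pS).
  - by move=> x _; exact: sqr_sum_le.
rewrite ler_wpM2l//; apply: ler_sum => i _; rewrite [leRHS](bigD1 i)//= lerDl.
by apply: sumr_ge0 => j _; apply: Rintegral_ge0 => x _; exact: sqr_ge0.
Qed.

End cell_polynomials.

(** * The a priori error estimate *)

Lemma ip_sub_le (R : realType) d (D : set 'rV[R]_d) (f g : 'rV[R]_d -> R) :
  measurable D -> L2 D f -> L2 D g ->
  ip D (fun x => f x - g x) (fun x => f x - g x) <= 2 * ip D f f + 2 * ip D g g.
Proof.
move=> mD Lf Lg; have Lfg := L2B mD Lf Lg.
have ff := L2_integrableM mD Lf Lf; have gg := L2_integrableM mD Lg Lg.
have iZ h : (lebesgue_rV d).-integrable D (EFin \o h) ->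
    (lebesgue_rV d).-integrable D (EFin \o (fun x => 2 * h x)).
  by move=> ih; exact: (integrableZl mD 2 ih).
rewrite /ip -!RintegralZl// -RintegralD//; [|exact: iZ|exact: iZ].
apply: le_Rintegral => //.
- exact: L2_integrableM.
- exact: (integrableD mD (iZ _ ff) (iZ _ gg)).
- by move=> x _; have := sqr_ge0 (f x + g x); rewrite expr2; nra.
Qed.

(** With W the residual and p the residual times the weight, D^2 |div tau|^2 is at
most M S, where S = |p|^2. In the identity for the residual, Young's inequality
with the parameters 1 and (M + 1) / D^2 leaves at most one half of S on the
right-hand side, which is absorbed. *)
Lemma cell_estimate (R : realType) (n' k : nat) (kappa : R) : exists2 C : R, 0 <= C &
  forall (Omega : set 'rV[R]_n'.+2) T lam lamh u uh us sigma sigmah sigmas,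
  polytope Omega -> triangulation Omega T ->
  laplace_eigenpair Omega lam u sigma -> discrete_eigenpair Omega T k lamh uh sigmah ->
  postprocessed_eigenfunction Omega T k uh sigmah us ->
  postprocessed_flux Omega T k lamh us sigmah sigmas ->
  forall K, K \in T -> diam (simplex K) <= kappa * indiam (simplex K) ->
  \sum_i ip (osimplex K) (comp (fun x => restrv K sigmas x - restrv K sigmah x) i)
                         (comp (fun x => restrv K sigmas x - restrv K sigmah x) i) <=
  C * (lamh * diam (simplex K)) ^+ 2 *
    (diam (simplex K) ^+ 2 *
       \sum_i ip (osimplex K) (fun x => comp sigmah i x - comp sigma i x)
                              (fun x => comp sigmah i x - comp sigma i x) +
     ip (osimplex K) (fun x => uh x - u x) (fun x => uh x - u x)).
Proof.
have [m Hm] := @weight_degree R n'.+1.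
have [C1 C10 H1] := @scaled_divergence R n'.+1 k.+3.
have [C2 C20 H2] := @scaled_poincare R n'.+1 k.+2.
have [C3 C30 H3] := @scaled_weight R n'.+1 k.+1.
have [C4 C40 H4] := @scaled_inverse R n'.+1 (m + k.+1).
pose M := n'.+2%:R * (C4 * kappa ^+ 2).
have M0 : 0 <= M by rewrite mulr_ge0// mulr_ge0// sqr_ge0.
exists (C1 * C2 * C3 * (2 * (M + 1))); first by rewrite !mulr_ge0// addr_ge0.
move=> Omega T lam lamh u uh us sigma sigmah sigmas pO tT eig eigh hus hss K KT reg.
have ndK : nondegenerate K by have [+ _ _ _] := tT; apply.
set O := osimplex K; have mO : measurable O := measurable_osimplex K.
set D := diam (simplex K) in reg *.
have D0 : 0 < D := diam_gt0 ndK.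
pose q := restr K uh; pose w := restr K us.
pose g x := w x - q x.
pose W i x := comp (restrv K sigmah) i x - pderiv i q x.
have pg : polyfun k.+2 g := correction_poly tT eigh hus KT.
have pW i : polyfun k.+1 (W i) := residual_poly tT eigh KT i.
have pdel i := flux_correction_poly tT eigh hss KT i.
have nfd := noflux_difference tT eigh hss KT.
set A := \sum_i ip O (fun x => comp sigmah i x - _) _.
set B := ip O (fun x => uh x - u x) _.
pose v0 x := restrv K sigmah x - grad q x.
have v0E i : comp v0 i = W i.
  by rewrite /v0 comp_sub; apply/funext => x; congr (_ - _); rewrite /comp mxE.
pose p x := weight K x *: v0 x.
have pE i : comp p i = fun x => weight K x * W i x by rewrite /p comp_scale v0E.
have pp i : polyfun (m + k.+1) (comp p i) by rewrite pE; exact: polyfunM.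
pose tau x := weight K x *: p x.
have tauE i : comp tau i = fun x => weight K x * comp p i x by rewrite /tau comp_scale.
have pt i : polyfun (m + (m + k.+1)) (comp tau i) by rewrite tauE; exact: polyfunM.
have Lt i : L2 O (comp tau i) by exact: L2_poly_osimplex ndK (pt i).
have Lpp i : L2 O (comp p i) by exact: L2_poly_osimplex ndK (pp i).
have Ld : L2 O (pdiv tau) by exact: L2_poly_osimplex ndK (polyfun_pdiv pt).
pose S := \sum_i ip O (comp p i) (comp p i).
have S0 : 0 <= S by apply: sumr_ge0 => i _; exact: ip_ge0.
have [Lu [Ls _] _ _] := eig; have [[Luh _] [[Lsh _] _] _ _] := eigh.
have Leu : L2 O (fun x => uh x - u x) by apply: L2B => //; exact: (L2_osimplex pO tT KT).
have Les i : L2 O (fun x => comp sigmah i x - comp sigma i x).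
  by apply: L2B => //; [exact: (L2_osimplex pO tT KT (Lsh i))|exact: (L2_osimplex pO tT KT (Ls i))].
have tau_le i : ip O (comp tau i) (comp tau i) <= ip O (comp p i) (comp p i).
  apply: le_Rintegral => //; [exact: L2_integrableM|exact: L2_integrableM|].
  move=> x Ox; have /andP[w0 w1] := weight_itv ndK (osimplex_sub ndK Ox).
  rewrite tauE mulrACA -[leRHS]mul1r ler_wpM2r//; first by rewrite -expr2 sqr_ge0.
  by rewrite mulr_ile1.
have divtau : D ^+ 2 * ip O (pdiv tau) (pdiv tau) <= M * S.
  have := pdiv_sqr_le tT KT pt.
  move=> /(ler_wpM2l (sqr_ge0 D)) /le_trans; apply.
  rewrite mulrCA /M -mulrA ler_wpM2l// !mulr_sumr; apply: ler_sum => i _.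
  rewrite tauE; have := H4 kappa K (comp p i) ndK reg (pp i).
  by rewrite sqr_osimplex.
have SE : \sum_i ip O (W i) (comp tau i) = S.
  by apply: eq_bigr => i _; apply: eq_Rintegral => x _; rewrite tauE pE; ring.
have Sle : D ^+ 2 * S <= 2 * (M + 1) * (D ^+ 2 * A + B).
  have SE' : S = \sum_i ip O (fun x => comp sigmah i x - comp sigma i x) (comp tau i) +
      ip O (fun x => uh x - u x) (pdiv tau).
    by rewrite -SE; exact: (residual_identity pO tT eigh KT eig pp).
  pose b := (M + 1) / D ^+ 2.
  have b0 : 0 < b by rewrite divr_gt0 ?exprn_gt0// ltr_wpDl.
  have Y1 : \sum_i ip O (fun x => comp sigmah i x - comp sigma i x) (comp tau i) <=
      A + 4^-1 * S.
    rewrite /A /S mulr_sumr -big_split; apply: ler_sum => i _ /=.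
    have := ip_young mO (Les i) (Lt i) (ltr01 : (0 : R) < 1); rewrite mul1r mulr1 => /le_trans; apply.
    by rewrite lerD2l ler_wpM2l// invr_ge0.
  have Y2 := ip_young mO Leu Ld b0.
  set X := ip O (pdiv tau) (pdiv tau) in divtau Y2.
  have X0 : 0 <= X by exact: ip_ge0.
  have Y3 : (4 * b)^-1 * X <= 4^-1 * S.
    have -> : (4 * b)^-1 * X = 4^-1 * ((D ^+ 2 * X) / (M + 1)).
      have Mn : M + 1 != 0 by rewrite gt_eqF// ltr_wpDl.
      by rewrite /b; field; rewrite ?Mn ?gt_eqF.
    rewrite ler_wpM2l ?invr_ge0// ler_pdivrMr; last exact: ltr_wpDl.
    by apply: le_trans divtau _; rewrite mulrC ler_wpM2l// lerDl.
  have Y4 : S <= 2 * A + 2 * b * B.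
    have -> : 2 * b * B = 2 * (b * B) by ring.
    by move: SE' Y1 Y2 Y3; rewrite -/B; lra.
  have A0 : 0 <= A by apply: sumr_ge0 => i _; exact: ip_ge0.
  have {}Y4 := ler_wpM2l (sqr_ge0 D) Y4; apply: le_trans Y4 _.
  have -> : D ^+ 2 * (2 * A + 2 * b * B) = 2 * (D ^+ 2 * A) + 2 * (M + 1) * B.
    by rewrite /b; field; rewrite gt_eqF.
  rewrite [leRHS]mulrDr lerD2r ler_wpM2r//; first by rewrite mulr_ge0// sqr_ge0.
  by rewrite ler_peMr// lerDr.
have g0 : \int[lebesgue_rV n'.+2]_(x in simplex K) g x = 0.
  have := projection_cell pO tT eigh hus KT (polyfun_cst k 1); rewrite -ip_osimplex// => <-.
  by apply: eq_Rintegral => x _; rewrite mulr1.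
have Wle : \sum_i ip O (W i) (W i) <= C3 * S.
  rewrite /S mulr_sumr; apply: ler_sum => i _; have := H3 K (W i) ndK (pW i).
  by rewrite !sqr_osimplex// pE.
have gle : ip O g g <= C2 * D ^+ 2 * (C3 * S).
  have := H2 K g ndK pg g0; rewrite sqr_osimplex// => /le_trans; apply.
  apply: ler_wpM2l; first by rewrite mulr_ge0// sqr_ge0.
  apply: le_trans _ Wle; apply: le_trans _ (grad_correction_min pO tT eigh hus KT).
  by apply: ler_sum => i _; rewrite sqr_osimplex.
have [v [pv nfv dv vle]] := H1 K _ ndK pdel nfd.
have divd : \int[lebesgue_rV n'.+2]_(x in simplex K)
    pdiv (fun x => restrv K sigmas x - restrv K sigmah x) x ^+ 2 = lamh ^+ 2 * ip O g g.
  transitivity (\int[lebesgue_rV n'.+2]_(x in O) (lamh ^+ 2 * (g x * g x))).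
    rewrite Rintegral_osimplex//; apply: eq_Rintegral => x _.
    by rewrite (pdiv_flux_correction pO tT eigh hus hss KT) -/q -/w -/(g x); ring.
  have Lg := L2_poly_osimplex ndK pg.
  by rewrite RintegralZl//; exact: L2_integrableM.
have := flux_correction_min tT eigh hss KT pv nfv dv.
move=> /le_trans; apply; have -> : \sum_i ip O (comp v i) (comp v i) =
    \sum_i \int[lebesgue_rV n'.+2]_(x in simplex K) comp v i x ^+ 2.
  by apply: eq_bigr => i _; rewrite sqr_osimplex.
apply: le_trans vle _; rewrite divd -/D.
have c0 : 0 <= C1 * D ^+ 2 * lamh ^+ 2 by rewrite mulr_ge0 ?sqr_ge0// mulr_ge0 ?sqr_ge0.
have := ler_wpM2l c0 gle; rewrite -[X in X <= _]mulrA => /le_trans; apply.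
have c1 : 0 <= C1 * D ^+ 2 * lamh ^+ 2 * (C2 * C3) by exact: mulr_ge0 c0 (mulr_ge0 C20 C30).
have := ler_wpM2l c1 Sle.
have -> : C1 * D ^+ 2 * lamh ^+ 2 * (C2 * C3) * (D ^+ 2 * S) =
  C1 * D ^+ 2 * lamh ^+ 2 * (C2 * D ^+ 2 * (C3 * S)) by ring.
move=> /le_trans; apply; rewrite le_eqVlt; apply/orP; left; apply/eqP; ring.
Qed.

Lemma diam_le_mesh (R : realType) d (T : seq 'M[R]_(d.+1, d)) K : K \in T ->
  diam (simplex K) <= mesh_size T.
Proof. by move=> KT; exact: (le_bigmax_seq 0 K xpredT (fun K => diam (simplex K)) KT). Qed.

(** The sum of the cell estimates, with each diameter bounded by the mesh size. *)
Lemma flux_estimate (R : realType) (n' k : nat) (kappa : R) : exists2 C : R, 0 <= C &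
  forall (Omega : set 'rV[R]_n'.+2) T lam lamh u uh us sigma sigmah sigmas,
  polytope Omega -> triangulation Omega T -> shape_regular kappa T ->
  laplace_eigenpair Omega lam u sigma -> discrete_eigenpair Omega T k lamh uh sigmah ->
  postprocessed_eigenfunction Omega T k uh sigmah us ->
  postprocessed_flux Omega T k lamh us sigmah sigmas ->
  vip Omega (sigma \- sigmas) (sigma \- sigmas) <=
  2 * vip Omega (sigma \- sigmah) (sigma \- sigmah) +
  C * (lamh * mesh_size T) ^+ 2 *
    (mesh_size T ^+ 2 * vip Omega (sigma \- sigmah) (sigma \- sigmah) +
     ip Omega (u \- uh) (u \- uh)).
Proof.
have [C C0 H] := @cell_estimate R n' k kappa; exists (2 * C); first exact: mulr_ge0.
move=> Omega T lam lamh u uh us sigma sigmah sigmas pO tT reg eig eigh hus hss.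
have ndT K : K \in T -> nondegenerate K by have [+ _ _ _] := tT; apply.
have mO : measurable Omega := open_rV_measurable (open_polytope pO).
have [Lu [Ls _] _ _] := eig; have [[Luh _] [[Lsh _] _] _ _] := eigh.
have [[[[Lss _] _] _] _ _ _] := hss.
set h := mesh_size T.
have Lsub (v v' : 'rV[R]_n'.+2 -> 'rV[R]_n'.+2) i : L2v Omega v -> L2v Omega v' ->
    L2 Omega (comp (v \- v') i).
  by move=> Lv Lv'; rewrite (comp_sub v v'); exact: L2B.
rewrite !vip_sum//; try by move=> i; exact: Lsub.
have E1 i : ip Omega (comp (sigma \- sigmas) i) (comp (sigma \- sigmas) i) <=
    2 * ip Omega (comp (sigma \- sigmah) i) (comp (sigma \- sigmah) i) +
    2 * ip Omega (comp (sigmas \- sigmah) i) (comp (sigmas \- sigmah) i).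
  have := ip_sub_le mO (Lsub _ _ i Ls Lsh) (Lsub _ _ i Lss Lsh).
  move=> /(le_trans _); apply; rewrite le_eqVlt; apply/orP; left; apply/eqP.
  by apply: eq_Rintegral => x _; rewrite !comp_sub; ring.
apply: (le_trans (ler_sum _ (fun i _ => E1 i))); rewrite big_split/= -!mulr_sumr lerD2l.
rewrite -(mulrA 2) -(mulrA 2) ler_wpM2l//.
have E2 i : ip Omega (comp (sigmas \- sigmah) i) (comp (sigmas \- sigmah) i) =
  \sum_(K <- undup T) ip (osimplex K) (comp (fun x => restrv K sigmas x - restrv K sigmah x) i)
                         (comp (fun x => restrv K sigmas x - restrv K sigmah x) i).
  rewrite (L2_osimplex_sum pO tT)//; try exact: Lsub.
  apply: eq_big_seq => K; rewrite mem_undup => KT.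
  have [_ aes] := sigmas_poly tT hss KT; have [_ aeh] := sigmah_poly tT eigh KT.
  suff ae : {ae lebesgue_rV n'.+2, forall x, osimplex K x -> comp (sigmas \- sigmah) i x =
      comp (fun x => restrv K sigmas x - restrv K sigmah x) i x} by exact: ip_ae.
  apply: filterS2 aes aeh => x H1 H2 Ox; have Kx := osimplex_sub (ndT _ KT) Ox.
  by rewrite !comp_sub /comp H1// H2.
rewrite [X in X <= _](eq_bigr _ (fun i _ => E2 i)) exchange_big/=.
pose F K := C * (lamh * diam (simplex K)) ^+ 2 *
    (diam (simplex K) ^+ 2 *
       \sum_i ip (osimplex K) (fun x => comp sigmah i x - comp sigma i x)
                              (fun x => comp sigmah i x - comp sigma i x) +
     ip (osimplex K) (fun x => uh x - u x) (fun x => uh x - u x)).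
apply: (@le_trans _ _ (\sum_(K <- undup T) F K)).
  rewrite big_seq [leRHS]big_seq; apply: ler_sum => K; rewrite mem_undup => KT.
  by apply: (H Omega T lam lamh u uh us sigma sigmah sigmas) => //; exact: reg.
pose G K := C * (lamh * h) ^+ 2 *
    (h ^+ 2 * \sum_i ip (osimplex K) (comp (sigma \- sigmah) i) (comp (sigma \- sigmah) i) +
     ip (osimplex K) (u \- uh) (u \- uh)).
apply: (@le_trans _ _ (\sum_(K <- undup T) G K)).
  rewrite big_seq [leRHS]big_seq; apply: ler_sum => K; rewrite mem_undup => KT.
  have D0 := diam_ge0 (ndT _ KT); have Dh := diam_le_mesh KT; have h0 := le_trans D0 Dh.
  rewrite /F /G.
  have -> : \sum_i ip (osimplex K) (fun x => comp sigmah i x - comp sigma i x)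
      (fun x => comp sigmah i x - comp sigma i x) =
      \sum_i ip (osimplex K) (comp (sigma \- sigmah) i) (comp (sigma \- sigmah) i).
    by apply: eq_bigr => i _; apply: eq_Rintegral => x _; rewrite !comp_sub; ring.
  have -> : ip (osimplex K) (fun x => uh x - u x) (fun x => uh x - u x) =
      ip (osimplex K) (u \- uh) (u \- uh).
    by apply: eq_Rintegral => x _ /=; ring.
  have s0 : 0 <= \sum_i ip (osimplex K) (comp (sigma \- sigmah) i) (comp (sigma \- sigmah) i).
    by apply: sumr_ge0 => i _; exact: ip_ge0.
  have DD : diam (simplex K) ^+ 2 <= h ^+ 2 by rewrite ler_sqr ?nnegrE.
  rewrite !exprMn; apply: ler_pM.
  - by rewrite mulr_ge0// mulr_ge0// sqr_ge0.
  - by rewrite addr_ge0 ?ip_ge0// mulr_ge0// sqr_ge0.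
  - by rewrite ler_wpM2l// ler_wpM2l// sqr_ge0.
  - by rewrite lerD2r ler_wpM2r.
rewrite /G -mulr_sumr mulrA big_split/= -mulr_sumr exchange_big/=.
rewrite le_eqVlt; apply/orP; left; apply/eqP; congr (_ * (_ * _ + _)).
  by apply: eq_bigr => i _; rewrite (L2_osimplex_sum pO tT)//; exact: Lsub.
by rewrite (L2_osimplex_sum pO tT)//; exact: L2B.
Qed.

Section norms.
Context {R : realType} {d : nat}.
Local Notation pt := 'rV[R]_d.
Local Notation leb := (@lebesgue_rV R d).

Lemma L2norm_sqrt (D : set pt) (f g : pt -> R) : (forall x, f x * f x = g x) ->
  leb.-integrable D (EFin \o g) -> measurable D ->
  L2norm D f = (Num.sqrt (\int[leb]_(x in D) g x))%:E.
Proof.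
move=> fg ig mD; rewrite /L2norm unlock /Lnorm.
have -> : (\int[leb]_x `|(EFin \o f \_ D) x| `^ 2 = \int[leb]_(x in D) (g x)%:E)%E.
  rewrite [RHS]integral_mkcond; apply: eq_integral => x _; rewrite /= !patchE; case: ifP => _ /=.
    by rewrite -fg powR_mulrn// -normrX expr2 ger0_norm// -expr2 sqr_ge0.
  by rewrite normr0 powR0// gt_eqF.
rewrite -[(\int[leb]_(x in D) _)%E]fineK; last exact: (integrable_fin_num mD ig).
by rewrite poweR_EFin powR12_sqrt//; apply: Rintegral_ge0 => x _; rewrite -fg -expr2 sqr_ge0.
Qed.

Lemma L2normE (D : set pt) (f : pt -> R) : measurable D -> L2 D f ->
  L2norm D f = (Num.sqrt (ip D f f))%:E.
Proof. by move=> mD Lf; apply: L2norm_sqrt => //; exact: L2_integrableM. Qed.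

Lemma L2vnormE (D : set pt) (tau : pt -> pt) : measurable D -> L2v D tau ->
  L2vnorm D tau = (Num.sqrt (vip D tau tau))%:E.
Proof.
move=> mD Lt; apply: L2norm_sqrt => //; first by move=> x; rewrite /= -expr2 sqr_enorm.
by apply: integrable_sumR => // i; exact: L2_integrableM (Lt i) (Lt i).
Qed.

End norms.

Theorem theorem1 (R : realType) (n k : nat) (Omega : set 'rV[R]_n.+1)
    (lam : R) (u : 'rV[R]_n.+1 -> R) (sigma : 'rV[R]_n.+1 -> 'rV[R]_n.+1)
    (kappa : R) (I : Type) (T : I -> seq 'M[R]_(n.+2, n.+1))
    (lamh : I -> R) (uh : I -> 'rV[R]_n.+1 -> R)
    (sigmah : I -> 'rV[R]_n.+1 -> 'rV[R]_n.+1)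
    (us : I -> 'rV[R]_n.+1 -> R)
    (sigmas : I -> 'rV[R]_n.+1 -> 'rV[R]_n.+1)
    (hdim : n.+1 = 2%N \/ n.+1 = 3%N)
    (hk : (1 <= k)%N)
    (hOmega : polytope Omega)
    (heig : laplace_eigenpair Omega lam u sigma)
    (hsimple : simple_eigenvalue Omega lam)
    (hu1 : L2norm Omega u = 1%E)
    (htri : forall i, triangulation Omega (T i))
    (hreg : forall i, shape_regular kappa (T i))
    (hmesh : forall e : R, 0 < e -> exists i, mesh_size (T i) < e)
    (heigh : forall i,
      discrete_eigenpair Omega (T i) k (lamh i) (uh i) (sigmah i))
    (huh1 : forall i, L2norm Omega (uh i) = 1%E)
    (hsign : forall i, 0 < ip Omega u (uh i))
    (hus : forall i, postprocessed_eigenfunction Omega (T i) k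
      (uh i) (sigmah i) (us i))
    (hsigmas : forall i, postprocessed_flux Omega (T i) k
      (lamh i) (us i) (sigmah i) (sigmas i)) :
  (forall i, {ae lebesgue_rV n.+1, forall x, Omega x ->
    - div Omega (sigmas i) x = lamh i * us i x}) /\
  (forall s : R, 2^-1 < s -> Hdiv Omega sigma -> Hsv Omega s sigma ->
    let h := fun i => mesh_size (T i) in
    let r := Num.min s k.+1%:R in
    let r' := Num.min s k.+2%:R in
    let N t := seminorm Omega t u in
    lesssim h (fun i => L2norm Omega (u \- uh i))
      (fun i => (h i `^ r)%:E * N (r + 1)%R)%E ->
    lesssim h (fun i => L2vnorm Omega (sigma \- sigmah i))
      (fun i => (h i `^ r')%:E * N (r' + 1)%R)%E ->
    lesssim h (fun i => L2norm Omega (div Omega (sigma \- sigmah i)))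
      (fun i => (h i `^ r)%:E * (N (r + 1)%R + N (r' + 1)%R))%E ->
    lesssim h (fun i => (`|lam - lamh i|)%:E)
      (fun i => (h i `^ (2 * r))%:E * (N (r + 1)%R + N (r' + 1)%R))%E ->
    lesssim h (fun i => L2vnorm Omega (sigma \- sigmas i))
      (fun i => (h i `^ r')%:E * (N (r + 1)%R + N (r' + 1)%R))%E).
Proof.
destruct n as [|n]; first by case: hdim.
have mO : measurable Omega := open_rV_measurable (open_polytope hOmega).
split.
  move=> i; apply: (ae_cells (htri i)) => K KT.
  have [_ aew] := us_poly (htri i) (hus i) KT.
  have ds := div_sigmas hOmega (htri i) (hsigmas i) KT.
  apply: filterS2 aew ds => x H1 H2 Kx.
  rewrite H1// H2// (pdiv_sigmas hOmega (htri i) (heigh i) (hus i) (hsigmas i) KT).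
  by rewrite mulNr opprK.
move=> s s2 _ _ h r r' N [C1 [h1 [C10 h10 H1]]] [C2 [h2 [C20 h20 H2]]] _ [C4 [h4 [C40 h40 H4]]].
have h0 i : 0 < h i.
  have := triangulation_neq_nil hOmega (htri i).
  case TE : (T i) => [//|K S] _; have KT : K \in T i by rewrite TE mem_head.
  have [ndT _ _ _] := htri i.
  by apply: lt_le_trans (diam_gt0 (ndT _ KT)) _; exact: diam_le_mesh.
have s0 : 0 < s by apply: lt_trans s2.
have r0 : 0 <= r by rewrite le_min (ltW s0) ler0n.
have rr' : r' <= r + 1.
  by rewrite /r /r' addr_minl natr1 le_min !ge_min lerDl ler01 lexx orbT.
have N0 t : (0 <= N t)%E.
  rewrite /N /seminorm; case: ifP => _ //; exact: poweR_ge0.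
have [C C0 HC] := @flux_estimate R n k kappa.
have [[a [b [[a0 b0] [Na Nb]]]]|Noo] : (exists a b, (0 <= a /\ 0 <= b) /\
    (N (r + 1) = a%:E /\ N (r' + 1) = b%:E)) \/ (N (r + 1)%R + N (r' + 1)%R = +oo)%E.
- move: (N0 (r + 1)) (N0 (r' + 1)).
  case: (N (r + 1)) => [a| |] //; case: (N (r' + 1)) => [b| |] //; rewrite ?lee_fin => a0 b0.
  + by left; exists a, b.
  + by right.
  + by right.
  + by right.
- pose L := `|lam| + C4 * (a + b); pose Q := 2 + C * L ^+ 2.
  have L0 : 0 <= L by rewrite addr_ge0// mulr_ge0 ?addr_ge0// ltW.
  have Q2 : 2 <= Q by rewrite lerDl mulr_ge0// sqr_ge0.
  have Q0 : 0 < Q by apply: lt_le_trans Q2.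
  exists (Q * (C1 + C2)), (Num.min (Num.min h1 h2) (Num.min h4 1)); split.
  + by rewrite mulr_gt0// addr_gt0.
  + by rewrite !lt_min h10 h20 h40 ltr01.
  move=> i; rewrite !lt_min => /andP[/andP[i1 i2] /andP[i4 /ltW i5]].
  have [Lu [Ls _] _ _] := heig; have [[Luh _] [[Lsh _] _] _ _] := heigh i.
  have [[[[Lss _] _] _] _ _ _] := hsigmas i.
  have Lsub (v v' : 'rV[R]_n.+2 -> 'rV[R]_n.+2) : L2v Omega v -> L2v Omega v' ->
      L2v Omega (v \- v').
    by move=> Lv Lv' j; rewrite (comp_sub v v'); exact: L2B.
  have := H1 i i1; have := H2 i i2; have := H4 i i4.
  rewrite (L2vnormE mO (Lsub _ _ Ls Lsh)) (L2vnormE mO (Lsub _ _ Ls Lss)) (L2normE mO (L2B mO Lu Luh)).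
  rewrite Na Nb -!EFinD -!EFinM !lee_fin.
  have := HC Omega (T i) lam (lamh i) u (uh i) (us i) sigma (sigmah i) (sigmas i) hOmega
    (htri i) (hreg i) heig (heigh i) (hus i) (hsigmas i).
  rewrite -/(h i).
  set A := vip Omega (sigma \- sigmah i) _; set B := ip Omega (u \- uh i) _.
  set E := vip Omega (sigma \- sigmas i) _ => HE Hl HA HB.
  set x := h i `^ r in HB *; set x' := h i `^ r' in HA *.
  have hi01 : 0 < h i <= 1 by rewrite h0.
  have x0 : 0 <= x by exact: powR_ge0.
  have x'0 : 0 <= x' by exact: powR_ge0.
  (* the extra power of the mesh size in front of the error of uh makes up for its
     lower order, because r' <= r + 1 *)
  have hx : h i * x <= x'.
    have -> : h i * x = h i `^ (r + 1).
      rewrite powRD; last by rewrite (gt_eqF (h0 i)) implybT.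
      by rewrite powRr1 1?mulrC// ltW.
    exact: ger_powR.
  have lamL : `|lamh i| <= L.
    rewrite -[lamh i](subKr lam) (le_trans (ler_normB _ _))// lerD2l (le_trans Hl)//.
    rewrite ler_wpM2l ?(ltW C40)// ler_piMl ?addr_ge0//.
    by rewrite -[leRHS](powRr0 (h i)); apply: ger_powR => //; rewrite mulr_ge0.
  have A0 : 0 <= A by apply: Rintegral_ge0 => y _; exact: dotxx_ge0.
  have B0 : 0 <= B by exact: ip_ge0.
  have sqr_le (y z : R) : 0 <= y -> Num.sqrt y <= z -> y <= z ^+ 2.
    by move=> y0 yz; rewrite -[leLHS]sqr_sqrtr// ler_sqr ?nnegrE ?sqrtr_ge0// (le_trans _ yz)// sqrtr_ge0.
  have {}HA := sqr_le _ _ A0 HA; have {}HB := sqr_le _ _ B0 HB.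
  set al := C2 * (x' * b) in HA.
  have hB : h i ^+ 2 * B <= (C1 * (x' * a)) ^+ 2.
    apply: le_trans (ler_wpM2l (sqr_ge0 _) HB) _; rewrite -exprMn ler_sqr ?nnegrE.
    - rewrite mulrCA ler_wpM2l ?(ltW C10)// mulrA ler_wpM2r//.
    - by rewrite !mulr_ge0// ltW.
    - by rewrite !mulr_ge0// ltW.
  have hA : h i ^+ 4 * A <= al ^+ 2.
    apply: le_trans _ HA; rewrite ler_piMl// exprn_ile1//; exact: ltW.
  have key : E <= (Q * (C1 + C2) * (x' * (a + b))) ^+ 2.
    apply: le_trans HE _.
    apply: (@le_trans _ _ (2 * al ^+ 2 + C * L ^+ 2 * (al ^+ 2 + (C1 * (x' * a)) ^+ 2))).
      rewrite lerD ?ler_wpM2l//.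
      have -> : C * (lamh i * h i) ^+ 2 * (h i ^+ 2 * A + B) =
          C * lamh i ^+ 2 * (h i ^+ 4 * A + h i ^+ 2 * B) by ring.
      rewrite ler_pM//.
      + by rewrite mulr_ge0// sqr_ge0.
      + by rewrite addr_ge0// mulr_ge0// exprn_ge0// ltW.
      + by rewrite ler_wpM2l// -[leLHS]real_normK ?num_real// ler_sqr ?nnegrE.
      + exact: lerD.
    apply: (@le_trans _ _ (Q * (al ^+ 2 + (C1 * (x' * a)) ^+ 2))).
      rewrite /Q [leRHS]mulrDl lerD2r ler_wpM2l// lerDl; exact: sqr_ge0.
    have -> : (Q * (C1 + C2) * (x' * (a + b))) ^+ 2 = Q * (Q * ((C1 + C2) * (x' * (a + b))) ^+ 2).
      by ring.
    rewrite ler_wpM2l ?(ltW Q0)//.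
    apply: (@le_trans _ _ (((C1 + C2) * (x' * (a + b))) ^+ 2)); last first.
      by rewrite ler_peMl ?sqr_ge0//; apply: le_trans Q2; rewrite ler1n.
    have -> : (C1 + C2) * (x' * (a + b)) = al + C1 * (x' * a) + (C1 * (x' * b) + C2 * (x' * a)).
      by rewrite /al; ring.
    have y1 : 0 <= al by rewrite /al !mulr_ge0// ltW.
    have y2 : 0 <= C1 * (x' * a) by rewrite !mulr_ge0// ltW.
    have y3 : 0 <= C1 * (x' * b) + C2 * (x' * a) by rewrite addr_ge0// !mulr_ge0// ltW.
    by move: (C1 * (x' * a)) (C1 * (x' * b) + C2 * (x' * a)) y2 y3 => y z y2 y3; nra.
  have {}key := ler_wsqrtr key; apply: le_trans key _.
  have C12 : 0 < Q * (C1 + C2) by rewrite mulr_gt0// addr_gt0.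
  rewrite sqrtr_sqr ger0_norm//; apply: mulr_ge0; first exact: ltW.
  exact: mulr_ge0 x'0 (addr_ge0 a0 b0).
  (* an infinite seminorm leaves nothing to prove, the mesh size being positive *)
- exists 1, 1; split => // i _; rewrite mul1e Noo gt0_muley ?leey//.
  by rewrite lte_fin powR_gt0.
Qed.
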